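(* Let $\Lambda,\Gamma\subseteq\{1,\ldots,n\}$, and let $\{\varphi_\lambda(z_\lambda)\}_{\lambda\in\Lambda}$ and $\{\psi_t(z_t)\}_{t\in\Gamma}$ be non-constant inner functions, $\varphi_\lambda$ depending only on the variable $z_\lambda$ and $\psi_t$ only on $z_t$. Let $$\mathcal{S}_{\Phi_\Lambda}=\sum_{\lambda\in\Lambda}\varphi_\lambda(z_\lambda)H^2(\mathbb{D}^n),\qquad \mathcal{S}_{\Psi_\Gamma}=\sum_{t\in\Gamma}\psi_t(z_t)H^2(\mathbb{D}^n)$$ be the corresponding submodules of $H^2(\mathbb{D}^n)$. Then $[P_{\mathcal{S}_{\Phi_\Lambda}},P_{\mathcal{S}_{\Psi_\Gamma}}]=0$ if and only if for every $j\in\Lambda\cap\Gamma$ either $\varphi_j\mid\psi_j$ or $\psi_j\mid\varphi_j$.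
   Context: Throughout $n\ge 2$. $H^2(\mathbb{D}^n)$ is the Hardy space of analytic functions $f$ on the unit polydisc $\mathbb{D}^n$ with $\|f\|=\sup_{0\le r<1}\big(\int_{\mathbb{T}^n}|f(r\boldsymbol z)|^2\,d\mu\big)^{1/2}<\infty$, where $\mu$ is normalized Lebesgue measure on $\mathbb{T}^n$. A submodule is a closed subspace of $H^2(\mathbb{D}^n)$ invariant under multiplication by each coordinate function $z_1,\ldots,z_n$. $P_{\mathcal{S}}$ is the orthogonal projection of $H^2(\mathbb{D}^n)$ onto a closed subspace $\mathcal{S}$, and $[A,B]:=AB-BA$. An inner function on $\mathbb{D}^n$ is a bounded analytic function on $\mathbb{D}^n$ whose boundary values have modulus $1$ almost everywhere on $\mathbb{T}^n$. For inner functions $\varphi,\psi$, $\varphi\mid\psi$ ($\varphi$ divides $\psi$) means $\psi=\varphi\eta$ for some inner function $\eta$. *)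

(* Defs.v *)
From HB Require Import structures.
From mathcomp Require Import all_boot all_order all_algebra.
From mathcomp Require Import all_classical all_reals all_analysis measurable_realfun.
From mathcomp.real_closed Require Import complex.

Set Implicit Arguments.
Unset Strict Implicit.
Unset Printing Implicit Defensive.

Import Order.TTheory GRing.Theory Num.Theory.
Import numFieldNormedType.Exports.

Local Open Scope classical_set_scope.
Local Open Scope ring_scope.
Local Open Scope complex_scope.

(* [normc z : R] is the modulus of [z : R[i]] as an element of [R]; the generic
   norm [`|z|] takes its values in [R[i]]. *)
Notation normc := ComplexField.Normc.normc.

(* The instances that make any [numFieldType] a normed module over itself are
   keyed on the structure projections, so they do not apply to [R[i]]. *)
#[non_forgetful_inheritance]
HB.instance Definition _ (R : realType) := PseudoPointedMetric.copy R[i] R[i]^o.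
#[non_forgetful_inheritance]
HB.instance Definition _ (R : realType) := NormedModule.copy R[i] R[i]^o.

Section torus.
Context {R : realType}.

Definition cons_tuple (n : nat)
    (p : measurableTypeR R * n.-tuple (measurableTypeR R)) :
  n.+1.-tuple (measurableTypeR R) := [tuple of p.1 :: p.2].

Lemma measurable_cons_tuple n : measurable_fun setT (@cons_tuple n).
Proof. exact: measurable_cons. Qed.

HB.instance Definition _ n := isMeasurableFun.Build _ _ _ _ (@cons_tuple n)
  (@measurable_cons_tuple n).

(* The torus T^n is parametrized by angles: [t] in [0, 1]^n stands for the point
   [torus_point t] = (e^(2 i pi t_1), ..., e^(2 i pi t_n)).  Under this
   parametrization, normalized Lebesgue measure on T^n is the n-fold product of
   the uniform probability on [0, 1]. *)
Fixpoint torus_measure (n : nat) : probability (n.-tuple (measurableTypeR R)) R :=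
  match n with
  | 0 => dirac [tuple]
  | m.+1 =>
    distribution (uniform_prob (@ltr01 R) \x torus_measure m)%E (@cons_tuple m)
  end.

Definition torus_point (n : nat) (t : n.-tuple (measurableTypeR R)) : 'rV[R[i]]_n :=
  \row_j (cos (2 * pi * tnth t j) +i* sin (2 * pi * tnth t j)).

End torus.

Section hardy.
Context {R : realType} {n : nat}.
Implicit Types (z w : 'rV[R[i]]_n) (f g h : 'rV[R[i]]_n -> R[i]).
Implicit Types (S : set ('rV[R[i]]_n -> R[i])).
Implicit Types (A B : ('rV[R[i]]_n -> R[i]) -> ('rV[R[i]]_n -> R[i])).

Definition polydisc : set 'rV[R[i]]_n := [set z | forall j, normc (z 0 j) < 1].

(* Functions on the polydisc are represented by total functions whose values
   outside the polydisc are irrelevant; equality between them is equality at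
   every point of [polydisc]. *)

Definition analytic f :=
  forall z, polydisc z -> differentiable f z.

(* The supremum over 0 <= r < 1 of the L^2 norm on T^n of z |-> f (r z). *)
Definition hardy_norm f : \bar R :=
  ereal_sup [set Lnorm (torus_measure n) 2%:E
                   (fun t => (normc (f (r%:C *: torus_point t)))%:E)
            | r in [set r : R | 0 <= r < 1]].

Definition hardy : set ('rV[R[i]]_n -> R[i]) :=
  [set f | analytic f /\ (hardy_norm f < +oo)%E].

(* The inner product inducing [hardy_norm], given by the polarization identity;
   it is linear in its first argument. *)
Definition hardy_inner f g : R[i] :=
  4^-1 * \sum_(k < 4)
    'i ^+ k * ((fine (hardy_norm (fun z => f z + 'i ^+ k * g z))) ^+ 2)%:C.

(* [hardy_proj S f] is the element of [S] whose difference with [f] is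
   orthogonal to [S].  It exists whenever [S] is a closed subspace, and it is
   then unique on the polydisc. *)
Definition hardy_proj S f : 'rV[R[i]]_n -> R[i] :=
  xget (fun=> 0)
    [set g | S g /\ forall h, S h -> hardy_inner (fun z => f z - g z) h = 0].

Definition commutator A B f : 'rV[R[i]]_n -> R[i] :=
  fun z => A (B f) z - B (A f) z.

Definition zero_operator A :=
  forall f, hardy f -> forall z, polydisc z -> A f z = 0.

(* The boundary values of a bounded analytic function are its radial limits. *)
Definition inner f :=
  [/\ analytic f,
      exists M : R, forall z, polydisc z -> normc (f z) <= M &
      {ae torus_measure n, forall t, exists l : R[i],
         f (r%:C *: torus_point t) @[r --> (1 : R)^'-] --> l
         /\ normc l = 1}].

Definition nonconstant f :=
  ~ exists c, forall z, polydisc z -> f z = c.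

Definition depends_only_on (j : 'I_n) f :=
  forall z w, polydisc z -> polydisc w -> z 0 j = w 0 j -> f z = f w.

Definition inner_divides f g :=
  exists h, inner h /\ forall z, polydisc z -> g z = f z * h z.

Definition sum_submodule (L : {set 'I_n}) (phi : 'I_n -> 'rV[R[i]]_n -> R[i]) :
  set ('rV[R[i]]_n -> R[i]) :=
  [set f | hardy f /\ exists2 g : 'I_n -> 'rV[R[i]]_n -> R[i],
     (forall l, l \in L -> hardy (g l)) &
     forall z, polydisc z -> f z = \sum_(l in L) phi l z * g l z].

End hardy.

(* Main.v *)
(** Proof idea. Let [E_k], [F_k] be the projections onto [phi_k H^2], [psi_k H^2].
    Distinct variables doubly commute, so the two projections are
    [1 - prod_k (1 - E_k)] and [1 - prod_k (1 - F_k)]; if one of [phi_j], [psi_j]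
    divides the other, then [E_j] and [F_j] are nested, so all factors commute.
    Conversely, let [C] be the commutator of [1 - E_j] and [1 - F_j].  Commutation
    of the full products makes the product of all other factors vanish on the
    range of [C]; restricting to functions independent of [z_k], one variable at a
    time, removes these factors, so [C = 0] on the functions of [z_j] alone.  In
    one variable, commuting projections onto [phi H^2] and [psi H^2] force one of
    the functions to divide the other.

    The identity [f(w) - f(w with w_k := 0) = w_k (S f)(w)], where [S] is the
    adjoint of multiplication by [z_k], comes from the reproducing kernels and
    replaces power series arguments. *)

From HB Require Import structures.
Require Import Defs.
From mathcomp Require Import all_boot all_order all_algebra.
From mathcomp Require Import all_classical all_reals all_analysis measurable_realfun.
From mathcomp.real_closed Require Import complex.
From mathcomp Require Import ring lra.

Set Implicit Arguments.
Unset Strict Implicit.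
Unset Printing Implicit Defensive.

Import Order.TTheory GRing.Theory Num.Theory.
Import numFieldNormedType.Exports.

Local Open Scope classical_set_scope.
Local Open Scope ring_scope.
Local Open Scope complex_scope.

(** The Hardy norm is a supremum over radii and the inner product is its polarization, so boundary
    values of Hardy functions are never formed: identities are proved on the torus for the dilations
    f(r z), which are continuous up to the boundary, and passed to the limit r -> 1. Inner functions
    enter only through their radial limits. Analyticity is pointwise complex differentiability,
    whence a Goursat argument behind Cauchy's formula. That formula yields the reproducing kernels
    and the self-adjointness of dilations, which takes the place of Parseval's identity.

    The argument with projections lives on an abstract Hilbert space with a family of shifts. Two
    points shape it. The products A and B of the factors other than the j-th need not commute, so
    commutation gives B A B C = 0, and A B C = 0 comes out of it by positivity. Removing the factors
    of z_k rests on their action on functions free of z_k: after setting z_k = 0 each acts as a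
    scalar 1 - |a|^2, where a is the value at 0 of the inner function; it is non-zero because that
    function is not constant. *)

Local Notation "z ^*" := (complex.conjc z) : ring_scope.
Local Notation "z ^*" := (complex.conjc z) : complex_scope.

(** * Complex modulus *)

Section complex_modulus.
Context {R : realType}.
Implicit Types (x y z : R[i]) (a b : R).

Lemma normc_sqrt z : normc z = Num.sqrt (complex.Re z ^+ 2 + complex.Im z ^+ 2).
Proof. by case: z. Qed.

Lemma normcP z : `|z| = (normc z)%:C.
Proof. by rewrite normc_def normc_sqrt. Qed.

Lemma normc_ge0 z : 0 <= normc z.
Proof. by rewrite normc_sqrt sqrtr_ge0. Qed.
Hint Resolve normc_ge0 : core.

Lemma sqr_normcE z : normc z ^+ 2 = complex.Re z ^+ 2 + complex.Im z ^+ 2.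
Proof. by rewrite normc_sqrt sqr_sqrtr// addr_ge0// sqr_ge0. Qed.

Lemma cReD x y : complex.Re (x + y) = complex.Re x + complex.Re y.
Proof. by case: x; case: y. Qed.

Lemma cImD x y : complex.Im (x + y) = complex.Im x + complex.Im y.
Proof. by case: x; case: y. Qed.

Lemma cReN x : complex.Re (- x) = - complex.Re x.
Proof. by case: x. Qed.

Lemma cImN x : complex.Im (- x) = - complex.Im x.
Proof. by case: x. Qed.

Lemma cReM x y : complex.Re (x * y) =
  complex.Re x * complex.Re y - complex.Im x * complex.Im y.
Proof. by case: x; case: y. Qed.

Lemma cImM x y : complex.Im (x * y) =
  complex.Re x * complex.Im y + complex.Im x * complex.Re y.
Proof. by case: x => a b; case: y. Qed.

Lemma cReJ x : complex.Re (x^*) = complex.Re x.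
Proof. by case: x. Qed.

Lemma cImJ x : complex.Im (x^*) = - complex.Im x.
Proof. by case: x. Qed.

Lemma complex_eqP x y :
  complex.Re x = complex.Re y -> complex.Im x = complex.Im y -> x = y.
Proof. by case: x => a b; case: y => c d /= -> ->. Qed.

Lemma normc0 : normc (0 : R[i]) = 0.
Proof. exact: ComplexField.Normc.normc0. Qed.

Lemma normc1 : normc (1 : R[i]) = 1.
Proof. exact: ComplexField.Normc.normc1. Qed.

Lemma normcM x y : normc (x * y) = normc x * normc y.
Proof. exact: ComplexField.Normc.normcM. Qed.

Lemma normcV x : normc (x^-1) = (normc x)^-1.
Proof. exact: ComplexField.Normc.normcV. Qed.

Lemma normcX x n : normc (x ^+ n) = normc x ^+ n.
Proof. by elim: n => [|n IH]; rewrite ?normc1// !exprS normcM IH. Qed.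

Lemma normc_prod (I : Type) (s : seq I) (P : pred I) (F : I -> R[i]) :
  normc (\prod_(i <- s | P i) F i) = \prod_(i <- s | P i) normc (F i).
Proof. by elim/big_rec2 : _ => [|i y x _ <-]; rewrite ?normc1 ?normcM. Qed.

Lemma normcN x : normc (- x) = normc x.
Proof. by rewrite !normc_sqrt cReN cImN !sqrrN. Qed.

Lemma normcBC x y : normc (x - y) = normc (y - x).
Proof. by rewrite -normcN opprB. Qed.

Lemma normcJ x : normc (x^*) = normc x.
Proof. by rewrite !normc_sqrt cReJ cImJ !sqrrN. Qed.

Lemma normc_real a : normc a%:C = `|a|.
Proof. by rewrite normc_sqrt /= expr0n addr0 sqrtr_sqr. Qed.

Lemma normcD x y : normc (x + y) <= normc x + normc y.
Proof. exact: le_normcD. Qed.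

Lemma normcB x y : normc (x - y) <= normc x + normc y.
Proof. by rewrite (le_trans (normcD _ _))// normcN. Qed.

Lemma normc_triangle y x z : normc (x - z) <= normc (x - y) + normc (y - z).
Proof. by rewrite (le_trans _ (normcD _ _))// addrA subrK. Qed.

Lemma normc_distl x y : `|normc x - normc y| <= normc (x - y).
Proof.
rewrite ler_norml; apply/andP; split.
  rewrite lerNl opprB lerBlDr normcBC.
  by rewrite -{1}(subrK x y) (le_trans (normcD _ _)).
by rewrite lerBlDr -{1}(subrK y x) (le_trans (normcD _ _)).
Qed.

Lemma normc_eq0 x : (normc x == 0) = (x == 0).
Proof.
apply/eqP/eqP => [|->]; last exact: normc0.
exact: ComplexField.Normc.eq0_normc.
Qed.

Lemma normc_gt0 x : (0 < normc x) = (x != 0).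
Proof. by rewrite lt_def normc_eq0 normc_ge0 andbT. Qed.

Lemma Re_le_normc x : `|complex.Re x| <= normc x.
Proof.
by rewrite -sqrtr_sqr normc_sqrt ler_wsqrtr// lerDl sqr_ge0.
Qed.

Lemma Im_le_normc x : `|complex.Im x| <= normc x.
Proof.
by rewrite -sqrtr_sqr normc_sqrt ler_wsqrtr// lerDr sqr_ge0.
Qed.

Lemma normc_le_ReIm x : normc x <= `|complex.Re x| + `|complex.Im x|.
Proof.
rewrite -[leRHS]ger0_norm ?addr_ge0// -sqrtr_sqr normc_sqrt ler_wsqrtr//.
rewrite sqrrD !real_normK ?num_real// lerD2r lerDl.
by rewrite mulrn_wge0// mulr_ge0.
Qed.

Lemma mulcJ x : x * x^* = (normc x ^+ 2)%:C.
Proof.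
apply: complex_eqP => /=; rewrite ?cReM ?cImM cReJ cImJ.
  by rewrite sqr_normcE mulrN opprK !expr2.
by rewrite mulrN mulrC addrC subrr.
Qed.

Lemma ge0_complexE x : 0 <= x -> x = (complex.Re x)%:C.
Proof. by case: x => a b; rewrite lecE /= => /andP[/eqP -> _]. Qed.

Lemma conjcD x y : (x + y)^* = x^* + y^*.
Proof. exact: rmorphD. Qed.

Lemma conjcB x y : (x - y)^* = x^* - y^*.
Proof. exact: rmorphB. Qed.

Lemma conjcN x : (- x)^* = - x^*.
Proof. exact: rmorphN. Qed.

Lemma conjcM x y : (x * y)^* = x^* * y^*.
Proof. exact: rmorphM. Qed.

Lemma conjc_prod (I : Type) (s : seq I) (P : pred I) (F : I -> R[i]) :
  (\prod_(i <- s | P i) F i)^* = \prod_(i <- s | P i) (F i)^*.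
Proof. exact: rmorph_prod. Qed.

Lemma normc_sub1_ge x : 1 - normc x <= normc (1 - x).
Proof.
by rewrite lerBlDr -{1}normc1 -{1}(subrK x 1) normcD.
Qed.

(* Choosing a rotation that makes [z] real turns bounds on real parts into a
   bound on the modulus. *)
Lemma normc_le_Re z a :
  (forall u, normc u = 1 -> complex.Re (u * z) <= a) -> normc z <= a.
Proof.
move=> H; have [z0|z0] := eqVneq z 0.
  by have := H 1 normc1; rewrite z0 mulr0 normc0.
have nz : normc z != 0 by rewrite normc_eq0.
have -> : normc z = complex.Re (((normc z)^-1)%:C * z^* * z).
  rewrite -mulrA [z^* * z]mulrC mulcJ -rmorphM /=.
  by rewrite expr2 mulrA mulVf// mul1r.
apply: H; rewrite normcM normc_real normcJ ger0_norm ?invr_ge0//.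
by rewrite mulVf.
Qed.

End complex_modulus.
#[global] Hint Resolve normc_ge0 : core.

(** * Complex-valued integrals *)

Section complex_integral.
Context d {T : measurableType d} {R : realType}.
Implicit Types (D : set T) (f g : T -> R[i]).

(** Measurability is stated for the real and imaginary parts because [cint] is assembled from two
    real integrals. *)
Definition cmeas D f :=
  measurable_fun D (fun t => complex.Re (f t)) /\
  measurable_fun D (fun t => complex.Im (f t)).

Lemma eq_cmeas D f g : {in D, f =1 g} -> cmeas D f -> cmeas D g.
Proof.
by move=> fg [mR mI]; split; [move: mR|move: mI];
  apply: eq_measurable_fun => t Dt; rewrite fg.
Qed.

Lemma cmeas_cst D c : cmeas D (cst c).
Proof. by split; exact: measurable_cst. Qed.

Lemma cmeasD D f g : cmeas D f -> cmeas D g -> cmeas D (fun t => f t + g t).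
Proof.
move=> [fR fI] [gR gI]; split.
  by under eq_fun do rewrite cReD; exact: measurable_funD.
by under eq_fun do rewrite cImD; exact: measurable_funD.
Qed.

Lemma cmeasN D f : cmeas D f -> cmeas D (fun t => - f t).
Proof.
move=> [fR fI]; split.
  by under eq_fun do rewrite cReN; exact: measurable_funN.
by under eq_fun do rewrite cImN; exact: measurable_funN.
Qed.

Lemma cmeasM D f g : cmeas D f -> cmeas D g -> cmeas D (fun t => f t * g t).
Proof.
move=> [fR fI] [gR gI]; split.
  under eq_fun do rewrite cReM.
  by apply: measurable_funB; exact: measurable_funM.
under eq_fun do rewrite cImM.
by apply: measurable_funD; exact: measurable_funM.
Qed.

Lemma cmeasJ D f : cmeas D f -> cmeas D (fun t => (f t)^*).
Proof.
move=> [fR fI]; split; first by under eq_fun do rewrite cReJ.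
by under eq_fun do rewrite cImJ; exact: measurable_funN.
Qed.

Lemma cmeas_sqr_normc D f : cmeas D f ->
  measurable_fun D (fun t => normc (f t) ^+ 2).
Proof.
move=> [fR fI]; under eq_fun do rewrite sqr_normcE.
by apply: measurable_funD; exact: measurable_funX.
Qed.

(** Boundedness is bundled with measurability: on a set of finite measure such functions are
    integrable, and unlike integrable functions they are stable under products. *)
Definition bmeas D f :=
  cmeas D f /\ exists M, forall t, D t -> normc (f t) <= M.

Lemma eq_bmeas D f g : {in D, f =1 g} -> bmeas D f -> bmeas D g.
Proof.
move=> fg [mf [M fM]]; split; first exact: (eq_cmeas fg).
by exists M => t Dt; rewrite -fg ?inE//; exact: fM.
Qed.

Lemma bmeas_cst D c : bmeas D (cst c).
Proof. by split; [exact: cmeas_cst|exists (normc c)]. Qed.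

Lemma bmeasD D f g : bmeas D f -> bmeas D g -> bmeas D (fun t => f t + g t).
Proof.
move=> [mf [M fM]] [mg [N gN]]; split; first exact: cmeasD.
by exists (M + N) => t Dt; rewrite (le_trans (normcD _ _))// lerD// ?fM// gN.
Qed.

Lemma bmeasN D f : bmeas D f -> bmeas D (fun t => - f t).
Proof.
move=> [mf [M fM]]; split; first exact: cmeasN.
by exists M => t Dt; rewrite normcN fM.
Qed.

Lemma bmeasB D f g : bmeas D f -> bmeas D g -> bmeas D (fun t => f t - g t).
Proof. by move=> mf mg; apply: bmeasD => //; exact: bmeasN. Qed.

Lemma bmeasM D f g : bmeas D f -> bmeas D g -> bmeas D (fun t => f t * g t).
Proof.
move=> [mf [M fM]] [mg [N gN]]; split; first exact: cmeasM.
by exists (M * N) => t Dt; rewrite normcM ler_pM// ?fM// gN.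
Qed.

Lemma bmeasZ D c f : bmeas D f -> bmeas D (fun t => c * f t).
Proof. by move=> mf; apply: (bmeasM (bmeas_cst D c)). Qed.

Lemma bmeasJ D f : bmeas D f -> bmeas D (fun t => (f t)^*).
Proof.
move=> [mf [M fM]]; split; first exact: cmeasJ.
by exists M => t Dt; rewrite normcJ fM.
Qed.

Lemma bmeas_prod D (I : Type) (s : seq I) (F : I -> T -> R[i]) :
  (forall i, bmeas D (F i)) -> bmeas D (fun t => \prod_(i <- s) F i t).
Proof.
move=> mF; elim: s => [|i s IH].
  by under eq_fun do rewrite big_nil; exact: bmeas_cst.
by under eq_fun do rewrite big_cons; exact: bmeasM.
Qed.

Variable mu : {measure set T -> \bar R}.

Definition cint D f : R[i] :=
  (\int[mu]_(t in D) complex.Re (f t)) +i* (\int[mu]_(t in D) complex.Im (f t)).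

Lemma eq_cint D f g : {in D, f =1 g} -> cint D f = cint D g.
Proof.
by move=> fg; congr (_ +i* _); apply: eq_Rintegral => t Dt; rewrite fg.
Qed.

Variable D : set T.
Hypothesis mD : measurable D.
Hypothesis muD : (mu D < +oo)%E.

Lemma bounded_measurable_integrable (h : T -> R) : measurable_fun D h ->
  (exists M, forall t, D t -> `|h t| <= M) -> mu.-integrable D (EFin \o h).
Proof.
move=> mh [M hM]; apply: measurable_bounded_integrable => //.
exists M; split; first exact: num_real.
by move=> x Mx t Dt /=; rewrite (le_trans (hM _ Dt))// ltW.
Qed.

Lemma integrable_Re f : bmeas D f ->
  mu.-integrable D (EFin \o (fun t => complex.Re (f t))).
Proof.
move=> [[mR _] [M fM]]; apply: bounded_measurable_integrable => //.
by exists M => t Dt; rewrite (le_trans (Re_le_normc _))// fM.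
Qed.

Lemma integrable_Im f : bmeas D f ->
  mu.-integrable D (EFin \o (fun t => complex.Im (f t))).
Proof.
move=> [[_ mI] [M fM]]; apply: bounded_measurable_integrable => //.
by exists M => t Dt; rewrite (le_trans (Im_le_normc _))// fM.
Qed.

Lemma cintD f g : bmeas D f -> bmeas D g ->
  cint D (fun t => f t + g t) = cint D f + cint D g.
Proof.
move=> mf mg; apply: complex_eqP => /=.
  rewrite -RintegralD//; [|exact: integrable_Re..].
  by apply: eq_Rintegral => t _; rewrite cReD.
rewrite -RintegralD//; [|exact: integrable_Im..].
by apply: eq_Rintegral => t _; rewrite cImD.
Qed.

Lemma cintZ c f : bmeas D f -> cint D (fun t => c * f t) = c * cint D f.
Proof.
move=> mf; apply: complex_eqP; rewrite ?cReM ?cImM /=.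
  rewrite -!RintegralZl//; [|exact: integrable_Im|exact: integrable_Re].
  rewrite -RintegralB//.
  - by apply: eq_Rintegral => t _; rewrite cReM.
  - exact: (integrableZl _ _ (integrable_Re mf)).
  - exact: (integrableZl _ _ (integrable_Im mf)).
rewrite -!RintegralZl//; [|exact: integrable_Re|exact: integrable_Im].
rewrite -RintegralD//.
- by apply: eq_Rintegral => t _; rewrite cImM.
- exact: (integrableZl _ _ (integrable_Im mf)).
- exact: (integrableZl _ _ (integrable_Re mf)).
Qed.

Lemma cintZr c f : bmeas D f -> cint D (fun t => f t * c) = cint D f * c.
Proof.
move=> mf; rewrite mulrC -cintZ//.
by apply: eq_cint => t _; rewrite mulrC.
Qed.

Lemma cintN f : bmeas D f -> cint D (fun t => - f t) = - cint D f.
Proof.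
move=> mf; rewrite -mulN1r -cintZ//.
by apply: eq_cint => t _; rewrite mulN1r.
Qed.

Lemma cintB f g : bmeas D f -> bmeas D g ->
  cint D (fun t => f t - g t) = cint D f - cint D g.
Proof. by move=> mf mg; rewrite cintD ?cintN//; exact: bmeasN. Qed.

Lemma cintJ f : bmeas D f -> cint D (fun t => (f t)^*) = (cint D f)^*.
Proof.
move=> mf; apply: complex_eqP; rewrite ?cReJ ?cImJ /=.
  by apply: eq_Rintegral => t _; rewrite cReJ.
rewrite -mulN1r -RintegralZl//; last exact: integrable_Im.
by apply: eq_Rintegral => t _; rewrite cImJ mulN1r.
Qed.

Lemma cint_cst c : cint D (cst c) = c * (fine (mu D))%:C.
Proof.
apply: complex_eqP; rewrite ?cReM ?cImM /= Rintegral_cst//.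
  by rewrite mulr0 subr0.
by rewrite mulr0 add0r.
Qed.

(** For unimodular [u], the real part of [u] times the integral is the integral of [Re (u f)], whose
    integrand is at most [M]; [normc_le_Re] turns this into a bound on the modulus. *)
Lemma normc_cint f M : bmeas D f -> (forall t, D t -> normc (f t) <= M) ->
  normc (cint D f) <= M * fine (mu D).
Proof.
move=> mf fM; apply: normc_le_Re => u u1.
rewrite -cintZ//= -(Rintegral_cst mu mD M); apply: le_Rintegral => //.
- exact: integrable_Re (bmeasZ u mf).
- by apply: (bounded_measurable_integrable (measurable_cst _)); exists `|M|.
- move=> t Dt; rewrite (le_trans (ler_norm _))// (le_trans (Re_le_normc _))//.
  by rewrite normcM u1 mul1r fM.
Qed.

End complex_integral.

Section complex_integral_probability.
Context d {T : measurableType d} {R : realType} (P : probability T R).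

Lemma probability_lty : (P setT < +oo)%E.
Proof. by rewrite probability_setT ltry. Qed.

Lemma normc_cint_prob (g : T -> R[i]) M :
  bmeas setT g -> (forall t, normc (g t) <= M) -> normc (cint P setT g) <= M.
Proof.
move=> mg gM; have := normc_cint measurableT probability_lty mg (fun t _ => gM t).
rewrite [fine _](_ : _ = 1) ?mulr1//.
exact: (congr1 fine (probability_setT P)).
Qed.

Lemma cint_prob_cst (c : R[i]) : cint P setT (cst c) = c.
Proof.
rewrite cint_cst// [fine _](_ : _ = 1) ?mulr1//.
exact: (congr1 fine (probability_setT P)).
Qed.

End complex_integral_probability.

Section complex_fubini.
Context d1 d2 {T1 : measurableType d1} {T2 : measurableType d2} {R : realType}.
Variables (P1 : probability T1 R) (P2 : probability T2 R).
Variable f : T1 * T2 -> R[i].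
Hypothesis mf : bmeas setT f.

Lemma bmeas_prod1 x : bmeas setT (fun y => f (x, y)).
Proof.
case: mf => -[mR mI] [M fM]; split; last by exists M => y _; exact: fM.
by split; [exact: (measurableT_comp mR)|exact: (measurableT_comp mI)].
Qed.

Lemma bmeas_prod2 y : bmeas setT (fun x => f (x, y)).
Proof.
case: mf => -[mR mI] [M fM]; split; last by exists M => x _; exact: fM.
by split; [exact: (measurableT_comp mR)|exact: (measurableT_comp mI)].
Qed.

Let P12 : ((P1 \x P2) [set: T1 * T2] < +oo)%E.
Proof. by rewrite probability_setT ltry. Qed.

Let iR : (P1 \x P2)%E.-integrable setT (EFin \o (fun z => complex.Re (f z))).
Proof. exact: integrable_Re. Qed.

Let iI : (P1 \x P2)%E.-integrable setT (EFin \o (fun z => complex.Im (f z))).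
Proof. exact: integrable_Im. Qed.

Let P1T : (P1 setT < +oo)%E.
Proof. by rewrite probability_setT ltry. Qed.

Let P2T : (P2 setT < +oo)%E.
Proof. by rewrite probability_setT ltry. Qed.

Lemma bmeas_cint2 : bmeas setT (fun y => cint P1 setT (fun x => f (x, y))).
Proof.
split; last first.
  have [_ [M fM]] := mf; exists M => x _; apply: normc_cint_prob.
    exact: bmeas_prod2.
  by move=> y; exact: fM.
split.
  have := measurable_fubini_G iR; rewrite /fubini_G => m1.
  exact: (measurableT_comp (@fine_measurable R _ measurableT) m1).
have := measurable_fubini_G iI; rewrite /fubini_G => m1.
exact: (measurableT_comp (@fine_measurable R _ measurableT) m1).
Qed.

Lemma cint_prod12 : cint (P1 \x P2)%E setT f =
  cint P1 setT (fun x => cint P2 setT (fun y => f (x, y))).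
Proof.
apply: complex_eqP => /=; rewrite /Rintegral.
  rewrite -(integral12_prod_meas1 iR)/=; congr fine.
  apply: eq_integral => x _ /=; rewrite /fubini_F fineK//.
  exact: integrable_fin_num (integrable_Re _ _ (bmeas_prod1 x)).
rewrite -(integral12_prod_meas1 iI)/=; congr fine.
apply: eq_integral => x _ /=; rewrite /fubini_F fineK//.
exact: integrable_fin_num (integrable_Im _ _ (bmeas_prod1 x)).
Qed.

Lemma cint_prod21 : cint (P1 \x P2)%E setT f =
  cint P2 setT (fun y => cint P1 setT (fun x => f (x, y))).
Proof.
apply: complex_eqP => /=; rewrite /Rintegral.
  rewrite -(integral21_prod_meas1 iR)/=; congr fine.
  apply: eq_integral => x _ /=; rewrite /fubini_G fineK//.
  exact: integrable_fin_num (integrable_Re _ _ (bmeas_prod2 x)).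
rewrite -(integral21_prod_meas1 iI)/=; congr fine.
apply: eq_integral => x _ /=; rewrite /fubini_G fineK//.
exact: integrable_fin_num (integrable_Im _ _ (bmeas_prod2 x)).
Qed.

End complex_fubini.

Section complex_pushforward.
Context d1 d2 {T1 : measurableType d1} {T2 : measurableType d2} {R : realType}.
Variables (P : probability T1 R) (phi : {mfun T1 >-> T2}).

Lemma cint_distribution (f : T2 -> R[i]) : bmeas setT f ->
  cint (distribution P phi) setT f = cint P setT (f \o phi).
Proof.
move=> [[mR mI] [M fM]].
have PT : (P setT < +oo)%E by rewrite probability_setT ltry.
have mp : measurable_fun setT phi by [].
have mf' : bmeas setT (f \o phi).
  split; last by exists M => t _; exact: fM.
  by split; [exact: (measurableT_comp mR)|exact: (measurableT_comp mI)].
apply: complex_eqP; rewrite /cint /Rintegral /=.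
  rewrite (integral_pushforward mp)//.
    exact/measurable_EFinP.
  exact: (integrable_Re _ PT mf').
rewrite (integral_pushforward mp)//.
  exact/measurable_EFinP.
exact: (integrable_Im _ PT mf').
Qed.

End complex_pushforward.

Section complex_dominated.
Context d {T : measurableType d} {R : realType}.
Variable P : probability T R.

Lemma bounded_cvg (h : nat -> T -> R) (g : T -> R) (M : R) :
  (forall n, measurable_fun setT (h n)) -> measurable_fun setT g ->
  {ae P, forall t, h ^~ t @ \oo --> g t} ->
  (forall n t, `|h n t| <= M) ->
  (fun n => \int[P]_t h n t) @ \oo --> \int[P]_t g t.
Proof.
move=> mh mg hg hM.
have [] := @dominated_convergence _ _ _ P _ measurableT
  (fun n t => (h n t)%:E) (EFin \o g) (cst M%:E).
- by move=> n; exact/measurable_EFinP.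
- exact/measurable_EFinP.
- apply: filterS hg => t ht _; apply: cvg_EFin ht; exact: nearW.
- suff : P.-integrable setT (EFin \o cst M) by [].
  apply: bounded_measurable_integrable => //; first exact: probability_lty.
  by exists `|M|.
- by apply: aeW => t n _; rewrite /= lee_fin hM.
move=> ig _ cv; apply: fine_cvg; rewrite fineK//.
exact: integrable_fin_num.
Qed.

End complex_dominated.

(** * Complex limits *)

Section complex_limits.
Context {R : realType} {T : Type} (F : set_system T) {FF : Filter F}.
Implicit Types (f g : T -> R[i]) (a b c : R[i]).

(** The norm of R[i] takes its values in R[i], but a positive element of R[i] is real, so real radii
    and [normc] describe the same neighbourhoods. *)
Lemma ccvgP f a :
  f @ F --> a <-> forall e : R, 0 < e -> \forall t \near F, normc (f t - a) < e.
Proof.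
split=> [/cvgrPdist_lt fa e e0|H].
  have := fa e%:C; rewrite ltcR => /(_ e0).
  by apply: filterS => t /=; rewrite normcP ltcR normcBC.
apply/cvgrPdist_lt => e e0.
have ee : e = (complex.Re e)%:C by apply: ge0_complexE; exact: ltW.
rewrite ee ltcR in e0 *; have := H _ e0.
by apply: filterS => t; rewrite [in X in _ -> X]normcP ltcR normcBC.
Qed.

Lemma ccvg_cst a : (fun _ : T => a) @ F --> a.
Proof. by apply/ccvgP => e e0; apply: nearW => t; rewrite subrr normc0. Qed.

Lemma ccvgD f g a b : f @ F --> a -> g @ F --> b ->
  (fun t => f t + g t) @ F --> a + b.
Proof. by move=> fa gb; exact: (@cvgD R[i] _ T F FF f g a b fa gb). Qed.

Lemma ccvgB f g a b : f @ F --> a -> g @ F --> b ->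
  (fun t => f t - g t) @ F --> a - b.
Proof. by move=> fa gb; exact: (@cvgB R[i] _ T F FF f g a b fa gb). Qed.

Lemma ccvgM f g a b : f @ F --> a -> g @ F --> b ->
  (fun t => f t * g t) @ F --> a * b.
Proof. by move=> fa gb; exact: (@cvgM R[i] T F FF f g a b fa gb). Qed.

Lemma ccvgV f a : a != 0 -> f @ F --> a -> (fun t => (f t)^-1) @ F --> a^-1.
Proof. by move=> a0 fa; exact: (@cvgV R[i] T F FF f a a0 fa). Qed.

Lemma ccvgJ f a : f @ F --> a -> (fun t => (f t)^*) @ F --> a^*.
Proof.
move=> /ccvgP fa; apply/ccvgP => e /fa; apply: filterS => t.
by rewrite -conjcB normcJ.
Qed.

Lemma ccvg_normc f a : f @ F --> a -> (fun t => normc (f t)) @ F --> normc a.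
Proof.
move=> /ccvgP fa; apply/cvgrPdist_lt => e /fa; apply: filterS => t.
by apply: le_lt_trans; rewrite distrC normc_distl.
Qed.

Lemma ccvg_prod (I : Type) (s : seq I) (h : I -> T -> R[i]) (a : I -> R[i]) :
  (forall i, h i @ F --> a i) ->
  (fun t => \prod_(i <- s) h i t) @ F --> \prod_(i <- s) a i.
Proof.
move=> ha; elim: s => [|i s IH].
  by rewrite big_nil; under eq_fun do rewrite big_nil; exact: ccvg_cst.
by rewrite big_cons; under eq_fun do rewrite big_cons; exact: (ccvgM (ha i) IH).
Qed.

Lemma ccvg_real (f : T -> R) (a : R) : f @ F --> a ->
  (fun t => (f t)%:C) @ F --> a%:C.
Proof.
move=> /cvgrPdist_lt fa; apply/ccvgP => e /fa; apply: filterS => t.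
by rewrite -rmorphB normc_real distrC.
Qed.

Lemma ccvg_Complex (f g : T -> R) (a b : R) : f @ F --> a -> g @ F --> b ->
  (fun t => f t +i* g t) @ F --> a +i* b.
Proof.
have E (x y : R) : x +i* y = x%:C + 'i * y%:C := complexE (x +i* y).
move=> fa gb; rewrite E; under eq_fun do rewrite E.
exact: (ccvgD (ccvg_real fa) (ccvgM (ccvg_cst (a := 'i)) (ccvg_real gb))).
Qed.

Lemma ccvg_Re f a : f @ F --> a ->
  (fun t => complex.Re (f t)) @ F --> complex.Re a.
Proof.
move=> /ccvgP fa; apply/cvgrPdist_lt => e /fa; apply: filterS => t.
by apply: le_lt_trans; rewrite distrC -cReN -cReD Re_le_normc.
Qed.

Lemma ccvg_Im f a : f @ F --> a ->
  (fun t => complex.Im (f t)) @ F --> complex.Im a.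
Proof.
move=> /ccvgP fa; apply/cvgrPdist_lt => e /fa; apply: filterS => t.
by apply: le_lt_trans; rewrite distrC -cImN -cImD Im_le_normc.
Qed.

End complex_limits.

Section complex_neighbourhoods.
Context {R : realType}.
Implicit Types (z w : R[i]) (g : R[i] -> R[i]).

Lemma near_normcP z (P : R[i] -> Prop) :
  (\forall x \near z, P x) <->
  exists2 e : R, 0 < e & forall x, normc (x - z) < e -> P x.
Proof.
split=> [/nbhs_normP[e /= e0 eP]|[e e0 eP]].
  have ee : e = (complex.Re e)%:C by apply: ge0_complexE; exact: ltW.
  exists (complex.Re e); first by rewrite -ltcR -ee.
  move=> x xz; apply: eP => /=.
  by rewrite ee normcP ltcR normcBC.
apply/nbhs_normP; exists e%:C => /=; first by rewrite ltcR.
by move=> x /=; rewrite normcP ltcR normcBC => /eP.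
Qed.

(** Complex differentiability in one variable, with the derivative [B] quantified away. The bound is
    non-strict so that it includes x = z. *)
Definition cdiff g z := exists B, forall e : R, 0 < e ->
  \forall x \near z, normc (g x - g z - B * (x - z)) <= e * normc (x - z).

Lemma cdiff_continuous g z : cdiff g z -> g x @[x --> z] --> g z.
Proof.
move=> [B /(_ 1 ltr01) gB]; apply/(@ccvgP _ _ (nbhs z)) => e e0.
apply/near_normcP; move/near_normcP: gB => [d d0 gB].
pose k := 1 + normc B; have k0 : 0 < k by rewrite ltr_pwDl// normc_ge0.
exists (Num.min d (e / k)) => [|x]; first by rewrite lt_min d0 divr_gt0.
rewrite lt_min => /andP[/gB gx xz].
rewrite -(subrK (B * (x - z)) (g x - g z)).
rewrite (le_lt_trans (normcD _ _))// normcM.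
rewrite (@le_lt_trans _ _ (k * normc (x - z)))//.
  by rewrite mulrDl lerD2r.
by rewrite mulrC -ltr_pdivlMr.
Qed.

End complex_neighbourhoods.

Section within_continuity.
Context {R : realType} {T : topologicalType} (A : set T).
Implicit Types h k : T -> R[i].

Definition cwithin h := forall x, A x -> h @ within A (nbhs x) --> h x.

Lemma cwithin_continuous h : (forall x, h y @[y --> x] --> h x) -> cwithin h.
Proof. by move=> ch x Ax; apply: cvg_within_filter; exact: ch. Qed.

End within_continuity.

(** * Integrals of continuous functions over intervals *)

Section interval_integral.
Context {R : realType}.
Implicit Types (a b c : R) (h k : R -> R[i]).
Notation leb := (@lebesgue_measure R).

Lemma cwithin_bmeas a b h : cwithin `[a, b] h -> bmeas `[a, b] h.
Proof.
move=> ch.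
have cR : {within `[a, b], continuous (fun t => complex.Re (h t))}.
  by apply/subspace_continuousP => x xab; apply: ccvg_Re; exact: ch.
have cI : {within `[a, b], continuous (fun t => complex.Im (h t))}.
  by apply/subspace_continuousP => x xab; apply: ccvg_Im; exact: ch.
split.
  by split; apply: subspace_continuous_measurable_fun.
have bd (f : R -> R) : {within `[a, b], continuous f} ->
    exists M, forall t, `[a, b]%classic t -> `|f t| <= M.
  move=> cf; have := continuous_compact cf (@segment_compact _ a b).
  move=> /compact_bounded [M [_ HM]]; exists (M + 1) => t tab.
  by apply: (HM (M + 1)); [rewrite ltrDl|exists t].
have [M HM] := bd _ cR; have [N HN] := bd _ cI.
exists (M + N) => t tab; rewrite (le_trans (normc_le_ReIm _))//.
by rewrite lerD ?HM ?HN.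
Qed.

Definition iint a b h : R[i] := cint leb `[a, b] h.

Lemma lebesgue_itv_lty a b : (leb `[a, b] < +oo)%E.
Proof.
by rewrite lebesgue_measure_itv/=; case: ifP => // _; rewrite -EFinB ltry.
Qed.

Lemma fine_lebesgue_itv a b : a <= b -> fine (leb `[a, b]) = b - a.
Proof.
rewrite le_eqVlt => /predU1P[->|ab]; rewrite lebesgue_measure_itv/= lte_fin.
  by rewrite ltxx subrr.
by rewrite ab.
Qed.

Lemma normc_iint a b h M : a <= b -> bmeas `[a, b] h ->
  (forall t, a <= t <= b -> normc (h t) <= M) ->
  normc (iint a b h) <= M * (b - a).
Proof.
move=> ab mh hM; rewrite -fine_lebesgue_itv//.
exact: (normc_cint _ (lebesgue_itv_lty a b)).
Qed.

Lemma eq_iint a b h k : (forall t, a <= t <= b -> h t = k t) ->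
  iint a b h = iint a b k.
Proof.
by move=> hk; apply: eq_cint => t; rewrite inE/= in_itv/= => /hk.
Qed.

Lemma iint_split a b c h : a <= b <= c -> bmeas `[a, c] h ->
  iint a c h = iint a b h + iint b c h.
Proof.
move=> /andP[ab bc] mh.
have iR : leb.-integrable `[a, c] (EFin \o (fun t => complex.Re (h t))).
  exact: (integrable_Re _ (lebesgue_itv_lty a c) mh).
have iI : leb.-integrable `[a, c] (EFin \o (fun t => complex.Im (h t))).
  exact: (integrable_Im _ (lebesgue_itv_lty a c) mh).
have sub : `[b, c] `<=` `[a, c].
  by move=> x /=; rewrite !in_itv/= => /andP[bx ->]; rewrite (le_trans ab bx).
have main (f : R -> R) : leb.-integrable `[a, c] (EFin \o f) ->
    \int[leb]_(t in `[a, c]) f t =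
    \int[leb]_(t in `[a, b]) f t + \int[leb]_(t in `[b, c]) f t.
  move=> mf; have := @Rintegral_itvB _ f (BLeft a) (BRight c) b mf.
  rewrite !bnd_simp => /(_ ab bc) H.
  have mf' : leb.-integrable `]b, c] (EFin \o f).
    apply: (@integrableS _ _ _ leb `[a, c] `]b, c]) mf => //.
    apply: subset_trans sub.
    by move=> x /=; rewrite !in_itv/= => /andP[/ltW -> ->].
  have E := @Rintegral_itv_obnd_cbnd _ b (BRight c) f mf'.
  by rewrite -E -H addrC subrK.
by apply: complex_eqP; [rewrite cReD /= main|rewrite cImD /= main].
Qed.

End interval_integral.

(** * Cauchy's formula on the disc *)

Section bisection.
Context {R : realType}.
Variables (a0 b0 c0 d0 : R) (D : R -> R -> R -> R -> R[i]).
Hypothesis ab0 : a0 < b0.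
Hypothesis cd0 : c0 < d0.
Hypothesis Dsplit1 : forall a m b c d, a0 <= a -> a <= m -> m <= b -> b <= b0 ->
  c0 <= c -> c <= d -> d <= d0 -> D a b c d = D a m c d + D m b c d.
Hypothesis Dsplit2 : forall a b c m d, a0 <= a -> a <= b -> b <= b0 ->
  c0 <= c -> c <= m -> m <= d -> d <= d0 -> D a b c d = D a b c m + D a b m d.
Hypothesis Dsmall : forall s t, a0 <= s <= b0 -> c0 <= t <= d0 ->
  forall e : R, 0 < e -> exists2 del : R, 0 < del &
  forall a b c d, a0 <= a <= s -> s <= b <= b0 -> c0 <= c <= t -> t <= d <= d0 ->
    b - a < del -> d - c < del ->
    normc (D a b c d) <= e * ((b - a) + (d - c)) ^+ 2.

Let l1 := b0 - a0.
Let l2 := d0 - c0.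
Let u m : R := 2^-1 ^+ m.

Let uS m : u m = u m.+1 + u m.+1.
Proof. by rewrite /u exprS; lra. Qed.

Let u_gt0 m : 0 < u m.
Proof. by rewrite exprn_gt0// invr_gt0. Qed.

Let l1_gt0 : 0 < l1. Proof. by rewrite subr_gt0. Qed.
Let l2_gt0 : 0 < l2. Proof. by rewrite subr_gt0. Qed.

Let eta := normc (D a0 b0 c0 d0).

(** A node [(m, (a, c))] stands for the rectangle with lower corner (a, c) and sides [l1] and [l2]
    divided by 2^m. It is good if it lies in the initial rectangle and |D| has lost at most a factor
    4 per halving. *)
Let good (x : nat * (R * R)) :=
  [/\ a0 <= x.2.1, x.2.1 + l1 * u x.1 <= b0, c0 <= x.2.2, x.2.2 + l2 * u x.1 <= d0 &
   eta * u x.1 ^+ 2 <= normc (D x.2.1 (x.2.1 + l1 * u x.1) x.2.2 (x.2.2 + l2 * u x.1))].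

Let nested (x y : nat * (R * R)) :=
  [/\ y.1 = x.1.+1, x.2.1 <= y.2.1, y.2.1 + l1 * u y.1 <= x.2.1 + l1 * u x.1,
      x.2.2 <= y.2.2 & y.2.2 + l2 * u y.1 <= x.2.2 + l2 * u x.1].

(** One of the four quarters carries at least a quarter of |D|. The hypothesis [good x] stands under
    the existential so that [choice] yields a total successor function. *)
Let step x : exists y, good x -> good y /\ nested x y.
Proof.
have [gx|?] := pselect (good x); last by exists x.
case: x gx => m [a c] [/= aa0 bb0 cc0 dd0 big].
set h := l1 * u m.+1; set k := l2 * u m.+1.
have h0 : 0 <= h by rewrite ltW// mulr_gt0.
have k0 : 0 <= k by rewrite ltW// mulr_gt0.
have bE : a + l1 * u m = a + h + h by rewrite uS mulrDr addrA.
have dE : c + l2 * u m = c + k + k by rewrite uS mulrDr addrA.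
rewrite bE dE in big bb0 dd0.
have ah : a <= a + h by rewrite lerDl.
have ahh : a + h <= a + h + h by rewrite lerDl.
have ck : c <= c + k by rewrite lerDl.
have ckk : c + k <= c + k + k by rewrite lerDl.
have [aah cck] := (le_trans aa0 ah, le_trans cc0 ck).
have [bbh ddk] := (le_trans ahh bb0, le_trans ckk dd0).
rewrite (@Dsplit1 a (a + h)) ?(le_trans ck)// in big.
rewrite (@Dsplit2 a (a + h) c (c + k))// in big.
rewrite (@Dsplit2 (a + h) (a + h + h) c (c + k))// in big.
have small : eta * u m ^+ 2 = 4 * (eta * u m.+1 ^+ 2).
  by rewrite [u m]uS; ring.
have {big} : [\/ eta * u m.+1 ^+ 2 <= normc (D a (a + h) c (c + k)),
  eta * u m.+1 ^+ 2 <= normc (D a (a + h) (c + k) (c + k + k)),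
  eta * u m.+1 ^+ 2 <= normc (D (a + h) (a + h + h) c (c + k)) |
  eta * u m.+1 ^+ 2 <= normc (D (a + h) (a + h + h) (c + k) (c + k + k))].
  rewrite small in big.
  set x := eta * _ in big *.
  case: (leP x (normc (D a (a + h) c (c + k)))) => [?|x1]; first by apply: Or41.
  case: (leP x (normc (D a (a + h) (c + k) (c + k + k)))) => [?|x2].
    by apply: Or42.
  case: (leP x (normc (D (a + h) (a + h + h) c (c + k)))) => [?|x3].
    by apply: Or43.
  case: (leP x (normc (D (a + h) (a + h + h) (c + k) (c + k + k)))) => [?|x4].
    by apply: Or44.
  exfalso; move: big; apply/negP; rewrite -ltNge.
  rewrite (le_lt_trans (normcD _ _))//.
  rewrite (_ : 4 * x = (x + x) + (x + x)); last by ring.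
  by rewrite ltrD// (le_lt_trans (normcD _ _))// ltrD.
case=> big.
- by exists (m.+1, (a, c)) => _; do !split => //=; rewrite ?bE ?dE -/h -/k ?lerD2r.
- exists (m.+1, (a, c + k)) => _; do !split => //=; rewrite ?bE ?dE -/h -/k ?lerD2r//.
- exists (m.+1, (a + h, c)) => _; do !split => //=; rewrite ?bE ?dE -/h -/k ?lerD2r//.
- exists (m.+1, (a + h, c + k)) => _; do !split => //=; rewrite ?bE ?dE -/h -/k ?lerD2r//.
Qed.

(** Goursat's argument for an arbitrary additive function of rectangles: repeated halving leads to
    nested good rectangles, and at their common point [Dsmall] contradicts the lower bound
    [eta * u m ^+ 2] unless [eta = 0]. *)
Lemma bisection : D a0 b0 c0 d0 = 0.
Proof.
apply/eqP; rewrite -normc_eq0 -/eta eq_le normc_ge0 andbT leNgt.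
apply/negP => eta0.
have [f fP] := choice step.
pose x_ m := iter m f (0%N, (a0, c0)).
have u0 : u 0 = 1 by rewrite /u expr0.
have l1E : a0 + l1 * u 0 = b0 by rewrite u0 mulr1 /l1 addrC subrK.
have l2E : c0 + l2 * u 0 = d0 by rewrite u0 mulr1 /l2 addrC subrK.
have good0 : good (x_ 0%N).
  by rewrite /good /= l1E l2E u0 expr1n mulr1; split.
have x_0 : x_ 0%N = (0%N, (a0, c0)) by [].
have x_S m : x_ m.+1 = f (x_ m) by [].
have goodx m : good (x_ m).
  elim: m => [|m IH]; first exact: good0.
  by rewrite x_S; exact: (fP _ IH).1.
have nest m : nested (x_ m) (x_ m.+1).
  by rewrite x_S; exact: (fP _ (goodx m)).2.
clearbody x_.
have lev m : (x_ m).1 = m.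
  elim: m => [|m IH]; first by rewrite x_0.
  by have [-> _ _ _ _] := nest m; rewrite IH.
pose a_ m := (x_ m).2.1; pose c_ m := (x_ m).2.2.
have ndP (v : nat -> R) (l : R) : 0 <= l -> (forall m, v m <= v m.+1) ->
    (forall m, v m.+1 + l * u m.+1 <= v m + l * u m) ->
    exists s, forall m, v m <= s <= v m + l * u m.
  move=> l0 nd ni.
  have lu m : 0 <= l * u m by rewrite mulr_ge0// ltW.
  have nd' m k : v m <= v (m + k)%N.
    by elim: k => [|k IH]; rewrite ?addn0// addnS (le_trans IH).
  have ni' m k : v (m + k)%N + l * u (m + k)%N <= v m + l * u m.
    by elim: k => [|k IH]; rewrite ?addn0// addnS (le_trans (ni _)).
  have ub k m : v k <= v m + l * u m.
    have [km|mk] := leqP k m.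
      by rewrite -(subnK km) addnC (le_trans (nd' _ (m - k)%N))// lerDl.
    rewrite -(subnK (ltnW mk)) addnC (le_trans _ (ni' m (k - m)%N))//.
    by rewrite lerDl.
  exists (sup (range v)) => m; apply/andP; split.
    apply: ub_le_sup; last by exists m.
    by exists (v 0%N + l * u 0%N) => _ [k _ <-].
  apply: ge_sup; first by exists (v 0%N); exists 0%N.
  by move=> _ [k _ <-].
have [s sP] : exists s, forall m, a_ m <= s <= a_ m + l1 * u m.
  apply: ndP => [|m|m]; first exact: ltW.
    by have [] := nest m.
  by have [_ _ + _ _] := nest m; rewrite !lev.
have [t tP] : exists t, forall m, c_ m <= t <= c_ m + l2 * u m.
  apply: ndP => [|m|m]; first exact: ltW.
    by have [] := nest m.
  by have [_ _ _ _] := nest m; rewrite !lev.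
have s0 : a0 <= s <= b0.
  by have := sP 0%N; rewrite /a_ x_0 l1E.
have t0 : c0 <= t <= d0.
  by have := tP 0%N; rewrite /c_ x_0 l2E.
have l12 : 0 < l1 + l2 by rewrite addr_gt0.
(* With this [e] the bound of [Dsmall] on the m-th rectangle is half of the lower bound
   [eta * u m ^+ 2]. *)
pose e := eta / (2 * (l1 + l2) ^+ 2).
have e0 : 0 < e by rewrite divr_gt0// mulr_gt0// exprn_gt0.
have [del del0 Dd] := Dsmall s0 t0 e0.
have [m mP] : exists m, (l1 + l2) * u m < del.
  exists (Num.bound ((l1 + l2) / del)).
  set N := Num.bound _.
  have NP : (l1 + l2) / del < N%:R.
    by rewrite archi_boundP// divr_ge0// ltW.
  rewrite /u exprVn ltr_pdivrMr ?exprn_gt0// mulrC -ltr_pdivrMr//.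
  rewrite (lt_trans NP)// -natrX ltr_nat.
  by rewrite ltn_expl.
have [/= aa0 bb0 cc0 dd0] := goodx m; rewrite !lev => big.
rewrite !lev in bb0 dd0; rewrite -/(a_ m) -/(c_ m) in big aa0 bb0 cc0 dd0.
have /andP[as_ sb] := sP m; have /andP[ct td] := tP m.
have small : normc (D (a_ m) (a_ m + l1 * u m) (c_ m) (c_ m + l2 * u m)) <=
    e * ((l1 + l2) * u m) ^+ 2.
  have := Dd (a_ m) (a_ m + l1 * u m) (c_ m) (c_ m + l2 * u m).
  rewrite aa0 as_ sb bb0 cc0 ct td dd0 ![_ + _ - _]addrC !addKr -mulrDl.
  by apply => //; apply: le_lt_trans mP;
    rewrite ler_pM2r ?u_gt0// ?lerDl ?lerDr; exact: ltW.
have := le_trans big small.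
have eE : e * (l1 + l2) ^+ 2 = eta / 2.
  by rewrite /e; field; rewrite gt_eqF.
have etaU : 0 < eta * u m ^+ 2 by rewrite mulr_gt0// exprn_gt0.
rewrite exprMn [leRHS]mulrA eE; move: etaU; set U := u m ^+ 2; clearbody U eta.
by move=> ? ?; lra.
Qed.

End bisection.

(** * The parametrized unit circle *)

Section circle.
Context {R : realType}.
Notation leb := (@lebesgue_measure R).

Definition cis (t : R) : R[i] := cos (2 * pi * t) +i* sin (2 * pi * t).

Lemma normc_cis t : normc (cis t) = 1.
Proof. by rewrite normc_sqrt /= cos2Dsin2 sqrtr1. Qed.

Lemma cis_neq0 t : cis t != 0.
Proof. by rewrite -normc_gt0 normc_cis. Qed.

Lemma cisJM t : (cis t)^* * cis t = 1.
Proof. by rewrite mulrC mulcJ normc_cis expr1n. Qed.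

Lemma cisJ t : (cis t)^* = (cis t)^-1.
Proof. by rewrite -[RHS]mul1r -(cisJM t) mulfK// cis_neq0. Qed.

Lemma cis01 : cis 1 = cis 0.
Proof.
have E : 2 * pi = pi *+ 2 :> R by rewrite mulr_natl.
by rewrite /cis mulr1 mulr0 E cos2pi sin2pi cos0 sin0.
Qed.

Lemma continuous_scaled (f : R -> R) (k : R) : continuous f ->
  continuous (fun t => f (k * t)).
Proof.
move=> cf t; apply: (@continuous_comp _ _ _ ( *%R k) f); last exact: cf.
exact: mulrl_continuous.
Qed.

Lemma continuous_cis t : cis x @[x --> t] --> cis t.
Proof.
apply: ccvg_Complex; apply: continuous_scaled.
  exact: continuous_cos.
exact: continuous_sin.
Qed.

Lemma FTC_trig (F f : R -> R) (a b : R) : a <= b -> continuous f ->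
  (forall x : R, is_derive x 1 F (f x)) ->
  \int[leb]_(x in `[a, b]) f x = F b - F a.
Proof.
rewrite le_eqVlt => /predU1P[->|ab] cf dF.
  by rewrite set_itv1 Rintegral_set1 subrr.
have cF : continuous F.
  move=> x; apply/differentiable_continuous/derivable1_diffP.
  by case: (dF x).
rewrite /Rintegral (@continuous_FTC2 _ f F a b ab)//.
- exact: continuous_subspaceT.
- split.
  + by move=> x _; by case: (dF x).
  + exact/cvg_at_right_filter/cF.
  + exact/cvg_at_left_filter/cF.
- by move=> x _; rewrite derive1E; have [_ ->] := dF x.
Qed.

Lemma iint_cis a b : a <= b ->
  (2 * pi)%:C * 'i * iint a b cis = cis b - cis a.
Proof.
move=> ab; have pi2 : 2 * pi != 0 :> R by rewrite mulf_neq0// gt_eqF// pi_gt0.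
have dlin (x : R) : is_derive x 1 (fun t : R => 2 * pi * t) (2 * pi).
  have := @is_deriveZ _ _ _ id (2 * pi) x 1 1 (is_derive_id x 1).
  by rewrite [_ *: 1]mulr1.
have IR : \int[leb]_(t in `[a, b]) cos (2 * pi * t) =
    (2 * pi)^-1 * sin (2 * pi * b) - (2 * pi)^-1 * sin (2 * pi * a).
  apply: (@FTC_trig (fun t => (2 * pi)^-1 * sin (2 * pi * t))) => //.
    exact: continuous_scaled (@continuous_cos R).
  move=> x; have := is_derive1_comp (is_derive_sin (2 * pi * x)) (dlin x).
  move=> /(is_deriveZ (2 * pi)^-1); rewrite [_ *: _]mulrC mulfK//.
have IS : \int[leb]_(t in `[a, b]) sin (2 * pi * t) =
    - (2 * pi)^-1 * cos (2 * pi * b) - - (2 * pi)^-1 * cos (2 * pi * a).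
  apply: (@FTC_trig (fun t => - (2 * pi)^-1 * cos (2 * pi * t))) => //.
    exact: continuous_scaled (@continuous_sin R).
  move=> x; have := is_derive1_comp (is_derive_cos (2 * pi * x)) (dlin x).
  move=> /(is_deriveZ (- (2 * pi)^-1)); rewrite [_ *: _]mulrC mulrN mulNr.
  by rewrite mulNr opprK mulfK.
rewrite /iint /cint /cis IR IS; move: (2 * pi) pi2 => k k0.
by apply: complex_eqP; rewrite !(cReM, cImM, cReD, cImD, cReN, cImN) /=; field.
Qed.

End circle.

(** * Goursat's argument for the Cauchy integral *)

Section cauchy_disc.
Context {R : realType}.
Notation leb := (@lebesgue_measure R).
Implicit Types (G : R[i] -> R[i]) (a b c d s t : R).

(** The limit is over full neighbourhoods, also at boundary points; this suits dilations, which are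
    defined beyond the closed disc. *)
Definition continuous_cdisc G :=
  forall z, normc z <= 1 -> G x @[x --> z] --> G z.

Lemma normci : normc ('i : R[i]) = 1.
Proof. by rewrite normc_sqrt /= expr0n add0r expr1n sqrtr1. Qed.

Lemma cdiff_caratheodory G (f : R[i] -> R[i]) z : f x @[x --> z] --> f z ->
  (\forall x \near z, G x - G z = f x * (x - z)) -> cdiff G z.
Proof.
move=> /(@ccvgP _ _ (nbhs z)) cf /near_normcP[d d0 Gf]; exists (f z) => e e0.
have /near_normcP[k k0 fk] := cf e e0.
apply/near_normcP; exists (Num.min d k) => [|x]; first by rewrite lt_min d0.
rewrite lt_min => /andP[xd xk]; rewrite Gf// -mulrBl normcM.
by rewrite ler_wpM2r// ltW// fk.
Qed.

Lemma normc_cisB a b : a <= b -> normc (cis b - cis a) <= 2 * pi * (b - a).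
Proof.
move=> ab; rewrite -iint_cis// !normcM normci mulr1 normc_real ger0_norm; last first.
  by rewrite mulr_ge0// pi_ge0.
rewrite ler_wpM2l ?mulr_ge0 ?pi_ge0// -[leRHS]mul1r; apply: normc_iint => //.
  by apply: cwithin_bmeas; apply: cwithin_continuous; exact: continuous_cis.
by move=> t _; rewrite normc_cis.
Qed.

Lemma normc_cis_dist a b : normc (cis b - cis a) <= 2 * pi * `|b - a|.
Proof.
have [ab|/ltW ba] := leP a b.
  by rewrite ger0_norm ?subr_ge0// normc_cisB.
by rewrite normcBC distrC ger0_norm ?subr_ge0// normc_cisB.
Qed.

Variable w : R[i].
Hypothesis w1 : normc w < 1.

Let q := 1 - normc w.
Let q0 : 0 < q. Proof. by rewrite subr_gt0. Qed.

Let zeta t := cis t - w.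
Let kappa t := cis t / zeta t.

Let zeta_ge t : q <= normc (zeta t).
Proof.
by rewrite lerBlDr -(normc_cis t) -{1}(subrK w (cis t)) normcD.
Qed.

Let zeta_le t : normc (zeta t) <= 2.
Proof. by rewrite (le_trans (normcB _ _))// normc_cis lerD2l ltW. Qed.

Let zeta_neq0 t : zeta t != 0.
Proof. by rewrite -normc_gt0 (lt_le_trans q0). Qed.

Let kappa_le t : normc (kappa t) <= q^-1.
Proof.
by rewrite normcM normc_cis mul1r normcV lef_pV2 ?posrE// normc_gt0.
Qed.

(** The radial homotopy from the constant [w] at s = 0 to the unit circle at s = 1. *)
Let p s t := w + s%:C * zeta t.

Let p_le s t : 0 <= s <= 1 -> normc (p s t) <= 1.
Proof.
move=> /andP[s0 s1].
have -> : p s t = (1 - s)%:C * w + s%:C * cis t.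
  by rewrite /p /zeta rmorphB /=; ring.
rewrite (le_trans (normcD _ _))// !normcM !normc_real normc_cis.
rewrite !ger0_norm ?subr_ge0//.
have : (1 - s) * normc w <= 1 - s by rewrite ler_piMr ?subr_ge0// ltW.
by lra.
Qed.

Let zeta_cont t : zeta x @[x --> t] --> zeta t.
Proof. by apply: ccvgB; [exact: continuous_cis|exact: ccvg_cst]. Qed.

Let kappa_cont t : kappa x @[x --> t] --> kappa t.
Proof. exact: (ccvgM (@continuous_cis _ t) (ccvgV (zeta_neq0 t) (@zeta_cont t))). Qed.

Let p_cont1 s t : p s x @[x --> t] --> p s t.
Proof.
exact: (ccvgD (ccvg_cst (a := w)) (ccvgM (ccvg_cst (a := s%:C)) (@zeta_cont t))).
Qed.

Let p_cont2 s t : p x t @[x --> s] --> p s t.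
Proof.
have s_s : x @[x --> s] --> s by exact: cvg_id.
exact: (ccvgD (ccvg_cst (a := w)) (ccvgM (ccvg_real s_s) (ccvg_cst (a := zeta t)))).
Qed.

(** In the coordinates of [p], dz / (z - w) is 2 i pi [kappa t] dt along an arc of constant s and ds
    / s along a segment of constant t; [F1] and [F2] are the differences of the integrands over
    opposite sides. *)
Let F1 G a b t := (G (p b t) - G (p a t)) * kappa t.
Let F2 G c d s := (G (p s d) - G (p s c)) * (s^-1)%:C.

Let F1_cont G s t : continuous_cdisc G -> 0 <= s <= 1 ->
  G (p s x) @[x --> t] --> G (p s t).
Proof. by move=> cG s01; apply: cvg_comp (@p_cont1 s t) _; exact/cG/p_le. Qed.

Let F1_bmeas G a b c d : continuous_cdisc G -> 0 <= a <= 1 -> 0 <= b <= 1 ->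
  bmeas `[c, d] (F1 G a b).
Proof.
move=> cG a01 b01; apply: cwithin_bmeas; apply: cwithin_continuous => t.
exact: (ccvgM (ccvgB (@F1_cont G b t cG b01) (@F1_cont G a t cG a01)) (@kappa_cont t)).
Qed.

Let F2_bmeas G a b c d : continuous_cdisc G -> 0 < a -> b <= 1 ->
  bmeas `[a, b] (F2 G c d).
Proof.
move=> cG a0 b1; apply: cwithin_bmeas => s; rewrite /= in_itv/= => /andP[as_ sb].
have s0 : 0 < s by exact: lt_le_trans as_.
have s01 : 0 <= s <= 1 by rewrite ltW//= (le_trans sb).
have pG t : G (p x t) @[x --> s] --> G (p s t).
  by apply: cvg_comp (@p_cont2 s t) _; exact/cG/p_le.
have s_s : x @[x --> s] --> s by exact: cvg_id.
have sV : x^-1 @[x --> s] --> s^-1 by apply: cvgV => //; rewrite gt_eqF.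
apply: cvg_within_filter.
exact: (ccvgM (ccvgB (pG d) (pG c)) (ccvg_real sV)).
Qed.

Let tpi : R[i] := (2 * pi)%:C * 'i.

Let normc_tpi : normc tpi = 2 * pi.
Proof.
by rewrite normcM normci mulr1 normc_real ger0_norm// mulr_ge0// pi_ge0.
Qed.

Let tpi_neq0 : tpi != 0.
Proof. by rewrite -normc_gt0 normc_tpi mulr_gt0// pi_gt0. Qed.

(* The integral of [G(z) dz / (z - w)] along the boundary of the image of the
   rectangle [a, b] x [c, d] under [(s, t) |-> w + s (cis t - w)], up to the
   factor [2 i pi]. *)
Let DD G a b c d := iint c d (F1 G a b) - tpi^-1 * iint a b (F2 G c d).

(** Both sides are explicit here, and they cancel because the integral of 2 i pi [cis] is the
    increment of [cis] ([iint_cis]). *)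
Let DD_affine A B a b c d : 0 < a -> a <= b -> c <= d ->
  DD (fun z => A + B * z) a b c d = 0.
Proof.
move=> a0 ab cd; rewrite /DD.
have -> : iint c d (F1 (fun z => A + B * z) a b) =
    B * (b - a)%:C * iint c d cis.
  rewrite /iint -cintZ//; last first.
  - by apply: cwithin_bmeas; apply: cwithin_continuous; exact: continuous_cis.
  - exact: lebesgue_itv_lty.
  apply: eq_iint => t _; rewrite /F1 /p /kappa rmorphB /=.
  by field; exact: zeta_neq0.
have -> : iint a b (F2 (fun z => A + B * z) c d) =
    iint a b (cst (B * (cis d - cis c))).
  apply: eq_iint => s /andP[as_ _]; rewrite /F2 /p /zeta /= rmorphV /=; last first.
    by rewrite unitfE gt_eqF// (lt_le_trans a0).
  field; rewrite (_ : 0 = (0 : R)%:C)// (inj_eq (@complexI _)) gt_eqF//.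
  exact: lt_le_trans as_.
rewrite /iint cint_cst// fine_lebesgue_itv// -/(iint c d cis) -iint_cis// -/tpi.
by field.
Qed.

Let DDB G H a b c d : continuous_cdisc G -> continuous_cdisc H ->
  0 < a -> a <= b -> b <= 1 ->
  DD (fun z => G z - H z) a b c d = DD G a b c d - DD H a b c d.
Proof.
move=> cG cH a0 ab b1; rewrite /DD.
have a01 : 0 <= a <= 1 by rewrite ltW//= (le_trans ab).
have b01 : 0 <= b <= 1 by rewrite b1 (le_trans (ltW a0)).
have -> : iint c d (F1 (fun z => G z - H z) a b) =
    iint c d (F1 G a b) - iint c d (F1 H a b).
  rewrite /iint -cintB//; [|exact: lebesgue_itv_lty|exact: F1_bmeas..].
  by apply: eq_iint => t _; rewrite /F1; ring.
have -> : iint a b (F2 (fun z => G z - H z) c d) =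
    iint a b (F2 G c d) - iint a b (F2 H c d).
  rewrite /iint -cintB//; [|exact: lebesgue_itv_lty|exact: F2_bmeas..].
  by apply: eq_iint => t _; rewrite /F2; ring.
by ring.
Qed.

Let DD_le G a b c d M : continuous_cdisc G -> 0 < a -> a <= b -> b <= 1 -> c <= d ->
  (forall s t, a <= s <= b -> c <= t <= d -> normc (G (p s t)) <= M) ->
  normc (DD G a b c d) <= 2 * M * (q^-1 * (d - c) + a^-1 * (b - a)).
Proof.
move=> cG a0 ab b1 cd GM.
have a01 : 0 <= a <= 1 by rewrite ltW//= (le_trans ab).
have b01 : 0 <= b <= 1 by rewrite b1 (le_trans (ltW a0)).
have M0 : 0 <= M by apply: le_trans (GM a c _ _) => //; rewrite lexx.
have M2 s t s' t' : a <= s <= b -> c <= t <= d -> a <= s' <= b -> c <= t' <= d ->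
    normc (G (p s t) - G (p s' t')) <= 2 * M.
  by move=> *; rewrite (le_trans (normcB _ _))// mulr2n mulrDl mul1r lerD// GM.
rewrite mulrDr (le_trans (normcB _ _))//; apply: lerD.
  rewrite mulrA; apply: normc_iint => //; first exact: F1_bmeas.
  by move=> t tcd; rewrite /F1 normcM ler_pM// M2// ?lexx ?ab.
rewrite normcM normcV normc_tpi -[leRHS]mul1r; apply: ler_pM => //.
  by rewrite invr_ge0 mulr_ge0// pi_ge0.
  rewrite invf_le1 ?mulr_gt0 ?pi_gt0//.
  by have := @pi_ge2 R; lra.
rewrite mulrA; apply: normc_iint => //; first exact: F2_bmeas.
move=> s sab; rewrite /F2 normcM; apply: ler_pM => //.
  by apply: M2; rewrite ?lexx ?cd.
have s0 : 0 < s by case/andP: sab => ? _; exact: lt_le_trans a0 _.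
have sV0 : 0 <= s^-1 by rewrite invr_ge0 ltW.
rewrite normc_real (ger0_norm sV0) lef_pV2 ?posrE//.
by case/andP: sab.
Qed.

(** A Lipschitz constant for [p]: 2 bounds [zeta], and 2 pi is the Lipschitz constant of [cis]. *)
Let K : R := 2 * pi + 2.
Let K0 : 0 < K. Proof. by rewrite /K addr_gt0// mulr_gt0// pi_gt0. Qed.

Let p_dist s t s' t' : 0 <= s <= 1 ->
  normc (p s' t' - p s t) <= K * (`|s' - s| + `|t' - t|).
Proof.
move=> /andP[s0 s1].
have -> : p s' t' - p s t = (s' - s)%:C * zeta t' + s%:C * (cis t' - cis t).
  by rewrite /p /zeta rmorphB /=; ring.
rewrite (le_trans (normcD _ _))// !normcM !normc_real (ger0_norm s0).
have h1 : `|s' - s| * normc (zeta t') <= `|s' - s| * 2 by rewrite ler_wpM2l.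
have h2 : s * normc (cis t' - cis t) <= 2 * pi * `|t' - t|.
  rewrite -[leRHS]mul1r; apply: ler_pM => //; first by exact: normc_ge0.
  exact: normc_cis_dist.
have h3 : 0 <= `|s' - s| * pi by rewrite mulr_ge0// pi_ge0.
have h4 : 0 <= `|t' - t| by [].
by rewrite (le_trans (lerD h1 h2))// /K; lra.
Qed.

Section holomorphic.
Variable g : R[i] -> R[i].
Hypothesis gD : forall z, normc z <= 1 -> cdiff g z.

Let g_cont : continuous_cdisc g.
Proof. by move=> z z1; exact/cdiff_continuous/gD. Qed.

(** By [DD_affine], subtracting the first-order Taylor polynomial of [g] leaves [DD] unchanged. The
    remainder is a small multiple of the distance, which gives the quadratic bound that [bisection]
    asks for. The condition [0 < a0] keeps clear of the pole at s = 0. *)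
Let DD0 a0 : 0 < a0 -> a0 < 1 -> DD g a0 1 0 1 = 0.
Proof.
move=> a00 a01; apply: bisection => //.
- move=> a m b c d a0a am mb b1 c0 cd d1.
  have a_gt0 : 0 < a by exact: lt_le_trans a0a.
  have m_gt0 : 0 < m by exact: lt_le_trans am.
  have b_gt0 : 0 < b by exact: lt_le_trans mb.
  rewrite /DD (@iint_split _ a m b) ?am//; last exact: F2_bmeas.
  have -> : iint c d (F1 g a b) = iint c d (F1 g a m) + iint c d (F1 g m b).
    rewrite /iint -cintD//; [|exact: lebesgue_itv_lty|apply: F1_bmeas..] => //.
    - by apply: eq_iint => t _; rewrite /F1; ring.
    - by rewrite ltW//= (le_trans am)// (le_trans mb).
    - by rewrite ltW//= (le_trans mb).
    - by rewrite ltW//= (le_trans mb).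
    - by rewrite ltW//=.
  by ring.
- move=> a b c m d a0a ab b1 c0 cm md d1.
  have a_gt0 : 0 < a by exact: lt_le_trans a0a.
  have b_gt0 : 0 < b by exact: lt_le_trans ab.
  rewrite /DD (@iint_split _ c m d) ?cm//; last first.
    by apply: F1_bmeas => //; rewrite ltW//= (le_trans ab).
  have -> : iint a b (F2 g c d) = iint a b (F2 g c m) + iint a b (F2 g m d).
    rewrite /iint -cintD//; [|exact: lebesgue_itv_lty|exact: F2_bmeas..].
    by apply: eq_iint => t _; rewrite /F2; ring.
  by ring.
- move=> s t /andP[a0s s1] /andP[t0 t1] e e0.
  have s01 : 0 <= s <= 1 by rewrite s1 (le_trans (ltW a00)).
  have [B gB] := gD (p_le t s01).
  (* The product of the constants of [DD_le] and [p_dist], with 1/a bounded by 1/[a0]; dividing [e]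
     by it makes the final bound exactly [e * S ^+ 2]. *)
  pose k := 2 * K * (q^-1 + a0^-1).
  have k0 : 0 < k by rewrite !mulr_gt0// addr_gt0// invr_gt0.
  have /near_normcP[eta eta0 getaP] := gB _ (divr_gt0 e0 k0).
  exists (eta / (2 * K)); first by rewrite divr_gt0// mulr_gt0.
  move=> a b c d /andP[a0a as_] /andP[sb b1] /andP[c0 ct] /andP[td d1] bad dcd.
  have a_gt0 : 0 < a by exact: lt_le_trans a0a.
  have ab : a <= b by exact: le_trans sb.
  have cd : c <= d by exact: le_trans td.
  (* [A0 + B * z] is the first-order Taylor polynomial of [g] at [p s t]. *)
  pose A0 := g (p s t) - B * p s t.
  have cA : continuous_cdisc (fun z => A0 + B * z).
    move=> z _; have z_z : x @[x --> z] --> z by exact: cvg_id.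
    exact: (@ccvgD _ _ (nbhs z) _ _ _ _ _ (@ccvg_cst _ _ (nbhs z) _ A0)
      (@ccvgM _ _ (nbhs z) _ _ _ _ _ (@ccvg_cst _ _ (nbhs z) _ B) z_z)).
  rewrite -[DD g a b c d]subr0 -(@DD_affine A0 B a b c d)// -DDB//.
  set S := _ + (d - c).
  have S0 : 0 <= S by rewrite addr_ge0// subr_ge0.
  have cgA : continuous_cdisc (fun z => g z - (A0 + B * z)).
    move=> z z1.
    exact: (@ccvgB _ _ (nbhs z) _ _ _ _ _ (g_cont z1) (cA z z1)).
  rewrite (le_trans (@DD_le _ a b c d (e / k * (K * S)) _ _ _ _ _ _))//.
    move=> s' t' /andP[as' s'b] /andP[ct' t'd].
    have d1' : normc (p s' t' - p s t) <= K * S.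
      rewrite (le_trans (p_dist _ _ _ s01))// ler_pM2l// lerD// ler_norml.
        by apply/andP; split; lra.
      by apply/andP; split; lra.
    have d2' : normc (p s' t' - p s t) < eta.
      rewrite (le_lt_trans d1')// mulrC -ltr_pdivlMr//.
      have := ltrD bad dcd; rewrite -/S; suff -> : eta / K = eta / (2 * K) + eta / (2 * K) by [].
      by field; rewrite gt_eqF.
    rewrite (_ : g (p s' t') - _ = g (p s' t') - g (p s t) - B * (p s' t' - p s t)); last first.
      by rewrite /A0; ring.
    by rewrite (le_trans (getaP _ d2'))// ler_wpM2l// divr_ge0// ltW.
  have h1 : q^-1 * (d - c) + a^-1 * (b - a) <= (q^-1 + a0^-1) * S.
    rewrite mulrDl; apply: lerD.
      by rewrite ler_pM2l ?invr_gt0// /S lerDr subr_ge0.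
    apply: ler_pM => //; rewrite ?invr_ge0 ?subr_ge0//; first exact: ltW.
      by rewrite lef_pV2 ?posrE.
    by rewrite /S lerDl subr_ge0.
  rewrite (@le_trans _ _ (2 * (e / k * (K * S)) * ((q^-1 + a0^-1) * S)))//.
    have ek0 : 0 <= e / k by rewrite divr_ge0// ltW.
    have KS0 : 0 <= K * S by rewrite mulr_ge0// ltW.
    by rewrite ler_wpM2l// mulr_ge0// mulr_ge0.
  rewrite le_eqVlt; apply/orP; left; apply/eqP; rewrite /k.
  by field; rewrite !gt_eqF//= addr_gt0 ?invr_gt0.
Qed.

Let kappa_bmeas : bmeas `[(0 : R), 1] kappa.
Proof.
by apply: cwithin_bmeas; apply: cwithin_continuous; exact: kappa_cont.
Qed.

Let gcis_bmeas : bmeas `[(0 : R), 1] (fun t => g (cis t)).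
Proof.
apply: cwithin_bmeas; apply: cwithin_continuous => t.
by apply: cvg_comp (@continuous_cis _ t) _; apply: g_cont; rewrite normc_cis.
Qed.

(** The segments t = 0 and t = 1 coincide by [cis01], so [DD0] says that the integral over the unit
    circle equals the one over the circle shrunk towards [w] by the factor s, where [g] is close to
    [g w]. *)
Lemma cauchy_disc_kappa :
  iint 0 1 (fun t => g (cis t) * (cis t / (cis t - w))) =
  g w * iint 0 1 (fun t => cis t / (cis t - w)).
Proof.
rewrite -/kappa; apply/eqP; rewrite -subr_eq0 -normc_eq0 eq_le normc_ge0 andbT.
apply/ler_addgt0Pl => e e0; rewrite addr0.
have : g x @[x --> w] --> g w by apply: g_cont; exact: ltW.
move=> /(@ccvgP _ _ (nbhs w)) /(_ (e * q) (mulr_gt0 e0 q0)).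
move=> /near_normcP[d d0 gd].
(* As |zeta| <= 2, the bound s <= d/4 keeps [p s t] within d/2 of [w]; the bound 1/2 ensures s <
   1. *)
pose s := Num.min (1/2) (d / 4).
have s0 : 0 < s by rewrite lt_min !divr_gt0.
have s1 : s < 1 by rewrite gt_min; apply/orP; left; lra.
have s01 : 0 <= s <= 1 by rewrite !ltW.
have := DD0 s0 s1; rewrite /DD.
have -> : iint s 1 (F2 g 0 1) = 0.
  rewrite (@eq_iint _ _ _ _ (fun=> 0)) ?cint_cst ?mul0r//; last first.
    by move=> x _; rewrite /F2 /p /zeta cis01 subrr mul0r.
  by rewrite /iint cint_cst// mul0r.
rewrite mulr0 subr0 => F10.
have i1 : bmeas `[(0 : R), 1] (fun t => (g (p s t) - g w) * kappa t).
  apply: cwithin_bmeas; apply: cwithin_continuous => t.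
  exact: (ccvgM (ccvgB (@F1_cont g s t g_cont s01) (ccvg_cst (a := g w))) (@kappa_cont t)).
have bF1 : bmeas `[(0 : R), 1] (F1 g s 1) by apply: F1_bmeas; rewrite ?ler01 ?lexx.
have -> : iint 0 1 (fun t => g (cis t) * kappa t) - g w * iint 0 1 kappa =
    iint 0 1 (fun t => (g (p s t) - g w) * kappa t).
  rewrite -[RHS]addr0 -F10 /iint -cintD//; last exact: lebesgue_itv_lty.
  rewrite -cintZ//; last exact: lebesgue_itv_lty.
  rewrite -cintB//; [|exact: lebesgue_itv_lty|exact: bmeasM|exact: bmeasZ].
  have p1E t : p 1 t = cis t by rewrite /p /zeta rmorph1 mul1r addrC subrK.
  by apply: eq_iint => t _; rewrite /F1 p1E; ring.
rewrite -[leRHS]mulr1 -[X in _ * X]subr0; apply: normc_iint => // t _.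
rewrite normcM -(mulfK (lt0r_neq0 q0) e) ler_pM//.
apply/ltW/gd; rewrite /p addrC addKr normcM normc_real gtr0_norm//.
rewrite (@le_lt_trans _ _ (d / 4 * 2))//; last by lra.
have sd : s <= d / 4 by rewrite /s ge_min lexx orbT.
have sge0 : 0 <= s by exact: ltW.
exact: (ler_pM sge0 (normc_ge0 _) sd (zeta_le t)).
Qed.

End holomorphic.

End cauchy_disc.

Section cauchy_formula.
Context {R : realType}.

Lemma mean_value_disc (g : R[i] -> R[i]) :
  (forall z, normc z <= 1 -> cdiff g z) -> iint 0 1 (fun t => g (cis t)) = g 0.
Proof.
move=> gD; have := @cauchy_disc_kappa R 0 _ g gD; rewrite normc0 ltr01 => /(_ isT).
have E t : cis t / (cis t - 0) = 1 :> R[i] by rewrite subr0 divff// cis_neq0.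
under [X in X = _ -> _]eq_iint do rewrite E mulr1.
move=> ->; under eq_iint do rewrite E.
by rewrite /iint cint_cst// fine_lebesgue_itv// subr0 !mulr1.
Qed.

Lemma sub1_neq0 (z : R[i]) : normc z < 1 -> 1 - z != 0.
Proof.
by move=> z1; rewrite -normc_gt0 (lt_le_trans _ (normc_sub1_ge _))// subr_gt0.
Qed.

(** On the circle the kernel equals cis / (cis - w), which reduces the claim to showing that its
    integral is 1. Its conjugate is [h (cis t)] with h(z) = 1 / (1 - w^* z) holomorphic on the
    closed disc, so the mean value property gives h(0) = 1. *)
Lemma cauchy_disc (g : R[i] -> R[i]) (w : R[i]) : normc w < 1 ->
  (forall z, normc z <= 1 -> cdiff g z) ->
  iint 0 1 (fun t => g (cis t) * (1 - w * (cis t)^*)^-1) = g w.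
Proof.
move=> w1 gD.
have E t : (1 - w * (cis t)^*)^-1 = cis t / (cis t - w) :> R[i].
  have nz : cis t - w != 0.
    rewrite -normc_gt0 (lt_le_trans _ (normc_distl _ _))// normc_cis.
    by rewrite gtr0_norm subr_gt0.
  rewrite cisJ; by field; rewrite nz cis_neq0.
under eq_iint do rewrite E.
rewrite (cauchy_disc_kappa w1 gD) -[RHS]mulr1; congr (_ * _).
pose h (z : R[i]) := (1 - w^* * z)^-1.
have hn z : normc z <= 1 -> 1 - w^* * z != 0.
  move=> z1; apply: sub1_neq0; rewrite normcM normcJ.
  by rewrite (le_lt_trans (ler_piMr _ z1)).
have c1 z : 1 - w^* * x @[x --> z] --> 1 - w^* * z.
  have z_z : x @[x --> z] --> z by exact: cvg_id.
  exact: (@ccvgB _ _ (nbhs z) _ _ _ _ _ (@ccvg_cst _ _ (nbhs z) _ 1)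
    (@ccvgM _ _ (nbhs z) _ _ _ _ _ (@ccvg_cst _ _ (nbhs z) _ (w^*)) z_z)).
have ch z : normc z <= 1 -> h x @[x --> z] --> h z.
  by move=> z1; exact: (@ccvgV _ _ (nbhs z) _ _ _ (hn z z1) (c1 z)).
have hD z : normc z <= 1 -> cdiff h z.
  move=> z1; apply: (@cdiff_caratheodory _ _ (fun x => w^* * h x * h z)).
    exact: (@ccvgM _ _ (nbhs z) _ _ _ _ _ (@ccvgM _ _ (nbhs z) _ _ _ _ _
      (@ccvg_cst _ _ (nbhs z) _ (w^*)) (ch z z1)) (@ccvg_cst _ _ (nbhs z) _ (h z))).
  have n0 : 0 < normc (1 - w^* * z) by rewrite normc_gt0 hn.
  have /(@ccvgP _ _ (nbhs z)) /(_ _ n0) := c1 z; apply: filterS => x xz.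
  have nx : 1 - w^* * x != 0.
    apply/eqP => x0; move: xz; rewrite x0 sub0r normcN ltxx//.
  by rewrite /h; field; rewrite nx hn.
have := mean_value_disc hD; rewrite [X in _ = X -> _]/h mulr0 subr0 invr1.
have cw : cwithin `[(0 : R), 1] (fun t : R => h (cis t)).
  apply: cwithin_continuous => t.
  by apply: cvg_comp (@continuous_cis _ t) _; apply: ch; rewrite normc_cis.
have J t : cis t / (cis t - w) = (h (cis t))^* :> R[i].
  by rewrite -E /h conjc_inv conjcB conjcM conjcK conjc1.
move=> h1; under eq_iint do rewrite J.
rewrite /iint (cintJ _ (lebesgue_itv_lty 0 1) (cwithin_bmeas cw))//.
by rewrite -/(iint 0 1 _) h1 conjc1.
Qed.

End cauchy_formula.

(** * Cauchy's formula on the polydisc *)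

Section row_topology.
Context {R : realType} {n : nat}.
Implicit Types (z w u : 'rV[R[i]]_n) (F : 'rV[R[i]]_n -> R[i]).

Lemma near_rowP z (P : 'rV[R[i]]_n -> Prop) :
  (\forall y \near z, P y) <->
  exists2 e : R, 0 < e &
    forall y : 'rV[R[i]]_n, (forall j, normc (y 0 j - z 0 j) < e) -> P y.
Proof.
split=> [/nbhs_ballP[e /= e0 eP]|[e e0 eP]].
  have ee : e = (complex.Re e)%:C by apply: ge0_complexE; exact: ltW.
  exists (complex.Re e); first by rewrite -ltcR -ee.
  move=> y yz; apply: eP; split => // i j; rewrite ord1.
  by rewrite -ball_normE /= ee normcP ltcR normcBC.
apply/nbhs_ballP; exists e%:C => /=; first by rewrite ltcR.
move=> y [_ yz]; apply: eP => j; have := yz 0 j.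
by rewrite -ball_normE /= normcP ltcR normcBC.
Qed.

Lemma cvg_row {T : Type} (G : set_system T) {FG : Filter G}
    (f : T -> 'rV[R[i]]_n) z :
  (forall j, f t 0 j @[t --> G] --> z 0 j) -> f @ G --> z.
Proof.
move=> fz P /near_rowP[e e0 eP].
have : \forall t \near G, forall j, normc (f t 0 j - z 0 j) < e.
  apply: filter_forall => j.
  by have /(@ccvgP _ _ G) := fz j; apply.
by apply: filterS => t; exact: eP.
Qed.

Lemma coord_cvg z j : (fun y : 'rV[R[i]]_n => y 0 j) @ z --> z 0 j.
Proof.
apply/(@ccvgP _ _ (nbhs z)) => e e0; apply/near_rowP.
by exists e => // y; exact.
Qed.

Definition cpolydisc : set 'rV[R[i]]_n := [set z | forall j, normc (z 0 j) <= 1].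

Lemma sub_cpolydisc : polydisc `<=` cpolydisc.
Proof. by move=> z zD j; exact/ltW/zD. Qed.

Lemma compact_cdisc : compact [set z : R[i] | normc z <= 1].
Proof.
apply: (@subclosed_compact _ _
    ((fun p : R * R => p.1 +i* p.2) @` (`[-1, 1] `*` `[-1, 1]))).
- rewrite (_ : mkset _ = (@ComplexField.Normc.normc R) @^-1` [set x | x <= 1]) //.
  apply: closed_comp; last exact: closed_le.
  move=> z _; apply: (@ccvg_normc _ _ (nbhs z)).
  exact: cvg_id.
- apply: continuous_compact; last first.
    by apply: compact_setX; exact: segment_compact.
  apply: continuous_subspaceT => p; apply: (@ccvg_Complex _ _ (nbhs p)).
    exact: cvg_fst.
  exact: cvg_snd.
- move=> z /= z1; exists (complex.Re z, complex.Im z); last by case: z z1.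
  rewrite /= !in_itv /= -!ler_norml.
  by rewrite !(le_trans _ z1)// ?Re_le_normc ?Im_le_normc.
Qed.

Lemma compact_cpolydisc : compact cpolydisc.
Proof. exact: (rV_compact (fun=> compact_cdisc)). Qed.

Lemma bounded_cpolydisc F : (forall z, cpolydisc z -> F y @[y --> z] --> F z) ->
  exists M, forall z, cpolydisc z -> normc (F z) <= M.
Proof.
move=> cF.
have cN : {within cpolydisc, continuous (fun z => normc (F z))}.
  apply/subspace_continuousP => z zD; apply: ccvg_normc.
  by apply: cvg_within_filter; exact: cF.
have /compact_bounded [M [_ HM]] := continuous_compact cN compact_cpolydisc.
exists (M + 1) => z zD; rewrite (le_trans (ler_norm _))//.
by apply: (HM (M + 1)); [rewrite ltrDl|exists z].
Qed.

End row_topology.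
Arguments cpolydisc {R n}.

(** * Measurability and iterated integrals on the torus *)

Section torus_integral.
Context {R : realType}.
Notation mR := (measurableTypeR R).

Lemma torus_pointE n (t : n.-tuple mR) j : torus_point t 0 j = cis (tnth t j).
Proof. by rewrite mxE. Qed.

Lemma cpolydisc_torus n (t : n.-tuple mR) : cpolydisc (torus_point t).
Proof. by move=> j; rewrite torus_pointE normc_cis. Qed.

(** Rounding the angles down to multiples of 1/(N+1). Any function of the rounded angles is
    measurable, whatever the function, and a continuous function is the pointwise limit of such
    functions. *)
Let grid n (N : nat) (t : n.-tuple mR) : n.-tuple mR :=
  [tuple of [seq (Num.floor (N.+1%:R * x))%:~R / N.+1%:R | x <- t]].

Let measurable_grid n N (G : n.-tuple mR -> R) :
  measurable_fun setT (fun t => G (grid N t)).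
Proof.
move=> _ B mB; rewrite setTI.
pose fl (t : n.-tuple mR) : n.-tuple int :=
  [tuple of [seq Num.floor (N.+1%:R * x) | x <- t]].
pose g (k : n.-tuple int) : n.-tuple mR := [tuple of [seq x%:~R / N.+1%:R | x <- k]].
have gridE t : grid N t = g (fl t).
  by apply: val_inj; rewrite /= -map_comp.
have mfl k : measurable [set t | fl t = k].
  have -> : [set t | fl t = k] = \bigcap_(j in [set: 'I_n])
      (@tnth n mR ^~ j) @^-1` [set x | Num.floor (N.+1%:R * x) = tnth k j].
    apply/seteqP; split=> [t <- j _|t H] /=; first by rewrite tnth_map.
    by apply/eq_from_tnth => j; rewrite tnth_map; exact: H.
  apply: fin_bigcap_measurable; first exact: finite_finset.
  move=> j _; rewrite -[X in measurable X]setTI; apply: measurable_tnth => //.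
  have -> : [set x : R | Num.floor (N.+1%:R * x) = tnth k j] =
      [set x | (tnth k j)%:~R <= N.+1%:R * x < (tnth k j + 1)%:~R].
    apply/seteqP; split=> x /= => [<-|xk].
      exact: floor_itv.
    exact: floor_def.
  have -> : [set x | (tnth k j)%:~R <= N.+1%:R * x < (tnth k j + 1)%:~R] =
      `[(tnth k j)%:~R / N.+1%:R, (tnth k j + 1)%:~R / N.+1%:R[%classic :> set R.
    apply/seteqP; split=> x /=; rewrite in_itv /= ler_pdivrMr ?ltr0n//
      ltr_pdivlMr ?ltr0n// mulrC//.
  exact: measurable_itv.
(* Integer tuples are countable, so the preimage is a countable union of grid cells, enumerated by
   [unpickle]. *)
rewrite (_ : _ @^-1` _ = \bigcup_m (if unpickle m is Some k
    then if `[< B (G (g k)) >] then [set t | fl t = k] else set0 else set0)).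
  apply: bigcupT_measurable => m; case: (unpickle m) => [k|]; last exact: measurable0.
  by case: ifP => _ //; exact: measurable0.
apply/seteqP; split=> [t /=|t [m _]].
  rewrite gridE => BG; exists (pickle (fl t)) => //.
  by rewrite pickleK; case: asboolP.
by case: (unpickle m) => // k; case: asboolP => //= Bk E; rewrite gridE E.
Qed.

Let cvg_grid n (t : n.-tuple mR) j :
  (fun N => tnth (grid N t) j) @ \oo --> (tnth t j : R).
Proof.
have E N : tnth (grid N t) j = (Num.floor (N.+1%:R * tnth t j))%:~R / N.+1%:R :> R.
  by rewrite tnth_map.
set x := tnth t j in E *.
apply: (@squeeze_cvgr _ _ _ _ (fun N => x - N.+1%:R^-1) (fun=> x)).
- apply: nearW => N; rewrite E; apply/andP; split.
    rewrite ler_pdivlMr ?ltr0n// mulrBl mulVf ?pnatr_eq0// mulrC.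
    by rewrite lerBlDr -[1]/(1%:~R) -intrD ltW// floorD1_gt.
  by rewrite ler_pdivrMr ?ltr0n// mulrC floor_le_tmp.
- rewrite -[X in _ --> X]subr0; apply: cvgB; first exact: cvg_cst.
  exact: cvg_harmonic.
- exact: cvg_cst.
Qed.

Lemma bmeas_torus n (F : 'rV[R[i]]_n -> R[i]) :
  (forall z, cpolydisc z -> F y @[y --> z] --> F z) ->
  bmeas setT (fun t : n.-tuple mR => F (torus_point t)).
Proof.
move=> cF; split; last first.
  have [M HM] := bounded_cpolydisc cF.
  by exists M => t _; exact/HM/cpolydisc_torus.
have cv t : (fun N => F (torus_point (grid N t))) @ \oo --> F (torus_point t).
  apply: cvg_comp (cF _ (cpolydisc_torus t)).
  apply: cvg_row => j; rewrite torus_pointE.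
  under eq_fun do rewrite torus_pointE.
  by apply: cvg_comp (@continuous_cis R (tnth t j)); exact: cvg_grid.
split.
  apply: (@measurable_fun_cvg _ _ _ _ (fun N t => complex.Re (F (torus_point (grid N t))))).
    by move=> N; exact: measurable_grid (fun t => complex.Re (F (torus_point t))).
  by move=> t _; apply: ccvg_Re; exact: cv.
apply: (@measurable_fun_cvg _ _ _ _ (fun N t => complex.Im (F (torus_point (grid N t))))).
  by move=> N; exact: measurable_grid (fun t => complex.Im (F (torus_point t))).
by move=> t _; apply: ccvg_Im; exact: cv.
Qed.

Lemma cint_uniform (h : R -> R[i]) : bmeas setT (h : mR -> R[i]) ->
  cint (uniform_prob (@ltr01 R)) setT h = iint 0 1 h.
Proof.
move=> mh; have U (f : mR -> R) : measurable_fun setT f ->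
    \int[uniform_prob (@ltr01 R)]_t f t =
    \int[lebesgue_measure]_(t in `[0, 1]) f t.
  move=> mf; rewrite /Rintegral; congr fine.
  have mE : measurable_fun setT (EFin \o f) by exact/measurable_EFinP.
  have mE01 : measurable_fun `[(0 : R), 1] (EFin \o f) by exact: measurable_funTS.
  rewrite integralE [RHS]integralE.
  rewrite !integral_uniform ?subr0 ?invr1 ?mul1e//.
    exact: measurable_funeneg.
  exact: measurable_funepos.
by case: mh => -[mR' mI'] _; apply: complex_eqP; rewrite /= U.
Qed.

Lemma cint_torusS n (G : n.+1.-tuple mR -> R[i]) : bmeas setT G ->
  cint (torus_measure n.+1) setT G =
  cint (torus_measure n) setT (fun t =>
    iint 0 1 (fun x => G [tuple of x :: t])).
Proof.
move=> mG.
rewrite /= cint_distribution//.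
have mG' : bmeas setT (G \o @Defs.cons_tuple R n).
  case: mG => -[mR' mI'] [M GM]; split; last by exists M => t _; exact: GM.
  split; [exact: (measurableT_comp mR')|exact: (measurableT_comp mI')].
rewrite cint_prod21//; apply: eq_cint => t _.
by rewrite cint_uniform//; exact: (bmeas_prod2 mG').
Qed.

End torus_integral.

Section cauchy_kernel.
Context {R : realType} {n : nat}.
Implicit Types (z w u : 'rV[R[i]]_n) (F G : 'rV[R[i]]_n -> R[i]).

(** The Szegö kernel of the polydisc, analytic in its first argument; as a function of that argument
    it is the reproducing kernel at the second one. *)
Definition cker w z : R[i] := \prod_j (1 - w 0 j * (z 0 j)^*)^-1.

Lemma cker_factor_neq0 w z j : polydisc w -> cpolydisc z ->
  1 - w 0 j * (z 0 j)^* != 0.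
Proof.
move=> wD zD; apply: sub1_neq0; rewrite normcM normcJ.
exact: le_lt_trans (ler_piMr (normc_ge0 _) (zD j)) (wD j).
Qed.

Lemma cker_neq0 w z : polydisc w -> cpolydisc z -> cker w z != 0.
Proof.
move=> wD zD; apply/prodf_neq0 => j _.
by rewrite invr_neq0// cker_factor_neq0.
Qed.

Lemma ckerJ w z : (cker w z)^* = cker z w.
Proof.
rewrite conjc_prod; apply: eq_bigr => j _.
by rewrite conjc_inv conjcB conjcM conjcK conjc1 mulrC.
Qed.

Lemma cker_cvg w z : polydisc w -> cpolydisc z -> cker w y @[y --> z] --> cker w z.
Proof.
move=> wD zD; apply: (@ccvg_prod _ _ (nbhs z)) => j.
apply: (@ccvgV _ _ (nbhs z)); first exact: cker_factor_neq0.
apply: (@ccvgB _ _ (nbhs z) _ (fun=> 1)); first exact: ccvg_cst.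
apply: (@ccvgM _ _ (nbhs z) _ (fun=> w 0 j)); first exact: ccvg_cst.
apply: (@ccvgJ _ _ (nbhs z) _ (fun y : 'rV[R[i]]_n => y 0 j)).
exact: coord_cvg.
Qed.

Definition ccontinuous F := forall z, cpolydisc z -> F y @[y --> z] --> F z.

Lemma ccontinuousM F G : ccontinuous F -> ccontinuous G ->
  ccontinuous (fun z => F z * G z).
Proof.
move=> cF cG z zD.
exact: (@ccvgM _ _ (nbhs z) _ _ _ _ _ (cF z zD) (cG z zD)).
Qed.

Lemma ccontinuousD F G : ccontinuous F -> ccontinuous G ->
  ccontinuous (fun z => F z + G z).
Proof.
move=> cF cG z zD.
exact: (@ccvgD _ _ (nbhs z) _ _ _ _ _ (cF z zD) (cG z zD)).
Qed.

Lemma ccontinuousJ F : ccontinuous F -> ccontinuous (fun z => (F z)^*).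
Proof. by move=> cF z zD; exact: (@ccvgJ _ _ (nbhs z) _ _ _ (cF z zD)). Qed.

Lemma ccontinuous_cst c : ccontinuous (fun=> c).
Proof. by move=> z _; exact: (@ccvg_cst _ _ (nbhs z)). Qed.

(** Differentiability along complex lines only, which is what Cauchy's formula uses when applied one
    variable at a time. *)
Definition ldiff F z := forall u, cdiff (fun x => F (z + x *: u)) 0.

End cauchy_kernel.

Section cons_row.
Context {R : realType} {n : nat}.

Definition cons_row (x : R[i]) (v : 'rV[R[i]]_n) : 'rV[R[i]]_n.+1 :=
  \row_j oapp (v 0) x (unlift ord0 j).

Lemma cons_row0 x v : cons_row x v 0 ord0 = x.
Proof. by rewrite mxE unlift_none. Qed.

Lemma cons_rowS x v j : cons_row x v 0 (lift ord0 j) = v 0 j.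
Proof. by rewrite mxE liftK. Qed.

Lemma cons_row_eta (w : 'rV[R[i]]_n.+1) :
  w = cons_row (w 0 ord0) (\row_j w 0 (lift ord0 j)).
Proof.
apply/rowP => j; case: (unliftP ord0 j) => [k|] ->.
  by rewrite cons_rowS mxE.
by rewrite cons_row0.
Qed.

Lemma cons_rowD x v y u a :
  cons_row x v + a *: cons_row y u = cons_row (x + a * y) (v + a *: u).
Proof.
apply/rowP => j; case: (unliftP ord0 j) => [k|] ->.
  by rewrite !mxE !liftK /= !mxE.
by rewrite !mxE !unlift_none.
Qed.

Lemma cpolydisc_cons x v : normc x <= 1 -> cpolydisc v -> cpolydisc (cons_row x v).
Proof.
move=> x1 vD j; case: (unliftP ord0 j) => [k|] ->.
  by rewrite cons_rowS.
by rewrite cons_row0.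
Qed.

Lemma cons_row_cvgr x v : cons_row x u @[u --> v] --> cons_row x v.
Proof.
apply: (@cvg_row _ _ _ (nbhs v)) => j; case: (unliftP ord0 j) => [k|] ->.
  by under eq_fun do rewrite cons_rowS; rewrite cons_rowS; exact: coord_cvg.
by under eq_fun do rewrite cons_row0; rewrite cons_row0;
  exact: (@ccvg_cst _ _ (nbhs v)).
Qed.

Lemma torus_point_cons (x : R) (t : n.-tuple (measurableTypeR R)) :
  torus_point [tuple of x :: t] = cons_row (cis x) (torus_point t).
Proof.
apply/rowP => j; rewrite torus_pointE; case: (unliftP ord0 j) => [k|] ->.
  by rewrite cons_rowS torus_pointE tnthS.
by rewrite cons_row0.
Qed.

Lemma cker_cons x v y u :
  cker (cons_row x v) (cons_row y u) = (1 - x * y^*)^-1 * cker v u.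
Proof.
rewrite /cker big_ord_recl !cons_row0; congr (_ * _).
by apply: eq_bigr => j _; rewrite !cons_rowS.
Qed.

End cons_row.

Section cauchy_polydisc.
Context {R : realType}.

Lemma cdiff_shift (g : R[i] -> R[i]) a z : cdiff (fun x => g (a + x)) z -> cdiff g (a + z).
Proof.
move=> [B gB]; exists B => e /gB /near_normcP[d d0 gd].
apply/near_normcP; exists d => // x xaz.
have xE : x = a + (x - a) by rewrite addrC subrK.
have E : x - (a + z) = x - a - z by rewrite opprD addrA.
by rewrite E in xaz *; rewrite {1}xE; exact: gd.
Qed.

(** Induction on the number of variables. The kernel splits by [cker_cons]: the inner integral is
    Cauchy's formula on the disc in the first coordinate, the outer one is the induction hypothesis
    for the slice through [x]. *)
Lemma cauchy_polydisc n (F : 'rV[R[i]]_n -> R[i]) : ccontinuous F ->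
  (forall z, cpolydisc z -> ldiff F z) -> forall w, polydisc w ->
  cint (torus_measure n) setT
    (fun t => F (torus_point t) * cker w (torus_point t)) = F w.
Proof.
elim: n F => [|n IH] F cF dF w wD.
  rewrite (@eq_cint _ _ _ _ _ _ (cst (F w))) ?cint_prob_cst// => t _.
  have -> : torus_point t = w by apply/rowP => -[].
  by rewrite /cker big_ord0 mulr1.
have cFk := ccontinuousM cF (fun z => @cker_cvg _ _ w z wD).
rewrite cint_torusS; last exact: (bmeas_torus cFk).
rewrite [in RHS](cons_row_eta w).
set x := w 0 ord0; set v := \row_j _.
have vD : polydisc v by move=> j; rewrite mxE; exact: wD.
have x1 : normc x < 1 by exact: wD.
rewrite -(IH (fun u => F (cons_row x u)))//.
- apply: eq_cint => t _.
  have E y : F (torus_point [tuple of y :: t]) * cker w (torus_point [tuple of y :: t])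
      = F (cons_row (cis y) (torus_point t)) * (1 - x * (cis y)^*)^-1 *
        cker v (torus_point t).
    by rewrite torus_point_cons {1}(cons_row_eta w) cker_cons mulrA.
  under eq_iint do rewrite E.
  rewrite -(@cauchy_disc _ (fun y => F (cons_row y (torus_point t))) x)//.
    rewrite /iint (cintZr _ (lebesgue_itv_lty 0 1))//.
    apply: cwithin_bmeas; apply: cwithin_continuous => y.
    apply: ccvgM.
      apply: cvg_comp (cF _ (cpolydisc_cons _ (cpolydisc_torus t))); last by rewrite normc_cis.
      apply: cvg_row => j; case: (unliftP ord0 j) => [k|] ->.
        by under eq_fun do rewrite cons_rowS; rewrite cons_rowS; exact: ccvg_cst.
      by under eq_fun do rewrite cons_row0; rewrite cons_row0; exact: continuous_cis.
    apply: ccvgV.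
      by apply: sub1_neq0; rewrite normcM normcJ normc_cis mulr1.
    apply: ccvgB; first exact: ccvg_cst.
    apply: ccvgM; first exact: ccvg_cst.
    by apply: ccvgJ; exact: continuous_cis.
  move=> z z1; rewrite -[z]addr0; apply: cdiff_shift.
  have := dF _ (cpolydisc_cons z1 (cpolydisc_torus t)) (cons_row 1 0).
  rewrite (_ : (fun y => F (cons_row z (torus_point t) + y *: cons_row 1 0)) =
    (fun y => F (cons_row (z + y) (torus_point t))))//.
  by apply/funext => y; rewrite cons_rowD mulr1 scaler0 addr0.
- move=> z zD; apply: cvg_comp (@cons_row_cvgr _ _ x z) _; apply: cF.
  by apply: cpolydisc_cons => //; exact: ltW.
- move=> z zD u.
  have := dF _ (cpolydisc_cons (ltW x1) zD) (cons_row 0 u).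
  rewrite (_ : (fun y => F (cons_row x z + y *: cons_row 0 u)) =
    (fun y => F (cons_row x (z + y *: u))))//.
  by apply/funext => y; rewrite cons_rowD mulr0 addr0.
Qed.

End cauchy_polydisc.

Section complex_inverse_measurable.
Context d {T : measurableType d} {R : realType}.

Lemma bmeasV (f : T -> R[i]) (q : R) : 0 < q -> (forall t, q <= normc (f t)) ->
  bmeas setT f -> bmeas setT (fun t => (f t)^-1).
Proof.
move=> q0 qf [mf _]; split; last first.
  exists q^-1 => t _; rewrite normcV lef_pV2 ?posrE//.
  exact: lt_le_trans (qf t).
have n0 t : 0 < normc (f t) ^+ 2 by rewrite exprn_gt0// (lt_le_trans q0).
have E t : (f t)^-1 = (f t)^* * ((normc (f t) ^+ 2)^-1)%:C.
  have f0 : f t != 0 by rewrite -normc_gt0 (lt_le_trans q0).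
  rewrite rmorphV /= ?unitfE ?gt_eqF// -mulcJ.
  by rewrite invfM mulrCA mulfV ?mulr1// conjc_eq0.
apply: (@eq_cmeas _ _ _ _ (fun t => (f t)^* * ((normc (f t) ^+ 2)^-1)%:C)).
  by move=> t _; rewrite E.
apply: cmeasM; first exact: cmeasJ.
split => /=; last exact: measurable_cst.
under eq_fun do rewrite -powR_inv1 ?ltW//.
apply: (measurableT_comp (measurable_powR (-1))).
exact: cmeas_sqr_normc.
Qed.

End complex_inverse_measurable.

Section cauchy_schwarz_numbers.
Context {R : realType}.

(** Test with l = -s b^* for real s: s = 1/c minimizes the quadratic, and if c = 0 a large s forces
    b = 0. Since [a], [b], [c] are mere numbers, this also serves before a Hilbert space is
    available, and in [hprojection] with [a] a defect of minimality. *)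
Lemma cauchy_schwarz_coef (a c : R) (b : R[i]) : 0 <= c ->
  (forall l : R[i], 0 <= a + 2 * complex.Re (l * b) + normc l ^+ 2 * c) ->
  normc b ^+ 2 <= a * c.
Proof.
move=> c0 H.
have Hs (s : R) : 0 <= a - 2 * s * normc b ^+ 2 + s ^+ 2 * normc b ^+ 2 * c.
  have := H (- s%:C * b^*).
  have -> : - s%:C * b^* * b = (- (s * normc b ^+ 2))%:C.
    by rewrite mulNr mulNr -mulrA [X in _ * X]mulrC mulcJ -rmorphM -rmorphN.
  rewrite normcM normcN normcJ normc_real exprMn real_normK ?num_real//=.
  by rewrite mulrN mulrA.
have [c_eq0|c_neq0] := eqVneq c 0.
  rewrite c_eq0 mulr0 leNgt; apply/negP => b0.
  have := Hs ((a + 1) / (2 * normc b ^+ 2)); rewrite c_eq0 mulr0 addr0.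
  rewrite (_ : 2 * _ * _ = a + 1); first by lra.
  by field; rewrite -sqrf_eq0 gt_eqF.
have c_gt0 : 0 < c by rewrite lt_def c_neq0.
have := Hs c^-1.
rewrite (_ : _ + _ = a - normc b ^+ 2 / c); last by field.
by rewrite subr_ge0 ler_pdivrMr.
Qed.

End cauchy_schwarz_numbers.

(** * Inner product on the torus *)

Section torus_inner_product.
Context {R : realType} {n : nat}.
Notation mR := (measurableTypeR R).
Notation T := (torus_measure n : probability (n.-tuple mR) R).
Implicit Types (F G : 'rV[R[i]]_n -> R[i]) (z w : 'rV[R[i]]_n).

Definition tip F G : R[i] :=
  cint T setT (fun t => F (torus_point t) * (G (torus_point t))^*).

Definition tn2 F : R := complex.Re (tip F F).

Lemma tip_bmeas F G : ccontinuous F -> ccontinuous G ->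
  bmeas setT (fun t : n.-tuple mR => F (torus_point t) * (G (torus_point t))^*).
Proof.
move=> cF cG; exact: (bmeas_torus (ccontinuousM cF (ccontinuousJ cG))).
Qed.

Lemma tipDl F F' G : ccontinuous F -> ccontinuous F' -> ccontinuous G ->
  tip (fun z => F z + F' z) G = tip F G + tip F' G.
Proof.
move=> cF cF' cG; rewrite /tip -cintD//; [|exact: probability_lty|exact: tip_bmeas..].
by apply: eq_cint => t _; rewrite mulrDl.
Qed.

Lemma tipZl c F G : ccontinuous F -> ccontinuous G ->
  tip (fun z => c * F z) G = c * tip F G.
Proof.
move=> cF cG; rewrite /tip -cintZ//; [|exact: probability_lty|exact: tip_bmeas].
by apply: eq_cint => t _; rewrite mulrA.
Qed.

Lemma tipJ F G : ccontinuous F -> ccontinuous G -> tip G F = (tip F G)^*.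
Proof.
move=> cF cG; rewrite /tip -cintJ//; [|exact: probability_lty|exact: tip_bmeas].
by apply: eq_cint => t _; rewrite conjcM conjcK mulrC.
Qed.

Lemma tipDr F G G' : ccontinuous F -> ccontinuous G -> ccontinuous G' ->
  tip F (fun z => G z + G' z) = tip F G + tip F G'.
Proof.
move=> cF cG cG'.
rewrite (tipJ (ccontinuousD cG cG') cF) (tipDl cG cG' cF) conjcD.
by rewrite -(tipJ cG cF) -(tipJ cG' cF).
Qed.

Lemma tipZr c F G : ccontinuous F -> ccontinuous G ->
  tip F (fun z => c * G z) = c^* * tip F G.
Proof.
move=> cF cG; have cc := ccontinuousM (@ccontinuous_cst _ n c) cG.
by rewrite (tipJ cc cF) (tipZl c cG cF) conjcM -(tipJ cG cF).
Qed.

Lemma eq_tip F F' G G' : (forall z, cpolydisc z -> F z = F' z) ->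
  (forall z, cpolydisc z -> G z = G' z) -> tip F G = tip F' G'.
Proof.
by move=> FF GG; apply: eq_cint => t _; rewrite FF ?GG//; exact: cpolydisc_torus.
Qed.

Lemma tn2E F : tn2 F = \int[T]_t (normc (F (torus_point t)) ^+ 2).
Proof. by rewrite /tn2 /=; apply: eq_Rintegral => t _; rewrite mulcJ. Qed.

Lemma tip_real F : tip F F = (tn2 F)%:C.
Proof.
apply: complex_eqP => //=; rewrite (@eq_Rintegral _ _ _ _ _ (cst 0)).
  by rewrite Rintegral_cst// mul0r.
by move=> t _; rewrite mulcJ.
Qed.

Lemma tn2_ge0 F : 0 <= tn2 F.
Proof. by rewrite tn2E; apply: Rintegral_ge0 => t _; rewrite exprn_ge0 ?normc_ge0. Qed.

Lemma tn2D F G : ccontinuous F -> ccontinuous G ->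
  tn2 (fun z => F z + G z) = tn2 F + 2 * complex.Re (tip F G) + tn2 G.
Proof.
move=> cF cG; have cFG := ccontinuousD cF cG.
rewrite /tn2 (tipDl cF cG cFG) (tipDr cF cF cG) (tipDr cG cF cG) (tipJ cF cG).
by rewrite !cReD cReJ; lra.
Qed.

Lemma tn2Z c F : ccontinuous F -> tn2 (fun z => c * F z) = normc c ^+ 2 * tn2 F.
Proof.
move=> cF; have cc := ccontinuousM (@ccontinuous_cst _ n c) cF.
by rewrite /tn2 (tipZl c cF cc) (tipZr c cF cF) mulrA mulcJ tip_real -rmorphM /=.
Qed.

Lemma tip_cauchy_schwarz F G : ccontinuous F -> ccontinuous G ->
  normc (tip F G) ^+ 2 <= tn2 F * tn2 G.
Proof.
move=> cF cG; apply: cauchy_schwarz_coef; first exact: tn2_ge0.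
move=> l; have cl := ccontinuousM (@ccontinuous_cst _ n (l^*)) cG.
have := tn2_ge0 (fun z => F z + l^* * G z).
by rewrite (tn2D cF cl) (tn2Z _ cG) normcJ (tipZr _ cF cG) conjcK.
Qed.

Lemma tn2_le F (B : R) : ccontinuous F ->
  (forall z, cpolydisc z -> normc (F z) <= B) -> tn2 F <= B ^+ 2.
Proof.
move=> cF FB; apply: le_trans (ler_norm _) _; apply: le_trans (Re_le_normc _) _.
apply: normc_cint_prob; first exact: tip_bmeas.
move=> t; rewrite normcM normcJ -expr2 ler_pXn2r ?nnegrE//.
  exact/FB/cpolydisc_torus.
exact: le_trans (FB _ (cpolydisc_torus t)).
Qed.

Definition cholo F := ccontinuous F /\ forall z, cpolydisc z -> ldiff F z.

Lemma cpolydiscZ (s : R) z : 0 <= s <= 1 -> cpolydisc z -> cpolydisc (s%:C *: z).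
Proof.
move=> /andP[s0 s1] zD j; rewrite mxE normcM normc_real ger0_norm//.
by rewrite mulr_ile1.
Qed.

Lemma polydiscZ (s : R) z : 0 <= s < 1 -> cpolydisc z -> polydisc (s%:C *: z).
Proof.
move=> /andP[s0 s1] zD j; rewrite mxE normcM normc_real ger0_norm//.
by rewrite (le_lt_trans _ s1)// ler_piMr.
Qed.

Lemma scale_cvg (c : R[i]) z :
  (fun y : 'rV[R[i]]_n => c *: y) @ z --> (c *: z : 'rV[R[i]]_n).
Proof.
apply: (@cvg_row _ _ _ (nbhs z)) => j; rewrite mxE.
apply: (@cvg_trans _ ((fun y : 'rV[R[i]]_n => c * y 0 j) @ z)).
  by apply: near_eq_cvg; apply: nearW => y; rewrite mxE.
apply: (@ccvgM _ _ (nbhs z) _ (fun=> c)); first exact: (@ccvg_cst _ _ (nbhs z)).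
exact: coord_cvg.
Qed.

Lemma ccontinuous_dil (s : R) F : 0 <= s <= 1 -> ccontinuous F ->
  ccontinuous (fun z => F (s%:C *: z)).
Proof.
move=> s01 cF z zD; exact: (cvg_comp _ _ (@scale_cvg (s%:C) z) (cF _ (cpolydiscZ s01 zD))).
Qed.

Let dil_tipl (s : R) F G : 0 <= s < 1 -> cholo F -> ccontinuous G ->
  tip (fun z => F (s%:C *: z)) G =
  cint T setT (fun t => cint T setT (fun u =>
    F (torus_point u) * cker (s%:C *: torus_point t) (torus_point u) *
    (G (torus_point t))^*)).
Proof.
move=> s01 [cF dF] cG; apply: eq_cint => t _.
have stD := polydiscZ s01 (cpolydisc_torus t).
rewrite -(cauchy_polydisc cF dF stD) -cintZr//; first exact: probability_lty.
exact: (bmeas_torus (ccontinuousM cF (fun z => cker_cvg stD))).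
Qed.

Let cker_scale (s : R) z w : cker (s%:C *: z) w = (cker (s%:C *: w) z)^*.
Proof.
rewrite ckerJ; apply: eq_bigr => j _; rewrite !mxE conjcM conjc_real.
by congr (1 - _)^-1; rewrite mulrCA mulrA.
Qed.

(** Cauchy's formula writes F(s z) as the integral of F against [cker (s z) u], a kernel that is
    Hermitian in (z, u) by [cker_scale]; Fubini's theorem then moves the dilation to the other
    side. *)
Lemma dil_selfadjoint (s : R) F G : 0 <= s < 1 -> cholo F -> cholo G ->
  tip (fun z => F (s%:C *: z)) G = tip F (fun z => G (s%:C *: z)).
Proof.
move=> s01 hF hG; have [cF dF] := hF; have [cG dG] := hG.
have s01' : 0 <= s <= 1 by case/andP: s01 => -> /ltW ->.
rewrite (tipJ (ccontinuous_dil s01' cG) cF).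
rewrite (dil_tipl s01 hF cG) (dil_tipl s01 hG cF).
pose k (x : n.-tuple mR * n.-tuple mR) :=
  F (torus_point x.2) * cker (s%:C *: torus_point x.1) (torus_point x.2) *
  (G (torus_point x.1))^*.
have bcomp1 (h : n.-tuple mR -> R[i]) : bmeas setT h ->
    bmeas setT (fun x : n.-tuple mR * n.-tuple mR => h x.1).
  move=> [[mR' mI'] [M hM]]; split; last by exists M => x _; exact: hM.
  by split; [exact: (measurableT_comp mR')|exact: (measurableT_comp mI')].
have bcomp2 (h : n.-tuple mR -> R[i]) : bmeas setT h ->
    bmeas setT (fun x : n.-tuple mR * n.-tuple mR => h x.2).
  move=> [[mR' mI'] [M hM]]; split; last by exists M => x _; exact: hM.
  by split; [exact: (measurableT_comp mR')|exact: (measurableT_comp mI')].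
have bk : bmeas setT k.
  apply: bmeasM; last exact: (bcomp1 _ (bmeas_torus (ccontinuousJ cG))).
  apply: bmeasM; first exact: (bcomp2 _ (bmeas_torus cF)).
  apply: bmeas_prod => j.
  have bj : bmeas setT (fun t : n.-tuple mR => torus_point t 0 j).
    have cj : ccontinuous (fun y : 'rV[R[i]]_n => y 0 j).
      by move=> z _; exact: coord_cvg.
    exact: (bmeas_torus cj).
  apply: (@bmeasV _ _ _ _ (1 - s)).
  - by rewrite subr_gt0; case/andP: s01.
  - move=> x; apply: le_trans (normc_sub1_ge _); rewrite lerD2l lerN2 mxE.
    rewrite !normcM normcJ !torus_pointE !normc_cis !mulr1 normc_real.
    by rewrite ger0_norm//; case/andP: s01.
  - apply: bmeasB; first exact: bmeas_cst.
    apply: bmeasM; last exact: bmeasJ (bcomp2 _ bj).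
    under eq_fun do rewrite mxE.
    exact: bmeasZ (bcomp1 _ bj).
transitivity (cint (T \x T)%E setT k).
  by symmetry; exact: (@cint_prod12 _ _ _ _ _ T T k bk).
rewrite (@cint_prod21 _ _ _ _ _ T T k bk).
rewrite -cintJ; [|exact: measurableT|exact: probability_lty|]; last first.
  have b2 := @bmeas_cint2 _ _ _ _ _ T T _ (bmeasJ bk).
  apply: eq_bmeas b2 => u _; apply: eq_cint => t _.
  by rewrite /k /= !conjcM conjcK cker_scale conjcK; ring.
apply: eq_cint => u _.
rewrite -cintJ; [|exact: measurableT|exact: probability_lty|].
  apply: eq_cint => t _.
  by rewrite /k /= !conjcM conjcK -cker_scale; ring.
have := bmeas_prod2 (bmeasJ bk) u.
apply: eq_bmeas => t _.
by rewrite /k /= !conjcM conjcK cker_scale conjcK; ring.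
Qed.

Lemma cholo_dil (s : R) F : 0 <= s <= 1 -> cholo F -> cholo (fun z => F (s%:C *: z)).
Proof.
move=> s01 [cF dF]; split; first exact: ccontinuous_dil.
move=> z zD u; have := dF _ (cpolydiscZ s01 zD) (s%:C *: u).
by under eq_fun do rewrite scalerA mulrC -scalerA -scalerDr.
Qed.

Lemma tip_dil_dil (s : R) F : 0 <= s < 1 -> cholo F ->
  tn2 (fun z => F (s%:C *: z)) = complex.Re (tip (fun z => F ((s ^+ 2)%:C *: z)) F).
Proof.
move=> s01 hF; have s01' : 0 <= s <= 1 by case/andP: s01 => -> /ltW ->.
have := dil_selfadjoint s01 (cholo_dil s01' hF) hF; rewrite /tn2 => <-.
apply: (f_equal (@complex.Re R)).
apply: eq_tip => [z _|z _].
  by apply: (f_equal F); rewrite scalerA -rmorphM -expr2.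
reflexivity.
Qed.

(** Let m(r) be the squared norm of F(r z). Self-adjointness gives m(r) = Re <F(r^2 z), F>, so
    m(r)^2 <= m(r^2) m(1) <= (sup m) m(1) by Cauchy-Schwarz, and the supremum over r < 1 yields sup
    m <= m(1). It is finite because F is bounded. *)
Lemma tn2_dil_le (s : R) F : 0 <= s < 1 -> cholo F ->
  tn2 (fun z => F (s%:C *: z)) <= tn2 F.
Proof.
move=> s01 hF; have [cF _] := hF.
pose m (s : R) := tn2 (fun z => F (s%:C *: z)).
pose A := [set m s | s in [set s : R | 0 <= s < 1]].
have [B FB] := bounded_cpolydisc cF.
have ubA : has_ubound A.
  exists (B ^+ 2) => _ [r /andP[r0 r1] <-]; have r01 : 0 <= r <= 1 by rewrite r0 ltW.
  by apply: tn2_le; [exact: ccontinuous_dil|move=> z zD; exact/FB/cpolydiscZ].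
have mA r : 0 <= r < 1 -> m r <= sup A.
  by move=> r01; apply: ub_le_sup => //; exists r.
have m0 r : 0 <= m r by exact: tn2_ge0.
have sA0 : 0 <= sup A by apply: le_trans (mA s s01).
have m2 r : 0 <= r < 1 -> m r ^+ 2 <= sup A * tn2 F.
  move=> r01; have /andP[r0 r1] := r01.
  have r2 : 0 <= r ^+ 2 < 1 by rewrite exprn_ge0//= exprn_ilt1.
  have r2' : 0 <= r ^+ 2 <= 1 by case/andP: r2 => -> /ltW ->.
  rewrite (@le_trans _ _ (m (r ^+ 2) * tn2 F))//; last first.
    by rewrite ler_wpM2r ?tn2_ge0// mA.
  apply: le_trans (tip_cauchy_schwarz (ccontinuous_dil r2' cF) cF).
  rewrite /m (tip_dil_dil r01 hF) -real_normK ?num_real// ler_pXn2r ?nnegrE//.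
  exact: Re_le_normc.
suff : sup A <= tn2 F by apply: le_trans; exact: mA.
have [s0|s0] := eqVneq (sup A) 0; first by rewrite s0 tn2_ge0.
have sgt0 : 0 < sup A by rewrite lt_def s0.
rewrite -(ler_pM2l sgt0) -expr2.
have -> : sup A * tn2 F = Num.sqrt (sup A * tn2 F) ^+ 2.
  by rewrite sqr_sqrtr// mulr_ge0// tn2_ge0.
rewrite ler_pXn2r ?nnegrE ?sqrtr_ge0//.
apply: ge_sup; first by exists (m s); exists s.
move=> _ [r r01 <-]; rewrite -(ger0_norm (m0 r)) -sqrtr_sqr ler_wsqrtr//.
exact: m2.
Qed.

End torus_inner_product.

(** * Hardy norm *)

Section complex_limit_sum.
Context {R : realType} {T : Type} (F : set_system T) {FF : Filter F}.

Lemma ccvg_sum (I : Type) (s : seq I) (h : I -> T -> R[i]) (a : I -> R[i]) :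
  (forall i, h i @ F --> a i) ->
  (fun t => \sum_(i <- s) h i t) @ F --> \sum_(i <- s) a i.
Proof.
move=> ha; elim: s => [|i s IH].
  by rewrite big_nil; under eq_fun do rewrite big_nil; exact: ccvg_cst.
by rewrite big_cons; under eq_fun do rewrite big_cons; exact: (ccvgD (ha i) IH).
Qed.

End complex_limit_sum.

Lemma differentiable_eps (K : numFieldType) (V W : normedModType K)
    (f : V -> W) (df : {linear V -> W}) (x : V) : continuous df ->
  (forall e : K, 0 < e ->
    \forall h \near 0, `|f (h + x) - f x - df h| <= e * `|h|) ->
  differentiable f x.
Proof.
move=> cdf H.
have fE : f \o shift x = cst (f x) + df +o_ 0 id.
  apply/eqaddoP => e e0; apply: filterS (H e e0) => h.
  by rewrite !fctE /= opprD addrA.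
have dE := diff_unique cdf fE.
by apply/diff_locallyP; rewrite dE.
Qed.

Section analytic_eps.
Context {R : realType} {n : nat}.
Implicit Types (f g : 'rV[R[i]]_n -> R[i]) (z w u h : 'rV[R[i]]_n).

Definition lincomb (c : 'I_n -> R[i]) (h : 'rV[R[i]]_n) : R[i] := \sum_j c j * h 0 j.

Let lincomb_linear c : linear (lincomb c : _ -> R[i]^o).
Proof.
move=> a u v; rewrite /lincomb scaler_sumr -big_split/=.
by apply: eq_bigr => j _; rewrite !mxE mulrDr mulrCA.
Qed.

HB.instance Definition _ c := @GRing.isLinear.Build R[i] 'rV[R[i]]_n R[i] _
  (lincomb c) (lincomb_linear c).

Lemma mx_norm_coord (h : 'rV[R[i]]_n) j : normc (h 0 j) <= complex.Re `|h|.
Proof.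
have : `|h 0 j| <= `|h|.
  rewrite [leRHS]mx_normE -[leLHS]nngE num_le.
  exact: (le_bigmax _ (fun i : 'I_1 * 'I_n => `|h i.1 i.2|%:nng) (0, j)).
by rewrite normcP; case: `|h| => a b; rewrite lecE => /andP[].
Qed.

Lemma mx_norm_le (h : 'rV[R[i]]_n) (x : R) : 0 <= x ->
  (forall j, normc (h 0 j) <= x) -> `|h| <= x%:C.
Proof.
move=> x0 hx; have x0' : 0 <= x%:C by rewrite lecR.
rewrite [leLHS]mx_normE (_ : x%:C = (NngNum x0')%:num)// num_le.
apply/bigmax_leP; split=> [|[i j] _]; first by rewrite -num_le.
by rewrite -num_le /= normcP lecR ord1.
Qed.

(** Fréchet differentiability with the derivative given by its coefficients. The real [x] is any
    bound on the coordinates of [h], which avoids the R[i]-valued norm of row vectors. *)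
Definition adiff f z := exists c : 'I_n -> R[i], forall e : R, 0 < e ->
  exists2 d : R, 0 < d & forall h (x : R), 0 <= x -> x < d ->
    (forall j, normc (h 0 j) <= x) ->
    normc (f (z + h) - f z - lincomb c h) <= e * x.

Lemma differentiable_adiff f z : differentiable f z -> adiff f z.
Proof.
move=> df; exists (fun j => 'd f z (delta_mx 0 j)) => e e0.
have dE h : 'd f z h = lincomb (fun j => 'd f z (delta_mx 0 j)) h.
  rewrite {1}(row_sum_delta h) linear_sum; apply: eq_bigr => j _.
  by rewrite linearZ /= mulrC.
have /eqaddoP H := diff_locally df.
have e0' : 0 < e%:C by rewrite ltcR.
have /near_rowP[d d0 Hd] := H _ e0'.
exists d => // h x x0 xd hx.
have := Hd h; rewrite -dE.
have hd j : normc (h 0 j - (0 : 'rV[R[i]]_n) 0 j) < d.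
  by rewrite mxE subr0 (le_lt_trans (hx j)).
move=> /(_ hd) /=.
rewrite (_ : (_ - _) h = f (z + h) - f z - 'd f z h); last first.
  by rewrite /= /shift !fctE/= opprD addrA (addrC h).
rewrite normcP => Hn; rewrite -lecR; apply: le_trans Hn _.
by rewrite rmorphM; apply: ler_wpM2l; [exact: ltW|exact: mx_norm_le].
Qed.

Lemma lincomb_continuous c : continuous (lincomb c : 'rV[R[i]]_n -> R[i]).
Proof.
move=> z; rewrite /lincomb.
apply: (@ccvg_sum _ _ (nbhs z) _ _ _ (fun j (y : 'rV[R[i]]_n) => c j * y 0 j)).
move=> j.
apply: (@ccvgM _ _ (nbhs z) _ (fun=> c j)); first exact: (@ccvg_cst _ _ (nbhs z)).
exact: coord_cvg.
Qed.

Lemma adiff_differentiable f z : adiff f z -> differentiable f z.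
Proof.
move=> [c Hc].
apply: (@differentiable_eps _ _ _ f (lincomb c)).
  exact: lincomb_continuous.
move=> e e0.
have ee : e = (complex.Re e)%:C by apply: ge0_complexE; exact: ltW.
rewrite ee ltcR in e0; have [d d0 Hd] := Hc _ e0.
apply/near_rowP; exists (d / 2); first by rewrite divr_gt0.
move=> h hd.
have h0 : 0 <= complex.Re `|h|.
  have : 0 <= `|h| by [].
  by case: `|h| => a b; rewrite lecE => /andP[].
have hE : `|h| = (complex.Re `|h|)%:C by apply: ge0_complexE.
have hlt : complex.Re `|h| < d.
  rewrite (@le_lt_trans _ _ (d / 2))//; last by lra.
  rewrite -lecR -hE; apply: mx_norm_le; first by rewrite ltW// divr_gt0.
  by move=> j; have := hd j; rewrite mxE subr0 => /ltW.
have := Hd h _ h0 hlt (mx_norm_coord h).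
by rewrite (addrC h) normcP [in X in _ -> X]hE ee -rmorphM lecR.
Qed.

End analytic_eps.

Section analytic_slices.
Context {R : realType} {n : nat}.
Implicit Types (f g : 'rV[R[i]]_n -> R[i]) (z w u h : 'rV[R[i]]_n).

Lemma adiff_cvg f z : adiff f z -> f y @[y --> z] --> f z.
Proof.
by move=> /adiff_differentiable df; exact: differentiable_continuous.
Qed.

Lemma adiff_ldiff f z : adiff f z -> ldiff f z.
Proof.
move=> [c Hc] u; exists (lincomb c u) => e e0.
pose U : R := 1 + \sum_j normc (u 0 j).
have U0 : 0 < U by rewrite ltr_pwDl// sumr_ge0// => j _; exact: normc_ge0.
have uU j : normc (u 0 j) <= U.
  rewrite /U (bigD1 j)//= addrCA lerDl; apply: addr_ge0 => //.
  by apply: sumr_ge0 => k _; exact: normc_ge0.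
have [d d0 Hd] := Hc _ (divr_gt0 e0 U0).
apply/near_normcP; exists (d / U); first by rewrite divr_gt0.
move=> x; rewrite subr0 ltr_pdivlMr// => xd.
have := Hd (x *: u) (normc x * U).
rewrite mulr_ge0 ?normc_ge0 ?(ltW U0)// xd => /(_ isT isT).
have xu j : normc ((x *: u) 0 j) <= normc x * U.
  by rewrite mxE normcM ler_wpM2l// normc_ge0.
move=> /(_ xu); rewrite scale0r addr0.
have -> : lincomb c (x *: u) = lincomb c u * x by rewrite linearZ /= mulrC.
have -> : e / U * (normc x * U) = e * normc x by field; rewrite gt_eqF.
by [].
Qed.

Definition dil (r : R) f z := f (r%:C *: z).

Lemma analytic_adiff f z : analytic f -> polydisc z -> adiff f z.
Proof. by move=> af zD; apply: differentiable_adiff; exact: af. Qed.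

Lemma cholo_analytic (r : R) f : 0 <= r < 1 -> analytic f -> cholo (dil r f).
Proof.
move=> r01 af; split=> z zD.
  have H := adiff_cvg (analytic_adiff af (polydiscZ r01 zD)).
  exact: (cvg_comp _ _ (@scale_cvg _ _ r%:C z) H).
move=> u; have := adiff_ldiff (analytic_adiff af (polydiscZ r01 zD)) (r%:C *: u).
rewrite (_ : (fun x => f (r%:C *: z + x *: (r%:C *: u))) =
  (fun x => dil r f (z + x *: u)))//.
by apply/funext => x; rewrite /dil scalerDr !scalerA (mulrC x).
Qed.

Lemma ccontinuous_analytic (r : R) f : 0 <= r < 1 -> analytic f ->
  ccontinuous (dil r f).
Proof. by move=> r01 af; have [] := cholo_analytic r01 af. Qed.

Lemma tn2_dil_mono (r s : R) f : 0 <= r -> r <= s -> s < 1 -> analytic f ->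
  tn2 (dil r f) <= tn2 (dil s f).
Proof.
move=> r0; rewrite le_eqVlt => /predU1P[-> //|rs] s1 af.
have s0 : 0 < s by exact: le_lt_trans r0 rs.
have s01 : 0 <= s < 1 by rewrite ltW.
have q01 : 0 <= r / s < 1 by rewrite ltr_pdivrMr// mul1r rs andbT divr_ge0// ltW.
have := tn2_dil_le q01 (cholo_analytic s01 af).
rewrite (_ : (fun z => dil s f ((r / s)%:C *: z)) = dil r f)//.
apply/funext => z; rewrite /dil scalerA -rmorphM /=.
by rewrite mulrCA mulfV ?mulr1// gt_eqF.
Qed.

Lemma Lnorm_tn2 (r : R) f : 0 <= r < 1 -> analytic f ->
  Lnorm (torus_measure n) 2%:E (fun t => (normc (f (r%:C *: torus_point t)))%:E) =
  (Num.sqrt (tn2 (dil r f)))%:E.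
Proof.
move=> r01 af; have cf := ccontinuous_analytic r01 af.
rewrite unlock /Lnorm.
under eq_integral => t _ do rewrite poweR_EFin powR_mulrn ?normr_ge0//
  real_normK ?num_real//.
have mf : bmeas setT (fun t : n.-tuple (measurableTypeR R) => dil r f (torus_point t)).
  exact: (bmeas_torus cf).
rewrite -[X in (X `^ _)%E]fineK; last first.
  apply: integrable_fin_num => //.
  apply: bounded_measurable_integrable => //.
  - exact: probability_lty.
  - by case: mf => mf _; exact: cmeas_sqr_normc mf.
  - case: mf => _ [M HM]; exists (M ^+ 2) => t _.
    have M0 : 0 <= M by apply: le_trans (HM t I); exact: normc_ge0.
    rewrite ger0_norm ?exprn_ge0 ?normc_ge0// ler_pXn2r ?nnegrE ?normc_ge0//.
    exact: HM t I.
rewrite poweR_EFin powR12_sqrt; last first.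
  by apply: fine_ge0; apply: integral_ge0 => t _; rewrite lee_fin sqr_ge0.
by rewrite tn2E.
Qed.

Definition h2 f : R := fine (hardy_norm f) ^+ 2.

Lemma hardyP f : hardy f <-> analytic f /\
  exists B : R, forall r, 0 <= r < 1 -> tn2 (dil r f) <= B.
Proof.
split=> -[af H]; split=> //.
  have n0 : (0 <= hardy_norm f)%E.
    apply: (@le_trans _ _ (Num.sqrt (tn2 (dil 0 f)))%:E).
      by rewrite lee_fin sqrtr_ge0.
    apply: ereal_sup_ubound; exists 0 => /=; first by rewrite lexx ltr01.
    by rewrite Lnorm_tn2// lexx ltr01.
  exists (h2 f) => r r01.
  rewrite -[leLHS]sqr_sqrtr ?tn2_ge0// ler_pXn2r ?nnegrE ?sqrtr_ge0 ?fine_ge0//.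
  rewrite -lee_fin fineK ?ge0_fin_numE//.
  by apply: ereal_sup_ubound; exists r => //; rewrite Lnorm_tn2.
have [B HB] := H.
apply: (@le_lt_trans _ _ (Num.sqrt B)%:E); last exact: ltry.
apply: ge_ereal_sup => _ [r r01 <-].
by rewrite Lnorm_tn2// lee_fin ler_wsqrtr// HB.
Qed.

Lemma hardy_analytic f : hardy f -> analytic f.
Proof. by case. Qed.

Lemma h2_ub f r : hardy f -> 0 <= r < 1 -> tn2 (dil r f) <= h2 f.
Proof.
move=> [af H] r01.
have n0 : (0 <= hardy_norm f)%E.
  apply: (@le_trans _ _ (Num.sqrt (tn2 (dil 0 f)))%:E).
    by rewrite lee_fin sqrtr_ge0.
  apply: ereal_sup_ubound; exists 0 => /=; first by rewrite lexx ltr01.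
  by rewrite Lnorm_tn2// lexx ltr01.
rewrite -[leLHS]sqr_sqrtr ?tn2_ge0// ler_pXn2r ?nnegrE ?sqrtr_ge0 ?fine_ge0//.
rewrite -lee_fin fineK ?ge0_fin_numE//.
by apply: ereal_sup_ubound; exists r => //; rewrite Lnorm_tn2.
Qed.

Lemma h2_le f (B : R) : hardy f -> (forall r, 0 <= r < 1 -> tn2 (dil r f) <= B) ->
  h2 f <= B.
Proof.
move=> hf HB; have [af H] := hf.
have B0 : 0 <= B by apply: le_trans (HB 0 _); rewrite ?tn2_ge0// lexx ltr01.
have n0 : (0 <= hardy_norm f)%E.
  apply: (@le_trans _ _ (Num.sqrt (tn2 (dil 0 f)))%:E).
    by rewrite lee_fin sqrtr_ge0.
  apply: ereal_sup_ubound; exists 0 => /=; first by rewrite lexx ltr01.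
  by rewrite Lnorm_tn2// lexx ltr01.
rewrite -[leRHS]sqr_sqrtr// ler_pXn2r ?nnegrE ?sqrtr_ge0 ?fine_ge0//.
rewrite -lee_fin fineK ?ge0_fin_numE//.
apply: ge_ereal_sup => _ [r r01 <-].
by rewrite Lnorm_tn2// lee_fin ler_wsqrtr// HB.
Qed.

(** A sequence of radii increasing to 1, which turns limits over radii into limits of sequences. *)
Definition rad m : R := 1 - m.+1%:R^-1.

Lemma rad01 m : 0 <= rad m < 1.
Proof.
rewrite subr_ge0 invf_le1 ?ltr0n// ler1n /= ltrBlDr ltrDl invr_gt0.
by rewrite ltr0n.
Qed.

Lemma cvg_rad : rad @ \oo --> (1 : R).
Proof.
rewrite -[X in _ --> X](subr0 1); apply: cvgB; first exact: cvg_cst.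
exact: cvg_harmonic.
Qed.

(** The supremum over radii is a limit because the torus norms increase with the radius
    ([tn2_dil_mono]). *)
Lemma h2_cvg f : hardy f -> (fun m => tn2 (dil (rad m) f)) @ \oo --> h2 f.
Proof.
move=> hf; have af := hardy_analytic hf.
apply/cvgrPdist_lt => e e0.
have [[r r01 rP]|H] := pselect (exists2 r, 0 <= r < 1 & h2 f - e < tn2 (dil r f)); last first.
  exfalso; have : h2 f <= h2 f - e.
    apply: h2_le => // r r01; rewrite leNgt; apply/negP => rP.
    by apply: H; exists r.
  by rewrite leNgt ltrBlDr ltrDl e0.
have r1 : r < 1 by case/andP: r01.
have : \forall m \near \oo, r < rad m.
  by move/cvgrPdist_lt : cvg_rad => /(_ (1 - r)); rewrite subr_gt0 => /(_ r1);
    apply: filterS => m; rewrite ltr_norml => /andP[_]; rewrite ltrD2l ltrN2.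
apply: filterS => m rm; have := rad01 m => rm01.
rewrite ger0_norm ?subr_ge0 ?h2_ub// ltrBlDr -ltrBlDl.
apply: lt_le_trans rP _; apply: tn2_dil_mono => //.
- by case/andP: r01.
- exact: ltW.
- by case/andP: rm01.
Qed.

End analytic_slices.

Section polarization.
Context {R : realType} {n : nat}.
Implicit Types (F G f g : 'rV[R[i]]_n -> R[i]).

Lemma tip_polarization F G : ccontinuous F -> ccontinuous G ->
  tip F G = 4^-1 * \sum_(k < 4)
    'i ^+ k * (tn2 (fun z => F z + 'i ^+ k * G z))%:C.
Proof.
move=> cF cG.
have E (c : R[i]) : normc c = 1 -> tn2 (fun z => F z + c * G z) =
    tn2 F + tn2 G + 2 * complex.Re (c^* * tip F G).
  move=> c1; have cc := ccontinuousM (@ccontinuous_cst _ n c) cG.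
  by rewrite (tn2D cF cc) (tn2Z c cG) (tipZr c cF cG) c1; ring.
have i1 k : normc ('i ^+ k : R[i]) = 1.
  by rewrite normcX -complexiE normci expr1n.
rewrite !big_ord_recl big_ord0 addr0 !E//.
rewrite -complexiE !(lift0, exprS, expr0, mulr1).
have i2 : 'i%C * 'i%C = -1 :> R[i] by rewrite -expr2 sqr_i.
rewrite !i2 mul1r !mulrN1.
move: (tip F G) (tn2 F + tn2 G) => [x y] a.
have -> : complex.Re (1^* * (x +i* y)) = x.
  by rewrite cReM cReJ cImJ /= oppr0 mul0r subr0 mul1r.
have -> : complex.Re ('i%C^* * (x +i* y)) = y.
  by rewrite cReM cReJ cImJ /= mul0r sub0r mulN1r opprK.
have -> : complex.Re ((-1)^* * (x +i* y)) = - x.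
  by rewrite cReM cReJ cImJ cReN cImN /= !oppr0 mul0r subr0 mulN1r.
have -> : complex.Re ((- 'i%C)^* * (x +i* y)) = - y.
  by rewrite cReM cReJ cImJ cReN cImN /= oppr0 mul0r sub0r opprK mul1r.
apply: (@mulfI _ 4); first by rewrite pnatr_eq0.
rewrite mulrA mulfV ?pnatr_eq0// mul1r.
rewrite (_ : 4 * (x +i* y) = (4 * x) +i* (4 * y)); last first.
  have -> : 4 = 4%:C :> R[i] by rewrite rmorph_nat.
  by apply: complex_eqP; rewrite ?cReM ?cImM /= mul0r ?subr0 ?addr0.
by apply: complex_eqP; rewrite !(cReD, cImD, cReM, cImM, cReN, cImN) /=; lra.
Qed.

Lemma tn2D_le F G : ccontinuous F -> ccontinuous G ->
  tn2 (fun z => F z + G z) <= 2 * tn2 F + 2 * tn2 G.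
Proof.
move=> cF cG; have c1 := ccontinuousM (@ccontinuous_cst _ n (-1)) cG.
have := tn2_ge0 (fun z => F z + -1 * G z).
rewrite (tn2D cF c1) (tn2Z _ cG) (tipZr _ cF cG) (tn2D cF cG).
rewrite normcN normc1 expr1n rmorphN rmorph1 mulN1r cReN; lra.
Qed.

End polarization.

Section hardy_space.
Context {R : realType} {n : nat}.
Implicit Types (f g : 'rV[R[i]]_n -> R[i]) (z w : 'rV[R[i]]_n).

Lemma near_polydisc z : polydisc z -> exists2 d : R, 0 < d &
  forall y : 'rV[R[i]]_n, (forall j, normc (y 0 j - z 0 j) < d) -> polydisc y.
Proof.
move=> zD.
suff : \forall y \near z, forall j : 'I_n, normc ((y : 'rV[R[i]]_n) 0 j) < 1.
  by move/near_rowP.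
apply: (@filter_forall _ _ (fun (j : 'I_n) (y : 'rV[R[i]]_n) => normc (y 0 j) < 1)
  (nbhs z)) => j.
have z1 : 0 < 1 - normc (z 0 j) by rewrite subr_gt0; exact: zD.
have H : (fun y : 'rV[R[i]]_n => normc (y 0 j)) @ z --> normc (z 0 j).
  exact: (@ccvg_normc _ _ (nbhs z) _ _ _ (@coord_cvg _ _ z j)).
move/cvgrPdist_lt : H => /(_ _ z1); apply: filterS => y; rewrite distrC ltr_norml => /andP[_].
by rewrite ltrBlDr subrK.
Qed.

(** Differentiability is local and the polydisc is open, so the values outside do not matter. *)
Lemma eq_analytic f g : (forall z, polydisc z -> f z = g z) ->
  analytic f -> analytic g.
Proof.
move=> fg af z zD; apply: adiff_differentiable.
have [c Hc] := analytic_adiff af zD; exists c => e e0.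
have [d d0 Hd] := Hc e e0; have [k k0 Hk] := near_polydisc zD.
exists (Num.min d k) => [|h x x0]; first by rewrite lt_min d0.
rewrite lt_min => /andP[xd xk] hx.
have zhD : polydisc (z + h).
  apply: Hk => j; have -> : (z + h) 0 j - z 0 j = h 0 j by rewrite mxE; ring.
  exact: le_lt_trans (hx j) xk.
by rewrite -(fg _ zhD) -(fg _ zD); exact: Hd.
Qed.

Lemma analyticD f g : analytic f -> analytic g -> analytic (fun z => f z + g z).
Proof.
by move=> af ag z zD; exact: (@differentiableD _ _ R[i] f g z (af z zD) (ag z zD)).
Qed.

Lemma analyticM f g : analytic f -> analytic g -> analytic (fun z => f z * g z).
Proof.
by move=> af ag z zD; exact: (differentiableM (af z zD) (ag z zD)).
Qed.

Lemma analytic_cst (c : R[i]) : analytic (fun _ : 'rV[R[i]]_n => c).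
Proof. by move=> z _; exact: differentiable_cst. Qed.

Lemma analytic_coord (j : 'I_n) : analytic (fun z : 'rV[R[i]]_n => z 0 j).
Proof. by move=> z _; exact: differentiable_coord. Qed.

Lemma analyticV f : (forall z, polydisc z -> f z != 0) -> analytic f ->
  analytic (fun z => (f z)^-1).
Proof.
move=> f0 af z zD; have df := af z zD; have fz := f0 z zD.
exact: differentiableV.
Qed.

Lemma eq_tn2_dil f g (r : R) : 0 <= r < 1 ->
  (forall z, polydisc z -> f z = g z) -> tn2 (dil r f) = tn2 (dil r g).
Proof.
move=> r01 fg; apply: (f_equal (@complex.Re R)).
by apply: eq_tip => z zD; rewrite /dil fg//; exact: polydiscZ.
Qed.

Lemma eq_hardy f g : (forall z, polydisc z -> f z = g z) -> hardy f -> hardy g.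
Proof.
move=> fg /hardyP[af [B HB]]; apply/hardyP; split; first exact: eq_analytic af.
by exists B => r r01; rewrite -(eq_tn2_dil r01 fg) HB.
Qed.

Lemma hardyD f g : hardy f -> hardy g -> hardy (fun z => f z + g z).
Proof.
move=> /hardyP[af [A HA]] /hardyP[ag [B HB]]; apply/hardyP.
split; first exact: analyticD.
exists (2 * A + 2 * B) => r r01.
have := tn2D_le (ccontinuous_analytic r01 af) (ccontinuous_analytic r01 ag).
move=> /le_trans; apply.
by rewrite lerD// ler_pM2l// ?HA ?HB.
Qed.

Lemma hardyZ (c : R[i]) f : hardy f -> hardy (fun z => c * f z).
Proof.
move=> /hardyP[af [A HA]]; apply/hardyP.
split; first by apply: analyticM => //; exact: analytic_cst.
exists (normc c ^+ 2 * A) => r r01.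
have -> : tn2 (dil r (fun z => c * f z)) = normc c ^+ 2 * tn2 (dil r f).
  exact: (tn2Z c (ccontinuous_analytic r01 af)).
by rewrite ler_wpM2l ?exprn_ge0 ?normc_ge0// HA.
Qed.

Lemma tn2_le_mul (M : R) F G : ccontinuous F -> ccontinuous G ->
  (forall z : 'rV[R[i]]_n, cpolydisc z -> normc (G z) <= M * normc (F z)) ->
  0 <= M -> tn2 G <= M ^+ 2 * tn2 F.
Proof.
move=> cF cG HM M0; rewrite !tn2E -RintegralZl//; last first.
  apply: bounded_measurable_integrable => //; first exact: probability_lty.
    by have [mf _] := bmeas_torus cF; exact: cmeas_sqr_normc mf.
  have [_ [B HB]] := bmeas_torus cF; exists (B ^+ 2) => t _.
  have B0 : 0 <= B by apply: le_trans (HB t I); exact: normc_ge0.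
  rewrite ger0_norm ?exprn_ge0 ?normc_ge0// ler_pXn2r ?nnegrE ?normc_ge0//.
  exact: HB t I.
apply: le_Rintegral => //.
- apply: bounded_measurable_integrable => //; first exact: probability_lty.
    by have [mf _] := bmeas_torus cG; exact: cmeas_sqr_normc mf.
  have [_ [B HB]] := bmeas_torus cG; exists (B ^+ 2) => t _.
  have B0 : 0 <= B by apply: le_trans (HB t I); exact: normc_ge0.
  rewrite ger0_norm ?exprn_ge0 ?normc_ge0// ler_pXn2r ?nnegrE ?normc_ge0//.
  exact: HB t I.
- apply: bounded_measurable_integrable => //; first exact: probability_lty.
    have [mf _] := bmeas_torus (ccontinuousM (@ccontinuous_cst _ n M%:C) cF).
    apply: eq_measurable_fun (cmeas_sqr_normc mf) => t _.
    by rewrite normcM normc_real exprMn real_normK ?num_real.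
  have [_ [B HB]] := bmeas_torus cF; exists (M ^+ 2 * B ^+ 2) => t _.
  have B0 : 0 <= B by apply: le_trans (HB t I); exact: normc_ge0.
  rewrite ger0_norm ?mulr_ge0 ?exprn_ge0 ?normc_ge0//.
  rewrite ler_wpM2l ?exprn_ge0// ler_pXn2r ?nnegrE ?normc_ge0//.
  exact: HB t I.
- move=> t _; rewrite -exprMn ler_pXn2r ?nnegrE ?mulr_ge0 ?normc_ge0//.
  exact/HM/cpolydisc_torus.
Qed.

Definition bounded_on_polydisc f := exists M : R, forall z, polydisc z -> normc (f z) <= M.

Lemma hardy_mul_bounded f g : analytic f -> bounded_on_polydisc f -> hardy g ->
  hardy (fun z => f z * g z).
Proof.
move=> af [M HM] /hardyP[ag [B HB]]; apply/hardyP.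
have afg := analyticM af ag; split=> //.
have M0 : 0 <= M.
  have z0 : polydisc (0 : 'rV[R[i]]_n) by move=> j; rewrite mxE normc0.
  by apply: le_trans (HM _ z0); exact: normc_ge0.
exists (M ^+ 2 * B) => r r01.
apply: le_trans (_ : M ^+ 2 * tn2 (dil r g) <= _); last first.
  by rewrite ler_wpM2l ?exprn_ge0// HB.
apply: tn2_le_mul => //; [exact: ccontinuous_analytic..|].
move=> z zD; rewrite /dil normcM ler_wpM2r ?normc_ge0//.
exact/HM/polydiscZ.
Qed.

Lemma hardy_bounded f : analytic f -> bounded_on_polydisc f -> hardy f.
Proof.
move=> af [M HM]; apply/hardyP; split=> //; exists (M ^+ 2) => r r01.
apply: tn2_le; first exact: ccontinuous_analytic.
by move=> z zD; exact/HM/polydiscZ.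
Qed.

(** [hardy_inner] is a polarized norm, whose sesquilinearity is not visible. The polarization
    identity on the torus exhibits it as a limit of sesquilinear forms, from which it inherits its
    algebra. *)
Lemma hardy_inner_cvg f g : hardy f -> hardy g ->
  (fun m => tip (dil (rad m) f) (dil (rad m) g)) @ \oo --> hardy_inner f g.
Proof.
move=> hf hg.
have af := hardy_analytic hf; have ag := hardy_analytic hg.
have E m : tip (dil (rad m) f) (dil (rad m) g) = 4^-1 * \sum_(k < 4)
    'i ^+ k * (tn2 (dil (rad m) (fun z => f z + 'i ^+ k * g z)))%:C.
  exact: (tip_polarization (ccontinuous_analytic (rad01 m) af)
    (ccontinuous_analytic (rad01 m) ag)).
rewrite (_ : (fun m => _) = (fun m => 4^-1 * \sum_(k < 4)
    'i ^+ k * (tn2 (dil (rad m) (fun z => f z + 'i ^+ k * g z)))%:C)); last first.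
  by apply/funext => m; rewrite E.
apply: (@ccvgM _ _ _ _ (fun=> 4^-1)); first exact: ccvg_cst.
apply: ccvg_sum => k; apply: (@ccvgM _ _ _ _ (fun=> 'i ^+ k)).
  exact: ccvg_cst.
by apply: ccvg_real; apply: h2_cvg; apply: hardyD => //; exact: hardyZ.
Qed.

End hardy_space.

(** * Hilbert spaces *)

Section hilbert.
Context {R : realType} {H : lmodType R[i]}.
Variable ip : H -> H -> R[i].
Implicit Types (x y z : H) (c : R[i]).

(** The squared norm; all estimates are made on squares to avoid square roots. *)
Definition n2 x : R := complex.Re (ip x x).

Definition hcvg (u : nat -> H) (l : H) := forall e : R, 0 < e ->
  exists N, forall m, (N <= m)%N -> n2 (u m - l) < e.

Record is_hilbert : Prop := IsHilbert {
  ipDl : forall x y z, ip (x + y) z = ip x z + ip y z;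
  ipZl : forall c x y, ip (c *: x) y = c * ip x y;
  ipJ : forall x y, ip y x = (ip x y)^*;
  n2_ge0 : forall x, 0 <= n2 x;
  n2_eq0 : forall x, n2 x = 0 -> x = 0;
  ip_complete : forall u : nat -> H,
    (forall e : R, 0 < e -> exists N, forall m k, (N <= m)%N -> (N <= k)%N ->
      n2 (u m - u k) < e) -> exists l, hcvg u l
}.

Hypothesis hH : is_hilbert.

Lemma ipDr x y z : ip x (y + z) = ip x y + ip x z.
Proof. by rewrite (ipJ hH) (ipDl hH) conjcD -!(ipJ hH). Qed.

Lemma ipZr c x y : ip x (c *: y) = c^* * ip x y.
Proof. by rewrite (ipJ hH) (ipZl hH) conjcM -(ipJ hH). Qed.

Lemma ipNl x y : ip (- x) y = - ip x y.
Proof. by rewrite -scaleN1r (ipZl hH) mulN1r. Qed.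

Lemma ipNr x y : ip x (- y) = - ip x y.
Proof. by rewrite (ipJ hH) ipNl conjcN -(ipJ hH). Qed.

Lemma ipBl x y z : ip (x - y) z = ip x z - ip y z.
Proof. by rewrite (ipDl hH) ipNl. Qed.

Lemma ipBr x y z : ip x (y - z) = ip x y - ip x z.
Proof. by rewrite ipDr ipNr. Qed.

Lemma ip0l y : ip 0 y = 0.
Proof. by rewrite -(scale0r 0) (ipZl hH) mul0r. Qed.

Lemma ip0r y : ip y 0 = 0.
Proof. by rewrite (ipJ hH) ip0l conjc0. Qed.

Lemma ip_real x : ip x x = (n2 x)%:C.
Proof.
have : complex.Im (ip x x) = 0.
  have := f_equal (@complex.Im R) (ipJ hH x x); rewrite cImJ; lra.
by rewrite /n2; case: (ip x x) => a b /= ->.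
Qed.

Lemma ip_eq0 x : ip x x = 0 -> x = 0.
Proof. by rewrite ip_real => -[]; exact: (n2_eq0 hH). Qed.

Lemma ip_ext x y : (forall z, ip x z = ip y z) -> x = y.
Proof.
move=> H0; apply/eqP; rewrite -subr_eq0; apply/eqP/ip_eq0.
by rewrite ipBl H0 subrr.
Qed.

Lemma n2D x y : n2 (x + y) = n2 x + 2 * complex.Re (ip x y) + n2 y.
Proof.
by rewrite /n2 (ipDl hH) !ipDr (ipJ hH x y) !cReD cReJ; lra.
Qed.

Lemma n2Z c x : n2 (c *: x) = normc c ^+ 2 * n2 x.
Proof.
by rewrite /n2 (ipZl hH) ipZr mulrA mulcJ ip_real -rmorphM.
Qed.

Lemma n2N x : n2 (- x) = n2 x.
Proof. by rewrite -scaleN1r n2Z normcN normc1 expr1n mul1r. Qed.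

Lemma n2BC x y : n2 (x - y) = n2 (y - x).
Proof. by rewrite -n2N opprB. Qed.

Lemma n2_0 : n2 0 = 0.
Proof. by rewrite /n2 ip0l. Qed.

Lemma n2_parallelogram x y : n2 (x + y) + n2 (x - y) = 2 * n2 x + 2 * n2 y.
Proof. by rewrite !n2D n2N ipNr cReN; lra. Qed.

Lemma n2D_le2 x y : n2 (x + y) <= 2 * n2 x + 2 * n2 y.
Proof. by rewrite -n2_parallelogram lerDl (n2_ge0 hH). Qed.

Lemma hcauchy_schwarz x y : normc (ip x y) ^+ 2 <= n2 x * n2 y.
Proof.
apply: cauchy_schwarz_coef => [|l]; first exact: (n2_ge0 hH).
have := n2_ge0 hH (x + l^* *: y).
by rewrite n2D n2Z normcJ ipZr conjcK.
Qed.

Lemma ip_hcvgl (u : nat -> H) l y : hcvg u l -> (fun m => ip (u m) y) @ \oo --> ip l y.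
Proof.
move=> ul; apply/ccvgP => e e0.
pose K := n2 y + 1; have K0 : 0 < K by rewrite ltr_pwDr// (n2_ge0 hH).
have [N NP] := ul (e ^+ 2 / K) (divr_gt0 (exprn_gt0 2 e0) K0).
exists N => // m /= Nm; rewrite -ipBl -(@ltr_pXn2r _ 2) ?nnegrE ?normc_ge0 ?ltW//.
apply: le_lt_trans (hcauchy_schwarz _ _) _.
have := NP m Nm; rewrite ltr_pdivlMr// => H1.
apply: le_lt_trans H1; apply: ler_wpM2l; first exact: (n2_ge0 hH).
by rewrite /K lerDl.
Qed.

Lemma hcvg_n2 (u : nat -> H) l : hcvg u l -> (fun m => n2 (u m)) @ \oo --> n2 l.
Proof.
move=> ul.
have E m : n2 (u m) = n2 (u m - l) + 2 * complex.Re (ip (u m) l) - n2 l.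
  have := n2D (u m - l) l; rewrite subrK ipBl cReD cReN -/(n2 l) => ->.
  by move: (n2 _) (n2 l) (complex.Re _) => a b c; lra.
rewrite (_ : (fun m => _) =
   (fun m => n2 (u m - l) + 2 * complex.Re (ip (u m) l) - n2 l)); last first.
  by apply/funext.
rewrite [X in _ --> X](_ : n2 l = 0 + 2 * complex.Re (ip l l) - n2 l); last first.
  by rewrite /n2; move: (complex.Re _) => a; lra.
apply: cvgB; last exact: cvg_cst.
apply: cvgD.
  apply/cvgrPdist_lt => e e0; have [N NP] := ul e e0.
  exists N => // m /= Nm; rewrite sub0r normrN ger0_norm ?(n2_ge0 hH)//.
  exact: NP.
apply: cvgM; first exact: cvg_cst.
apply: (@ccvg_Re _ _ \oo); exact: ip_hcvgl.
Qed.

Definition hclosed (M : H -> Prop) := forall u l, (forall m, M (u m)) ->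
  hcvg u l -> M l.

Definition hsubspace (M : H -> Prop) := (exists x, M x) /\
  forall c x y, M x -> M y -> M (c *: x + y).

Lemma hcvg_cauchy (u : nat -> H) l : hcvg u l ->
  forall e : R, 0 < e -> exists N, forall m k, (N <= m)%N -> (N <= k)%N ->
      n2 (u m - u k) < e.
Proof.
move=> ul e e0; have e4 : 0 < e / 4 by rewrite divr_gt0.
have [N NP] := ul _ e4; exists N => m k Nm Nk.
have -> : u m - u k = (u m - l) + (l - u k) by rewrite addrA subrK.
apply: le_lt_trans (n2D_le2 _ _) _; rewrite [n2 (l - _)]n2BC.
have := NP m Nm; have := NP k Nk; lra.
Qed.

(** The parallelogram law makes a minimizing sequence Cauchy, and its limit inherits orthogonality
    from the approximate orthogonality of its terms. *)
Lemma hprojection (M : H -> Prop) : hsubspace M -> hclosed M ->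
  forall x, exists2 y, M y & forall m, M m -> ip (x - y) m = 0.
Proof.
move=> [[m0 Mm0] Mlin] Mcl x.
have M0 : M 0 by have := Mlin (-1) _ _ Mm0 Mm0; rewrite scaleN1r addNr.
have MZ c m : M m -> M (c *: m) by move=> Mm; rewrite -[_ *: _]addr0; exact: Mlin.
have MD y m : M y -> M m -> M (y + m).
  by move=> My Mm; rewrite -[y]scale1r; exact: Mlin.
pose A := [set n2 (x - m) | m in [set m | M m]].
have A0 : A !=set0 by exists (n2 (x - 0)); exists 0.
have lbA : has_lbound A by exists 0 => _ [m _ <-]; exact: (n2_ge0 hH).
pose d := inf A.
have dle m : M m -> d <= n2 (x - m) by move=> Mm; apply: ge_inf => //; exists m.
have ex (k : nat) : exists m, M m /\ n2 (x - m) < d + k.+1%:R^-1.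
  have k0 : 0 < k.+1%:R^-1 :> R by rewrite invr_gt0 ltr0n.
  have [_ [m Mm <-] mk] := inf_adherent k0 (conj A0 lbA).
  by exists m.
clearbody d; have [u uP] := choice ex.
have uM k : M (u k) by case: (uP k).
have ud k : n2 (x - u k) < d + k.+1%:R^-1 by case: (uP k).
have small (e : R) : 0 < e -> exists N, forall m, (N <= m)%N -> m.+1%:R^-1 < e.
  move=> e0; have /cvgrPdist_lt /(_ e e0) [N _ NP] := @cvg_harmonic R.
  exists N => m Nm; have := NP m Nm; rewrite /= sub0r normrN ger0_norm//.
have mid m k : n2 (u m - u k) <= 2 * m.+1%:R^-1 + 2 * k.+1%:R^-1.
  have := n2_parallelogram (x - u m) (x - u k).
  have -> : (x - u m) - (x - u k) = - (u m - u k).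
    by rewrite opprB addrC addrA subrK opprB.
  rewrite n2N.
  have -> : (x - u m) + (x - u k) = 2%:C *: (x - 2^-1%:C *: (u m + u k)).
    rewrite scalerBr scalerA -rmorphM /= mulfV ?pnatr_eq0// scale1r.
    by rewrite rmorph_nat scaler_nat mulr2n opprD addrACA.
  rewrite n2Z normc_real ger0_norm//.
  have := dle (2^-1%:C *: (u m + u k)) (MZ _ _ (MD _ _ (uM m) (uM k))).
  have := ud m; have := ud k.
  move: (n2 (x - u m)) (n2 (x - u k)) (n2 (u m - u k)) (m.+1%:R^-1) (k.+1%:R^-1).
  by move=> *; lra.
have [e e0|y uy] := ip_complete hH (u := u).
  have e4 : 0 < e / 4 by rewrite divr_gt0.
  have [N NP] := small _ e4; exists N => m k Nm Nk.
  apply: le_lt_trans (mid m k) _; have := NP m Nm; have := NP k Nk.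
  by move: (m.+1%:R^-1) (k.+1%:R^-1) => *; lra.
exists y; first exact: (Mcl u).
move=> m Mm.
(* [u k] misses the minimal squared distance by less than 1/(k+1); this defect plays the part of [a]
   in [cauchy_schwarz_coef]. *)
have ortho k : normc (ip (x - u k) m) ^+ 2 <= k.+1%:R^-1 * n2 m.
  apply: cauchy_schwarz_coef => [|l]; first exact: (n2_ge0 hH).
  have := dle (u k - l^* *: m) (MD _ _ (uM k) _).
  rewrite -scaleNr => /(_ (MZ _ _ Mm)).
  have -> : x - (u k + - l^* *: m) = (x - u k) + l^* *: m.
    by rewrite opprD addrA scaleNr opprK.
  rewrite n2D n2Z normcJ ipZr conjcK; have := ud k.
  by move: (k.+1%:R^-1) => *; lra.
have cv : (fun k => ip (x - u k) m) @ \oo --> ip (x - y) m.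
  have -> : (fun k => ip (x - u k) m) = (fun k => ip x m - ip (u k) m).
    by apply/funext => k; rewrite ipBl.
  rewrite ipBl; apply: (ccvgB (ccvg_cst (a := ip x m))).
  exact: ip_hcvgl.
apply/eqP; rewrite -normc_eq0 eq_le normc_ge0 andbT.
apply/ler_addgt0Pl => e e0; rewrite addr0.
have e2 : 0 < e / 2 by rewrite divr_gt0.
have /ccvgP /(_ _ e2) [N1 _ NP1] := cv.
have K0 : 0 < n2 m + 1 by rewrite ltr_pwDr// (n2_ge0 hH).
have [N2 NP2] := small ((e / 2) ^+ 2 / (n2 m + 1)) (divr_gt0 (exprn_gt0 2 e2) K0).
pose k := maxn N1 N2.
have h1 := NP1 k (leq_maxl _ _); have h2' := NP2 k (leq_maxr _ _).
have h3 : normc (ip (x - u k) m) <= e / 2.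
  rewrite -(@ler_pXn2r _ 2) ?nnegrE ?normc_ge0 ?(ltW e2)//.
  apply: le_trans (ortho k) _; rewrite ltr_pdivlMr// in h2'.
  apply: le_trans (ltW h2'); apply: ler_wpM2l; first by rewrite invr_ge0.
  by rewrite lerDl.
have := normc_triangle (ip (x - u k) m) (ip (x - y) m) 0.
rewrite !subr0 normcBC => h4; apply: le_trans h4 _.
rewrite [leRHS](splitr e) lerD// ltW//.
Qed.

Definition is_linear (V : H -> H) := forall c x y, V (c *: x + y) = c *: V x + V y.

Definition is_adjoint (W V : H -> H) := forall x y, ip (W x) y = ip x (V y).

Lemma adjointC (V V' W W' : H -> H) : is_adjoint W V -> is_adjoint W' V' ->
  (forall x, V' (V x) = V (V' x)) -> forall x, W (W' x) = W' (W x).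
Proof. by move=> WV WV' VC x; apply: ip_ext => z; rewrite WV WV' WV' WV VC. Qed.

Lemma adjoint_comm (V V' W W' : H -> H) : is_adjoint W V -> is_adjoint W' V' ->
  (forall x, V (W' x) = W' (V x)) -> forall x, W (V' x) = V' (W x).
Proof.
move=> WV WV' VC x; apply: ip_ext => z.
by rewrite WV (ipJ hH) -WV' -VC -(ipJ hH) -WV (ipJ hH) [RHS](ipJ hH) WV'.
Qed.

Section linear_maps.
Variable V : H -> H.
Hypothesis Vlin : is_linear V.

Lemma is_linear0 : V 0 = 0.
Proof. by have := Vlin (-1) 0 0; rewrite scaler0 addr0 scaleN1r addNr. Qed.

Lemma is_linearD x y : V (x + y) = V x + V y.
Proof. by have := Vlin 1 x y; rewrite !scale1r. Qed.

Lemma is_linearZ c x : V (c *: x) = c *: V x.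
Proof. by have := Vlin c x 0; rewrite is_linear0 !addr0. Qed.

Lemma is_linearB x y : V (x - y) = V x - V y.
Proof. by rewrite -scaleN1r is_linearD is_linearZ scaleN1r. Qed.

End linear_maps.

Section isometry.
Variable V : H -> H.
Hypothesis Vlin : is_linear V.
Hypothesis Viso : forall x, n2 (V x) = n2 x.

Let VB := is_linearB Vlin.

Lemma isometry_closed : hclosed (fun y => exists x, y = V x).
Proof.
move=> u l uV ul; have [v vP] := choice uV.
have [e e0|x vx] := ip_complete hH (u := v).
  have [N NP] := hcvg_cauchy ul e0; exists N => m k Nm Nk.
  by rewrite -Viso VB -!vP; exact: NP.
exists x; apply/eqP; rewrite -subr_eq0; apply/eqP/(n2_eq0 hH)/eqP.
rewrite eq_le (n2_ge0 hH) andbT; apply/ler_addgt0Pl => e e0; rewrite addr0.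
have e4 : 0 < e / 4 by rewrite divr_gt0.
have [N1 NP1] := ul _ e4; have [N2 NP2] := vx _ e4.
pose k := maxn N1 N2.
have h1 := NP1 k (leq_maxl _ _); have := NP2 k (leq_maxr _ _).
rewrite -Viso VB -vP => h2'.
have -> : l - V x = (l - u k) + (u k - V x) by rewrite addrA subrK.
apply: le_trans (n2D_le2 _ _) _; rewrite [n2 (l - _)]n2BC; lra.
Qed.

Lemma isometry_ip x y : ip (V x) (V y) = ip x y.
Proof.
have VD := is_linearD Vlin; have VZ := is_linearZ Vlin.
have re a b : complex.Re (ip (V a) (V b)) = complex.Re (ip a b).
  by have := Viso (a + b); rewrite VD !n2D !Viso; lra.
apply: complex_eqP => //; have := re ('i *: x) y.
by rewrite VZ !(ipZl hH) !cReM /= !mul0r !mul1r !sub0r => /oppr_inj.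
Qed.

(** [W x] is the preimage under [V] of the projection of [x] onto the closed range of [V]; this
    stands in for the Riesz representation theorem. *)
Lemma isometry_adjoint : exists W : H -> H, is_adjoint W V.
Proof.
have Vsub : hsubspace (fun y => exists x, y = V x).
  split; first by exists (V 0); exists 0.
  by move=> c _ _ [x ->] [y ->]; exists (c *: x + y); rewrite Vlin.
suff ex x : exists w, forall y, ip w y = ip x (V y).
  by have [W WP] := choice ex; exists W.
have [_ [w ->] wP] := hprojection Vsub isometry_closed x.
exists w => y; have : ip (x - V w) (V y) = 0 by apply: wP; exists y.
by rewrite ipBl isometry_ip => /eqP; rewrite subr_eq0 => /eqP.
Qed.

Lemma isometry_inj x y : V x = V y -> x = y.
Proof.
move=> xy; apply/eqP; rewrite -subr_eq0; apply/eqP/(n2_eq0 hH).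
by rewrite -Viso VB xy subrr n2_0.
Qed.

Variable W : H -> H.
Hypothesis WV : is_adjoint W V.

Lemma adjoint_linear : is_linear W.
Proof.
move=> c x y; apply: ip_ext => z.
by rewrite (ipDl hH) (ipZl hH) !WV (ipDl hH) (ipZl hH).
Qed.

Lemma adjointr x y : ip x (W y) = ip (V x) y.
Proof. by rewrite (ipJ hH) WV -(ipJ hH). Qed.

Lemma adjoint_isometryK x : W (V x) = x.
Proof. by apply: ip_ext => z; rewrite WV isometry_ip. Qed.

Lemma adjoint_contraction x : n2 (W x) <= n2 x.
Proof.
have := n2_ge0 hH (x - V (W x)).
rewrite n2D n2N Viso ipNr cReN -WV -/(n2 (W x)).
by move: (n2 _) (n2 _) => a b; lra.
Qed.

End isometry.

End hilbert.

(** * The Hardy space as a Hilbert space *)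

Section complex_unique.
Context {R : realType} {T : Type} (F : set_system T) {FF : ProperFilter F}.

Lemma ccvg_unique (f : T -> R[i]) (a b : R[i]) : f @ F --> a -> f @ F --> b -> a = b.
Proof.
move=> /ccvgP fa /ccvgP fb; apply/eqP; rewrite -subr_eq0 -normc_eq0.
rewrite eq_le normc_ge0 andbT; apply/ler_addgt0Pl => e e0; rewrite addr0.
have e2 : 0 < e / 2 by rewrite divr_gt0.
have [t [/= ta tb]] := filter_ex (filterI (fa _ e2) (fb _ e2)).
apply: le_trans (normc_triangle (f t) _ _) _; rewrite normcBC.
by rewrite [leRHS](splitr e) lerD// ltW.
Qed.

End complex_unique.

Section hardy_type.
Context {R : realType} {n : nat}.
Notation fT := ('rV[R[i]]_n -> R[i]).
Implicit Types (f g : fT) (z w : 'rV[R[i]]_n).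

Definition hardy_pred : {pred fT} :=
  [pred f | `[< hardy f /\ forall z, ~ polydisc z -> f z = 0 >]].

Lemma hardy0 : hardy (fun _ : 'rV[R[i]]_n => 0).
Proof.
apply: hardy_bounded; first exact: analytic_cst.
by exists 0 => z _; rewrite normc0.
Qed.

Lemma hardy_pred_submod_closed : submod_closed hardy_pred.
Proof.
split=> [|c f g].
  by apply/asboolP; split; [exact: hardy0|move=> z _].
move=> /asboolP[hf f0] /asboolP[hg g0]; apply/asboolP; split.
  exact: hardyD (hardyZ c hf) hg.
by move=> z zD; rewrite !fctE f0 ?g0// scaler0 addr0.
Qed.

HB.instance Definition _ := GRing.isSubmodClosed.Build R[i] fT hardy_pred
  hardy_pred_submod_closed.

(* Elements vanish outside the polydisc, so that equality of elements is equality
   on the polydisc. *)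
Record hardyT := HardyT { hval :> fT ; hvalP : hval \in hardy_pred }.

HB.instance Definition _ := [isSub for hval].
HB.instance Definition _ := [Choice of hardyT by <:].
HB.instance Definition _ := [SubChoice_isSubLmodule of hardyT by <:].

Lemma hval_hardy (F : hardyT) : hardy F.
Proof. by have /asboolP[] := hvalP F. Qed.

Lemma hval_out (F : hardyT) z : ~ polydisc z -> F z = 0.
Proof. by have /asboolP[_] := hvalP F; apply. Qed.

Definition restr f : fT := fun z => if `[< polydisc z >] then f z else 0.

Lemma restrE f z : polydisc z -> restr f z = f z.
Proof. by move=> zD; rewrite /restr; case: asboolP. Qed.

Lemma restr_pred f : hardy f -> restr f \in hardy_pred.
Proof.
move=> hf; apply/asboolP; split; last by move=> z zD; rewrite /restr; case: asboolP.
by apply: eq_hardy hf => z zD; rewrite restrE.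
Qed.

Definition mkH f (hf : hardy f) : hardyT := HardyT (restr_pred hf).

Lemma mkHE f (hf : hardy f) z : polydisc z -> mkH hf z = f z.
Proof. exact: restrE. Qed.

Lemma hardyT_ext (F G : hardyT) : (forall z, polydisc z -> F z = G z) -> F = G.
Proof.
move=> FG; apply: val_inj; apply/funext => z.
have [zD|zD] := pselect (polydisc z); first exact: FG.
by rewrite /= !hval_out.
Qed.

Lemma hDE (F G : hardyT) z : (F + G) z = F z + G z.
Proof. by []. Qed.

Lemma hZE (c : R[i]) (F : hardyT) z : (c *: F) z = c * F z.
Proof. by []. Qed.

Lemma hBE (F G : hardyT) z : (F - G) z = F z - G z.
Proof. by []. Qed.

Lemma h0E z : (0 : hardyT) z = 0.
Proof. by []. Qed.

Definition hip (F G : hardyT) : R[i] := hardy_inner F G.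

Lemma hip_cvg (F G : hardyT) :
  (fun m => tip (dil (rad m) F) (dil (rad m) G)) @ \oo --> hip F G.
Proof. by apply: hardy_inner_cvg; exact: hval_hardy. Qed.

Lemma hcc m (F : hardyT) : ccontinuous (dil (rad m) F).
Proof. exact: ccontinuous_analytic (rad01 m) (hardy_analytic (hval_hardy F)). Qed.

Lemma hipDl (F G K : hardyT) : hip (F + G) K = hip F K + hip G K.
Proof.
apply: (@ccvg_unique _ _ \oo _ _ _ _ (@hip_cvg (F + G) K)).
rewrite (_ : (fun m => _) = (fun m => tip (dil (rad m) F) (dil (rad m) K) +
   tip (dil (rad m) G) (dil (rad m) K))).
  exact: ccvgD (@hip_cvg F K) (@hip_cvg G K).
by apply/funext => m; exact: (tipDl (@hcc m F) (@hcc m G) (@hcc m K)).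
Qed.

Lemma hipZl c (F G : hardyT) : hip (c *: F) G = c * hip F G.
Proof.
apply: (@ccvg_unique _ _ \oo _ _ _ _ (@hip_cvg (c *: F) G)).
rewrite (_ : (fun m => _) = (fun m => c * tip (dil (rad m) F) (dil (rad m) G))).
  exact: ccvgM (ccvg_cst (a := c)) (@hip_cvg F G).
by apply/funext => m; exact: (tipZl c (@hcc m F) (@hcc m G)).
Qed.

Lemma hipJ (F G : hardyT) : hip G F = (hip F G)^*.
Proof.
apply: (@ccvg_unique _ _ \oo _ _ _ _ (@hip_cvg G F)).
rewrite (_ : (fun m => _) = (fun m => (tip (dil (rad m) F) (dil (rad m) G))^*)).
  exact: ccvgJ (@hip_cvg F G).
by apply/funext => m; exact: (tipJ (@hcc m F) (@hcc m G)).
Qed.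

Lemma hipDr (F G K : hardyT) : hip F (G + K) = hip F G + hip F K.
Proof. by rewrite hipJ hipDl conjcD -!hipJ. Qed.

Lemma hipZr c (F G : hardyT) : hip F (c *: G) = c^* * hip F G.
Proof. by rewrite hipJ hipZl conjcM -hipJ. Qed.

Lemma hip_h2 (F : hardyT) : hip F F = (h2 F)%:C.
Proof.
apply: (@ccvg_unique _ _ \oo _ _ _ _ (@hip_cvg F F)).
rewrite (_ : (fun m => _) = (fun m => (tn2 (dil (rad m) F))%:C)).
  by apply: ccvg_real; exact: h2_cvg (hval_hardy F).
by apply/funext => m; rewrite tip_real.
Qed.

Lemma n2_h2 (F : hardyT) : n2 hip F = h2 F.
Proof. by rewrite /n2 hip_h2. Qed.

Lemma n2_hardyT_ge0 (F : hardyT) : 0 <= n2 hip F.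
Proof. by rewrite n2_h2 /h2 sqr_ge0. Qed.

End hardy_type.
Arguments hardyT : clear implicits.

(** * Reproducing kernels and point evaluations *)

Section reproducing_kernel.
Context {R : realType} {n : nat}.
Notation H := (hardyT R n).
Implicit Types (z w : 'rV[R[i]]_n) (F G : H).

Lemma polydisc0 : polydisc (0 : 'rV[R[i]]_n).
Proof. by move=> j; rewrite mxE normc0. Qed.

Lemma analytic_prod (f : 'I_n -> 'rV[R[i]]_n -> R[i]) (s : seq 'I_n) :
  (forall j, analytic (f j)) -> analytic (fun z => \prod_(j <- s) f j z).
Proof.
move=> af; elim: s => [|j s IH].
  by under eq_fun do rewrite big_nil; exact: analytic_cst.
by under eq_fun do rewrite big_cons; exact: (analyticM (af j) IH).
Qed.

Lemma cker_analytic w : polydisc w -> analytic (cker^~ w).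
Proof.
move=> wD; apply: (analytic_prod (f := fun j z => (1 - z 0 j * (w 0 j)^*)^-1)) => j.
apply: analyticV.
  by move=> z zD; apply: cker_factor_neq0 => //; exact: sub_cpolydisc.
apply: (@eq_analytic _ _ (fun z => 1 + - (w 0 j)^* * z 0 j)).
  by move=> z _; rewrite mulNr mulrC.
apply: analyticD; first exact: analytic_cst.
by apply: analyticM; [exact: analytic_cst|exact: analytic_coord].
Qed.

Lemma cker_le (rho : R) w z : 0 <= rho < 1 -> (forall j, normc (w 0 j) <= rho) ->
  cpolydisc z -> normc (cker z w) <= ((1 - rho)^-1) ^+ n.
Proof.
move=> /andP[r0 r1] wr zD.
rewrite normc_prod -[X in _ <= _ ^+ X]card_ord -prodr_const ler_prod// => j _.
rewrite normc_ge0 /= normcV lef_pV2 ?posrE ?subr_gt0//; last first.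
  rewrite normc_gt0 sub1_neq0// normcM normcJ.
  apply: le_lt_trans r1; rewrite -[leRHS]mul1r.
  by apply: ler_pM => //; exact: normc_ge0.
apply: le_trans (normc_sub1_ge _); rewrite lerD2l lerN2 normcM normcJ.
by rewrite -[leRHS]mul1r; apply: ler_pM => //; exact: normc_ge0.
Qed.

Lemma polydisc_rho w : polydisc w -> exists2 rho : R, 0 <= rho < 1 &
  forall j, normc (w 0 j) <= rho.
Proof.
move=> wD; have [d d0 dP] := near_polydisc wD.
exists (\big[Num.max/0]_j normc (w 0 j)).
  rewrite bigmax_ge_id /=; apply/bigmax_ltP; split => // j _; exact: wD.
by move=> j; exact: le_bigmax.
Qed.

Lemma cker_bounded w : polydisc w -> bounded_on_polydisc (cker^~ w).
Proof.
move=> wD; have [rho r01 wr] := polydisc_rho wD.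
by exists ((1 - rho)^-1 ^+ n) => z zD; apply: cker_le => //; exact: sub_cpolydisc.
Qed.

Lemma cker_hardy w : polydisc w -> hardy (cker^~ w).
Proof.
by move=> wD; apply: hardy_bounded; [exact: cker_analytic|exact: cker_bounded].
Qed.

Definition kerH w (wD : polydisc w) : H := mkH (cker_hardy wD).

Lemma tip_cker (f : 'rV[R[i]]_n -> R[i]) (r : R) w : 0 <= r < 1 -> analytic f ->
  polydisc w -> tip (dil r f) (fun z => cker z w) = f (r%:C *: w).
Proof.
move=> r01 af wD; have [cF dF] := cholo_analytic r01 af.
rewrite -[RHS]/(dil r f w) -(cauchy_polydisc cF dF wD).
by apply: eq_cint => t _; rewrite ckerJ.
Qed.

(** At radius r the torus product is F(r (r w)): one r comes from dilating F, the other from moving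
    r across the kernel to [w]. Continuity at [w] gives the limit. *)
Lemma reproducing F w (wD : polydisc w) : hip F (kerH wD) = F w.
Proof.
apply: (@ccvg_unique _ _ \oo _ _ _ _ (@hip_cvg _ _ F (kerH wD))).
have aF := hardy_analytic (hval_hardy F).
have wcD := sub_cpolydisc wD.
rewrite (_ : (fun m => _) = (fun m => F ((rad m)%:C *: ((rad m)%:C *: w)))).
  have H1 := adiff_cvg (analytic_adiff aF wD).
  apply: (cvg_comp _ _ _ H1); apply: cvg_row => j.
  rewrite -[X in _ --> X](mul1r (w 0 j)) -[X in _ --> X](mul1r (1 * w 0 j)).
  under eq_fun do rewrite !mxE.
  have c1 : (fun m => (@rad R m)%:C) @ \oo --> (1 : R)%:C.
    by apply: ccvg_real; exact: cvg_rad.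
  exact: (ccvgM c1 (ccvgM c1 (ccvg_cst (a := w 0 j)))).
apply/funext => m; have r01 := @rad01 R m.
have rwD : polydisc ((rad m)%:C *: w) by exact: polydiscZ.
rewrite -(tip_cker r01 aF rwD); apply: eq_tip => // z zD.
rewrite /dil mkHE; last exact: polydiscZ.
apply: eq_bigr => j _; rewrite !mxE conjcM conjc_real.
by congr (1 - _)^-1; rewrite mulrCA mulrA.
Qed.

(** Cauchy-Schwarz against the reproducing kernel, derived directly from positivity because both
    definiteness and completeness of the Hardy space are drawn from this bound. *)
Lemma eval_bound F w (rho : R) : 0 <= rho < 1 -> (forall j, normc (w 0 j) <= rho) ->
  normc (F w) ^+ 2 <= ((1 - rho)^-1) ^+ n * n2 hip F.
Proof.
move=> r01 wr.
have wD : polydisc w by move=> j; apply: le_lt_trans (wr j) _; case/andP: r01.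
rewrite -(reproducing F wD).
have CS : normc (hip F (kerH wD)) ^+ 2 <= n2 hip F * n2 hip (kerH wD).
  apply: cauchy_schwarz_coef; first exact: n2_hardyT_ge0.
  move=> l; have := n2_hardyT_ge0 (F + l^* *: kerH wD).
  rewrite /n2 hipDl !hipDr !hipZl !hipZr conjcK [hip (kerH wD) F]hipJ !cReD.
  have -> : l^* * (hip F (kerH wD))^* = (l * hip F (kerH wD))^* by rewrite conjcM.
  have -> : l^* * (l * hip (kerH wD) (kerH wD)) =
      (normc l ^+ 2 * n2 hip (kerH wD))%:C.
    by rewrite hip_h2 n2_h2 mulrA (mulrC (l^*) l) mulcJ -rmorphM.
  rewrite cReJ /=.
  by move: (complex.Re _) (complex.Re _) (_ * complex.Re _) => a b c; lra.
apply: le_trans CS _; rewrite mulrC; apply: ler_wpM2r; first exact: n2_hardyT_ge0.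
have -> : n2 hip (kerH wD) = complex.Re (cker w w).
  by rewrite /n2 reproducing mkHE.
apply: le_trans (ler_norm _) _; apply: le_trans (Re_le_normc _) _.
by apply: cker_le => //; exact: sub_cpolydisc.
Qed.

Lemma n2_hardyT_eq0 F : n2 hip F = 0 -> F = 0.
Proof.
move=> F0; apply: hardyT_ext => w wD; have [rho r01 wr] := polydisc_rho wD.
have := eval_bound F r01 wr; rewrite F0 mulr0 => H1.
by apply/eqP; rewrite -normc_eq0 -sqrf_eq0 eq_le H1 sqr_ge0.
Qed.

End reproducing_kernel.

(** * Taylor estimates with uniform constants *)

Section taylor.
Context {R : realType} {n : nat}.
Implicit Types (f : 'rV[R[i]]_n -> R[i]) (w h : 'rV[R[i]]_n).

Lemma lincombZ (c : 'I_n -> R[i]) (a : R[i]) (u : 'rV[R[i]]_n) :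
  lincomb c (a *: u) = a * lincomb c u.
Proof. exact: linearZ. Qed.

(** [adiff] with the derivative named, so that the derivatives along a sequence of functions can be
    compared. *)
Definition adiff_at f w (c : 'I_n -> R[i]) := forall e : R, 0 < e ->
  exists2 d : R, 0 < d & forall h (x : R), 0 <= x -> x < d ->
    (forall j, normc (h 0 j) <= x) ->
    normc (f (w + h) - f w - lincomb c h) <= e * x.

(* Expanding the Cauchy kernel to second order. *)
Lemma cdiff_taylor (g : R[i] -> R[i]) (M : R) (b : R[i]) :
  (forall z, normc z <= 1 -> cdiff g z) -> (forall z, normc z <= 1 -> normc (g z) <= M) ->
  (forall e : R, 0 < e -> \forall x \near 0, normc (g x - g 0 - b * x) <= e * normc x) ->
  normc b <= M /\
  forall x, normc x <= 1/2 -> normc (g x - g 0 - b * x) <= 2 * M * normc x ^+ 2.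
Proof.
move=> gD gM gb.
have M0 : 0 <= M by apply: le_trans (gM 0 _); rewrite ?normc_ge0// normc0.
have bm (k : R -> R[i]) : (forall t, k x @[x --> t] --> k t) ->
    bmeas `[(0 : R), 1] (fun t => g (cis t) * k t).
  move=> ck; apply: cwithin_bmeas; apply: cwithin_continuous => t.
  apply: ccvgM (ck t).
  apply: cvg_comp (@continuous_cis _ t) _; apply: cdiff_continuous.
  by apply: gD; rewrite normc_cis.
have kJ (t : R) : (cis x)^* @[x --> t] --> (cis t)^*.
  by apply: ccvgJ; exact: continuous_cis.
pose A := iint 0 1 (fun t => g (cis t) * 1).
pose B := iint 0 1 (fun t => g (cis t) * (cis t)^*).
have b1 := bm _ (fun t => ccvg_cst (a := 1)).
have bJ := bm _ kJ.
have it (k : R -> R[i]) (K : R) : bmeas `[(0 : R), 1] (fun t => g (cis t) * k t) ->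
    (forall t, normc (k t) <= K) -> normc (iint 0 1 (fun t => g (cis t) * k t)) <= M * K.
  move=> bk kK; rewrite -[leRHS]mulr1 -[X in _ * X]subr0; apply: normc_iint => // t _.
  rewrite normcM; apply: ler_pM; rewrite ?normc_ge0//.
  by apply: gM; rewrite normc_cis.
have main x : normc x <= 1/2 -> normc (g x - A - B * x) <= 2 * M * normc x ^+ 2.
  move=> x2; have x1 : normc x < 1 by apply: le_lt_trans x2 _; lra.
  have xn t : 1 - x * (cis t)^* != 0.
    by apply: sub1_neq0; rewrite normcM normcJ normc_cis mulr1.
  have kV (t : R) : (1 - x * (cis y)^*)^-1 @[y --> t] --> (1 - x * (cis t)^*)^-1.
    apply: ccvgV => //; apply: ccvgB; first exact: ccvg_cst.
    exact: (ccvgM (ccvg_cst (a := x)) (kJ t)).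
  have kE (t : R) : (cis y)^* ^+ 2 * (1 - x * (cis y)^*)^-1 @[y --> t] -->
      (cis t)^* ^+ 2 * (1 - x * (cis t)^*)^-1.
    exact: (ccvgM (ccvgM (kJ t) (kJ t)) (kV t)).
  have bE := bm _ kE.
  have -> : g x - A - B * x =
      x ^+ 2 * iint 0 1 (fun t => g (cis t) * ((cis t)^* ^+ 2 * (1 - x * (cis t)^*)^-1)).
    rewrite -(cauchy_disc x1 gD) /A /B /iint.
    rewrite -(cintZr _ (lebesgue_itv_lty 0 1))// -(cintZ _ (lebesgue_itv_lty 0 1))//.
    have bV := bm _ kV.
    rewrite -(cintB _ (lebesgue_itv_lty 0 1))//.
    have bJx : bmeas `[(0 : R), 1] (fun t => g (cis t) * (cis t)^* * x).
      by apply: bmeasM => //; exact: bmeas_cst.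
    have bVB : bmeas `[(0 : R), 1]
        (fun t => g (cis t) * (1 - x * (cis t)^*)^-1 - g (cis t) * 1).
      by apply: bmeasB; [exact: bV|exact: b1].
    rewrite -(cintB _ (lebesgue_itv_lty 0 1))//.
      by apply: eq_iint => t _; field; exact: xn.
    exact: b1.
  rewrite normcM normcX mulrC ler_wpM2r ?exprn_ge0 ?normc_ge0// mulrC.
  apply: it => // t; rewrite normcM normcX normcJ normc_cis expr1n mul1r normcV.
  rewrite -[leRHS]invrK lef_pV2 ?posrE ?invr_gt0// ?normc_gt0//.
  apply: le_trans (normc_sub1_ge _); rewrite normcM normcJ normc_cis mulr1.
  by lra.
have gA : g 0 = A.
  apply/eqP; rewrite -subr_eq0 -normc_eq0 eq_le normc_ge0 andbT.
  have h0 : (0 : R) <= 1 / 2 by rewrite divr_ge0.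
  by have := main 0; rewrite normc0 => /(_ h0); rewrite expr0n !mulr0 subr0.
have bB : b = B.
  apply/eqP; rewrite -subr_eq0 -normc_eq0 eq_le normc_ge0 andbT.
  apply/ler_addgt0Pl => e e0; rewrite addr0.
  have e2 : 0 < e / 2 by rewrite divr_gt0.
  have /near_normcP[d d0 dP] := gb _ e2.
  pose K := 2 * M + 1; have K0 : 0 < K by rewrite ltr_pwDr// mulr_ge0.
  (* At the point s both linear approximations apply, and the quadratic error 2 M s^2 is at most s
     e/2; dividing by s leaves |b - B| <= e. *)
  pose s := Num.min (1/2) (Num.min (d / 2) (e / (2 * K))).
  have s0 : 0 < s by rewrite !lt_min !divr_gt0// mulr_gt0.
  have s2 : s <= 1/2 by rewrite /s ge_min lexx.
  have sd : s < d.
    by rewrite (@le_lt_trans _ _ (d / 2))//; [rewrite /s !ge_min lexx orbT|lra].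
  have sK : s * K <= e / 2.
    rewrite -ler_pdivlMr//; have -> : e / 2 / K = e / (2 * K).
      by field; rewrite gt_eqF.
    by rewrite /s !ge_min lexx !orbT.
  have ns : normc s%:C = s by rewrite normc_real gtr0_norm.
  have h1 := dP s%:C; rewrite subr0 ns in h1; have {}h1 := h1 sd.
  have h2' := main s%:C; rewrite ns -gA in h2'; have {}h2' := h2' s2.
  have : normc ((b - B) * s%:C) <= e / 2 * s + 2 * M * s ^+ 2.
    have -> : (b - B) * s%:C = (g s%:C - g 0 - B * s%:C) - (g s%:C - g 0 - b * s%:C).
      by ring.
    by apply: le_trans (normcB _ _) _; rewrite addrC lerD.
  rewrite normcM ns expr2 mulrA -mulrDl ler_pM2r// => /le_trans; apply.
  rewrite [leRHS](splitr e) lerD2l; apply: le_trans sK; rewrite /K.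
  by rewrite mulrC ler_pM2l// lerDl.
split; last by rewrite bB gA.
rewrite bB -[leRHS]mulr1; apply: it => // t.
by rewrite normcJ normc_cis.
Qed.

(** Apply [cdiff_taylor] on the complex line through [w] in direction [h], scaled so that the unit
    disc corresponds to radius [d]. The constants depend on [M] and [d] only, hence are uniform
    along a bounded sequence. *)
Lemma analytic_taylor f w (d M : R) c : 0 < d -> analytic f ->
  (forall z : 'rV[R[i]]_n, (forall j, normc (z 0 j - w 0 j) <= d) ->
    polydisc z /\ normc (f z) <= M) ->
  adiff_at f w c -> forall h (x : R), 0 <= x -> (forall j, normc (h 0 j) <= x) ->
  normc (lincomb c h) <= M * (x / d) /\
  (x <= d / 2 -> normc (f (w + h) - f w - lincomb c h) <= 2 * M * (x / d) ^+ 2).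
Proof.
move=> d0 af fM fc h x x0 hx.
have [x_eq0|x_neq0] := eqVneq x 0.
  have h0 : h = 0.
    apply/rowP => j; rewrite mxE; apply/eqP; rewrite -normc_eq0 eq_le normc_ge0 andbT.
    by rewrite -x_eq0 hx.
  by rewrite h0 linear0 x_eq0 mul0r expr0n !mulr0 addr0 subr0 subrr normc0.
have x_gt0 : 0 < x by rewrite lt_def x_neq0.
pose v := (d / x)%:C *: h.
have hv : h = (x / d)%:C *: v.
  rewrite scalerA -rmorphM /=; have -> : x / d * (d / x) = 1.
    by field; rewrite x_neq0 gt_eqF.
  by rewrite scale1r.
have vd j : normc (v 0 j) <= d.
  have dx0 : 0 <= d / x by rewrite divr_ge0// ltW.
  by rewrite mxE normcM normc_real ger0_norm// mulrAC ler_pdivrMr// ler_pM2l.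
clearbody v; pose g y := f (w + y *: v).
have wv y : normc y <= 1 -> polydisc (w + y *: v) /\ normc (g y) <= M.
  move=> y1; apply: fM => j; rewrite !mxE addrAC subrr add0r normcM -[leRHS]mul1r.
  exact: (ler_pM (normc_ge0 _) (normc_ge0 _) y1 (vd j)).
have gD y : normc y <= 1 -> cdiff g y.
  move=> y1; have [wD _] := wv _ y1.
  rewrite -[y]addr0; apply: cdiff_shift.
  have := adiff_ldiff (analytic_adiff af wD) v.
  rewrite (_ : (fun x => f (w + y *: v + x *: v)) = (fun x => g (y + x)))//.
  by apply/funext => s; rewrite /g scalerDl addrA.
have gb (e : R) : 0 < e ->
    \forall y \near 0, normc (g y - g 0 - lincomb c v * y) <= e * normc y.
  move=> e0; have [k k0 kP] := fc _ (divr_gt0 e0 d0).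
  apply/near_normcP; exists (k / d) => [|y]; first by rewrite divr_gt0.
  rewrite subr0 ltr_pdivlMr// => yk.
  have yv j : normc ((y *: v) 0 j) <= normc y * d.
    by rewrite mxE normcM ler_wpM2l// normc_ge0.
  have yd0 : 0 <= normc y * d by rewrite mulr_ge0 ?normc_ge0// ltW.
  have := kP (y *: v) _ yd0 yk yv.
  rewrite /g scale0r addr0 lincombZ.
  have -> : e / d * (normc y * d) = e * normc y by field; rewrite gt_eqF.
  by rewrite (mulrC y).
have [bM taylor] := cdiff_taylor gD (fun y y1 => (wv y y1).2) gb.
have nx : normc (x / d)%:C = x / d by rewrite normc_real ger0_norm// divr_ge0// ltW.
split.
  have xd0 : 0 <= x / d by rewrite divr_ge0// ltW.
  by rewrite hv lincombZ normcM nx [leRHS]mulrC ler_wpM2l.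
move=> xd; have := taylor (x / d)%:C; rewrite nx /g scale0r addr0 -hv => H1.
have -> : lincomb c h = lincomb c v * (x / d)%:C by rewrite {1}hv lincombZ mulrC.
by apply: H1; rewrite ler_pdivrMr//; lra.
Qed.

End taylor.

Section complex_sequences.
Context {R : realType}.
Implicit Types (v : nat -> R[i]) (l : R[i]).

Lemma le_sqrD1 (a b : R) : a ^+ 2 <= b -> a <= b + 1.
Proof. by move=> h; have := sqr_ge0 (a - 1); nra. Qed.

Lemma ccauchy_cvg v : (forall e : R, 0 < e -> exists N, forall m k,
  (N <= m)%N -> (N <= k)%N -> normc (v m - v k) < e) -> exists l : R[i], v @ \oo --> l.
Proof.
move=> H.
have real (p : R[i] -> R) : (forall x y, `|p x - p y| <= normc (x - y)) ->
    exists l : R, (fun m => p (v m)) @ \oo --> l.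
  move=> pl; suff : cvg ((fun m => p (v m)) @ \oo).
    by move=> c; exists (lim ((fun m => p (v m)) @ \oo)).
  apply/cauchy_cvgP; apply: cauchy_exP => e e0.
  have [N NP] := H e e0; exists (p (v N)); exists N => // m /= Nm.
  by rewrite -ball_normE /=; apply: le_lt_trans (pl _ _) _; exact: NP.
have [a av] := real (@complex.Re R) (fun x y => ltac:(rewrite -cReN -cReD; exact: Re_le_normc)).
have [b bv] := real (@complex.Im R) (fun x y => ltac:(rewrite -cImN -cImD; exact: Im_le_normc)).
exists (a +i* b).
rewrite (_ : v = (fun m => complex.Re (v m) +i* complex.Im (v m))).
  exact: ccvg_Complex.
by apply/funext => m; case: (v m).
Qed.

Lemma ccvg_le v l (B : R) N : v @ \oo --> l -> (forall m, (N <= m)%N -> normc (v m) <= B) ->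
  normc l <= B.
Proof.
move=> /ccvgP vl vB; apply/ler_addgt0Pl => e e0.
have [M _ MP] := vl e e0.
have := MP (maxn N M) (leq_maxr _ _) => /= h1.
have h2' := vB (maxn N M) (leq_maxl _ _).
rewrite -[l](subrK (v (maxn N M))) (le_trans (normcD _ _))// lerD//.
by rewrite normcBC ltW.
Qed.

End complex_sequences.

(** * Completeness of the Hardy space *)

Section completeness.
Context {R : realType} {n : nat}.
Notation H := (hardyT R n).
Implicit Types (w h : 'rV[R[i]]_n).

Lemma adiff_atB (f g : 'rV[R[i]]_n -> R[i]) w c c' :
  adiff_at f w c -> adiff_at g w c' ->
  adiff_at (fun z => f z - g z) w (fun j => c j - c' j).
Proof.
move=> fc gc e e0; have e2 : 0 < e / 2 by rewrite divr_gt0.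
have [d d0 dP] := fc _ e2; have [k k0 kP] := gc _ e2.
exists (Num.min d k) => [|h x x0]; first by rewrite lt_min d0.
rewrite lt_min => /andP[xd xk] hx.
have -> : lincomb (fun j => c j - c' j) h = lincomb c h - lincomb c' h.
  by rewrite /lincomb -sumrB; apply: eq_bigr => j _; rewrite mulrBl.
have h1 := dP h x x0 xd hx; have h2' := kP h x x0 xk hx.
have -> : f (w + h) - g (w + h) - (f w - g w) - (lincomb c h - lincomb c' h) =
    (f (w + h) - f w - lincomb c h) - (g (w + h) - g w - lincomb c' h) by ring.
apply: le_trans (normcB _ _) _.
by rewrite (splitr e) mulrDl lerD.
Qed.

Variable u : nat -> H.
Hypothesis uC : forall e : R, 0 < e -> exists N, forall m k, (N <= m)%N -> (N <= k)%N ->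
  n2 hip (u m - u k) < e.

Let unif (rho : R) : 0 <= rho < 1 -> forall e : R, 0 < e -> exists N, forall m k,
  (N <= m)%N -> (N <= k)%N -> forall w, (forall j, normc (w 0 j) <= rho) ->
  normc (u m w - u k w) < e.
Proof.
move=> r01 e e0; pose K : R := ((1 - rho)^-1) ^+ n.
have K0 : 0 < K by rewrite exprn_gt0// invr_gt0 subr_gt0; case/andP: r01.
have [N NP] := uC (divr_gt0 (exprn_gt0 2 e0) K0).
exists N => m k Nm Nk w wr.
have := eval_bound (u m - u k) r01 wr; rewrite -/K => h1.
rewrite -(@ltr_pXn2r _ 2) ?nnegrE ?normc_ge0 ?(ltW e0)//.
apply: le_lt_trans h1 _; rewrite mulrC -ltr_pdivlMr//; exact: NP.
Qed.

Let limit_ex w : exists l : R[i], polydisc w -> (fun m => u m w) @ \oo --> l.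
Proof.
have [wD|wD] := pselect (polydisc w); last by exists 0.
have [rho r01 wr] := polydisc_rho wD.
have [|l ul] := @ccauchy_cvg _ (fun m => u m w); last by exists l.
move=> e e0; have [N NP] := unif r01 e0.
by exists N => m k Nm Nk; exact: NP.
Qed.

(** By [eval_bound] a Cauchy sequence converges uniformly on smaller polydiscs. The Taylor estimates
    make its derivatives at a point Cauchy and bound all remainders by one quadratic, so the limit
    is differentiable. *)
Lemma hardy_complete : exists l : H, hcvg hip u l.
Proof.
have [f fP] := choice limit_ex.
have uf (rho : R) : 0 <= rho < 1 -> forall e : R, 0 < e -> exists N, forall m,
    (N <= m)%N -> forall w, (forall j, normc (w 0 j) <= rho) ->
    normc (u m w - f w) <= e.
  move=> r01 e e0; have [N NP] := unif r01 e0; exists N => m Nm w wr.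
  have wD : polydisc w by move=> j; apply: le_lt_trans (wr j) _; case/andP: r01.
  apply: (@ccvg_le _ (fun k => u m w - u k w) _ _ N).
    exact: (ccvgB (ccvg_cst (a := u m w)) (fP w wD)).
  by move=> k Nk; exact/ltW/NP.
have af : analytic f.
  move=> w wD; apply: adiff_differentiable.
  have [rho0 /andP[r00 r01] wr] := polydisc_rho wD.
  (* As [rho0 + d = rho < 1], points within [d] of [w] stay in the polydisc of radius [rho], where
     the convergence is uniform. *)
  pose rho := (1 + rho0) / 2; pose d := (1 - rho0) / 2.
  have d0 : 0 < d by rewrite divr_gt0// subr_gt0.
  have rho01 : 0 <= rho < 1 by rewrite /rho; apply/andP; split; lra.
  have ballr z : (forall j, normc ((z : 'rV[R[i]]_n) 0 j - w 0 j) <= d) ->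
      forall j, normc (z 0 j) <= rho.
    move=> zw j; rewrite -[z 0 j](subrK (w 0 j)) (le_trans (normcD _ _))//.
    have -> : rho = d + rho0 by rewrite /rho /d; lra.
    by rewrite lerD.
  have ballD z : (forall j, normc ((z : 'rV[R[i]]_n) 0 j - w 0 j) <= d) -> polydisc z.
    by move=> zw j; apply: le_lt_trans (ballr _ zw j) _; case/andP: rho01.
  have aum m : exists c, adiff_at (u m) w c.
    exact: analytic_adiff (hardy_analytic (hval_hardy (u m))) wD.
  have [c cP] := choice aum.
  have au m := hardy_analytic (hval_hardy (u m)).
  have cC j : exists l : R[i], (fun m => c m j) @ \oo --> l.
    apply: ccauchy_cvg => e e0.
    have ed : 0 < e * d / 2 by rewrite divr_gt0// mulr_gt0.
    have [N NP] := unif rho01 ed; exists N => m k Nm Nk.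
    have aB := hardy_analytic (hval_hardy (u m - u k)).
    have [] := @analytic_taylor _ _ (u m - u k) w d (e * d / 2) _ d0 aB _
      (adiff_atB (cP m) (cP k)) (delta_mx 0 j) 1 ler01.
    - move=> z zw; split; first exact: ballD.
      by apply/ltW/NP => //; exact: ballr.
    - move=> i; rewrite mxE eqxx /=; case: (_ == _); rewrite ?normc1// normc0//.
    rewrite /lincomb (bigD1 j)//= mxE !eqxx mulr1 big1; last first.
      by move=> i ij; rewrite mxE eqxx (negbTE ij) mulr0.
    rewrite addr0 => h1 _; apply: le_lt_trans h1 _.
    have -> : e * d / 2 * (1 / d) = e / 2 by field; rewrite gt_eqF.
    by lra.
  have [cl clP] := choice cC.
  exists cl.
  have [N0 N0P] := unif rho01 ltr01.
  pose K : R := ((1 - rho)^-1) ^+ n.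
  (* One 1 comes from [le_sqrD1], which passes from |u N0|^2 to |u N0|; the other is the distance to
     [u N0]. *)
  pose M := K * n2 hip (u N0) + 1 + 1.
  have uM m z : (N0 <= m)%N -> (forall j, normc ((z : 'rV[R[i]]_n) 0 j) <= rho) ->
      normc (u m z) <= M.
    move=> Nm zr; rewrite -[u m z](subrK (u N0 z)) (le_trans (normcD _ _))// addrC.
    apply: lerD; last by apply/ltW/N0P.
    have := eval_bound (u N0) rho01 zr; rewrite -/K => h1.
    exact: le_sqrD1.
  have M0 : 0 <= M.
    have := uM N0 0 (leqnn _); move=> /(_ _) h1; apply: le_trans (h1 _); rewrite ?normc_ge0//.
    by move=> j; rewrite mxE normc0; case/andP: rho01.
  (* The bound d/2 is the range of the Taylor estimate; the other one turns 2 M (x/d)^2 into at most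
     e x, the added 1 keeping the denominator positive. *)
  move=> e e0; pose del := Num.min (d / 2) (e * d ^+ 2 / (2 * M + 1)).
  have M1 : 0 < 2 * M + 1 by rewrite ltr_pwDr// mulr_ge0.
  exists del => [|h x x0].
    rewrite lt_min; apply/andP; split; first by rewrite divr_gt0.
    by rewrite divr_gt0//; apply: mulr_gt0 => //; exact: exprn_gt0.
  rewrite lt_min => /andP[xd xe] hx.
  have whD : polydisc (w + h).
    apply: ballD => j; have -> : (w + h) 0 j - w 0 j = h 0 j by rewrite mxE; ring.
    by apply: le_trans (hx j) _; apply: le_trans (ltW xd) _; lra.
  have lim1 : (fun m => u m (w + h) - u m w - lincomb (c m) h) @ \oo -->
      f (w + h) - f w - lincomb cl h.
    apply: (ccvgB (ccvgB (fP _ whD) (fP _ wD))).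
    apply: ccvg_sum => j; exact: (ccvgM (clP j) (ccvg_cst (a := h 0 j))).
  have : normc (f (w + h) - f w - lincomb cl h) <= 2 * M * (x / d) ^+ 2.
    apply: (ccvg_le lim1 (N := N0)) => m Nm.
    have [] := @analytic_taylor _ _ (u m) w d M _ d0 (au m) _ (cP m) h x x0 hx.
      by move=> z zw; split; [exact: ballD|apply: uM => //; exact: ballr].
    by move=> _; apply; exact: ltW.
  move=> /le_trans; apply.
  rewrite ltr_pdivlMr// in xe.
  rewrite expr_div_n mulrA ler_pdivrMr ?exprn_gt0//.
  rewrite expr2 mulrA -[leRHS]mulrA [x * _]mulrC mulrA; apply: ler_wpM2r => //.
  apply: le_trans (ltW xe); rewrite mulrC; apply: ler_wpM2l => //.
  by rewrite lerDl.
(* At a fixed radius r insert [u m] with [m] depending on r: [u k - u m] is small in norm, [u m - f]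
   uniformly on the polydisc of radius r. The resulting bound does not depend on r. *)
have key (e : R) : 0 < e -> exists N, forall k, (N <= k)%N ->
    forall r, 0 <= r < 1 -> tn2 (dil r (fun z => u k z - f z)) <= e / 2.
  move=> e0; have e8 : 0 < e / 8 by rewrite divr_gt0.
  have [N NP] := uC e8; exists N => k Nk r r01.
  apply/ler_addgt0Pl => eta eta0.
  pose s := Num.min 1 (eta / 2).
  have s0 : 0 < s by rewrite lt_min ltr01 divr_gt0.
  have [N2 N2P] := uf r r01 s s0.
  pose m := maxn N N2.
  have ak := hardy_analytic (hval_hardy (u k - u m)).
  have am : analytic (fun z => u m z - f z).
    have af' : analytic (fun z => -1 * f z).
      by apply: analyticM => //; exact: analytic_cst.
    apply: eq_analytic (analyticD (hardy_analytic (hval_hardy (u m))) af').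
    by move=> z _; rewrite mulN1r.
  have E : tn2 (dil r (fun z => u k z - f z)) =
      tn2 (fun z => dil r (u k - u m) z + dil r (fun z => u m z - f z) z).
    apply: (f_equal (@complex.Re R)).
    have E1 z : dil r (fun z => u k z - f z) z =
        dil r (u k - u m) z + dil r (fun z => u m z - f z) z.
      by rewrite /dil hBE; ring.
    by apply: eq_tip => z _; exact: E1.
  rewrite E.
  have := tn2D_le (ccontinuous_analytic r01 ak) (ccontinuous_analytic r01 am).
  move=> /le_trans; apply.
  have h1 : tn2 (dil r (u k - u m)) <= e / 8.
    apply: le_trans (h2_ub (hval_hardy (u k - u m)) r01) _.
    by rewrite -n2_h2; apply/ltW/NP => //; exact: leq_maxl.
  have h2' : tn2 (dil r (fun z => u m z - f z)) <= s ^+ 2.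
    apply: tn2_le; first exact: ccontinuous_analytic.
    move=> z zD; rewrite /dil; apply: N2P; first exact: leq_maxr.
    move=> j; rewrite mxE normcM normc_real ger0_norm; last by case/andP: r01.
    by rewrite ler_piMr//; case/andP: r01.
  have s1 : s <= 1 by rewrite /s ge_min lexx.
  have se : s <= eta / 2 by rewrite /s ge_min lexx orbT.
  have h3 : s ^+ 2 <= s by rewrite expr2 ler_piMr// ltW.
  move: (tn2 _) (tn2 _) (s ^+ 2) h1 h2' h3 => a b c; lra.
have hf : hardy f.
  have [N NP] := key 1 ltr01.
  have am : analytic (fun z => u N z - f z).
    have af' : analytic (fun z => -1 * f z).
      by apply: analyticM => //; exact: analytic_cst.
    apply: eq_analytic (analyticD (hardy_analytic (hval_hardy (u N))) af').
    by move=> z _; rewrite mulN1r.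
  have hg : hardy (fun z => u N z - f z).
    by apply/hardyP; split => //; exists (1 / 2) => r r01; exact: NP.
  apply: eq_hardy (hardyD (hval_hardy (u N)) (hardyZ (-1) hg)) => z _.
  by rewrite mulN1r opprB addrC subrK.
exists (mkH hf) => e e0; have [N NP] := key e e0; exists N => m Nm.
rewrite n2_h2; apply: (@le_lt_trans _ _ (e / 2)); last by lra.
apply: h2_le; first exact: hval_hardy.
move=> r r01; rewrite (@eq_tn2_dil _ _ _ (fun z => u m z - f z) r r01).
  exact: NP.
by move=> z zD; rewrite hBE mkHE.
Qed.

End completeness.

Section hardy_hilbert.
Context {R : realType} {n : nat}.

Lemma hardy_hilbert : is_hilbert (@hip R n).
Proof.
split.
- exact: hipDl.
- exact: hipZl.
- exact: hipJ.
- exact: n2_hardyT_ge0.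
- exact: n2_hardyT_eq0.
- exact: hardy_complete.
Qed.

End hardy_hilbert.

Lemma rcvg_unique (R : realType) (u : nat -> R) (a b : R) :
  u @ \oo --> a -> u @ \oo --> b -> a = b.
Proof. by move=> ua ub; rewrite -(cvg_lim _ ua)// -(cvg_lim _ ub). Qed.

(** * Multiplication by inner functions *)

Section dilation.
Context {R : realType} {n : nat}.
Notation H := (hardyT R n).
Implicit Types (F : H) (f g : 'rV[R[i]]_n -> R[i]).

Lemma scalerC (a b : R[i]) (z : 'rV[R[i]]_n) : a *: (b *: z) = b *: (a *: z).
Proof. by rewrite !scalerA mulrC. Qed.

Lemma dilC (r s : R) f : dil r (dil s f) = (fun z => dil r f (s%:C *: z)).
Proof. by apply/funext => z; rewrite /dil !scalerA mulrC. Qed.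

Lemma dil_dil (r s : R) f : dil r (dil s f) = dil (r * s) f.
Proof. by apply/funext => z; rewrite /dil scalerA -rmorphM mulrC. Qed.

Lemma analytic_dil (s : R) f : 0 <= s < 1 -> analytic f -> analytic (dil s f).
Proof.
move=> s01 af z zD; apply: differentiable_comp.
  exact: differentiableZ.
by apply/af/polydiscZ => //; exact: sub_cpolydisc.
Qed.

Lemma hardy_dil (s : R) f : 0 <= s < 1 -> hardy f -> hardy (dil s f).
Proof.
move=> s01 hf; apply/hardyP; split; first exact: analytic_dil (hardy_analytic hf).
exists (h2 f) => r r01; rewrite dil_dil; apply: h2_ub => //.
case/andP: s01 => s0 s1; case/andP: r01 => r0 r1.
by rewrite mulr_ge0//= mulr_ilt1.
Qed.

Definition dilH (s : R) (s01 : 0 <= s < 1) F : H := mkH (hardy_dil s01 (hval_hardy F)).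

Lemma dilHE (s : R) (s01 : 0 <= s < 1) F z : polydisc z ->
  dilH s01 F z = F (s%:C *: z).
Proof. by move=> zD; rewrite mkHE. Qed.

Lemma tn2_dilH (s r : R) (s01 : 0 <= s < 1) F : 0 <= r < 1 ->
  tn2 (dil r (dilH s01 F)) = tn2 (dil (r * s) F).
Proof.
by move=> r01; rewrite -dil_dil; apply: eq_tn2_dil => // z zD; rewrite dilHE.
Qed.

Lemma sqr01 (s : R) : 0 <= s < 1 -> 0 <= s ^+ 2 < 1.
Proof. by move=> /andP[s0 s1]; rewrite exprn_ge0//= expr_lt1. Qed.

Lemma hip_dilH (s : R) (s01 : 0 <= s < 1) F :
  complex.Re (hip (dilH (sqr01 s01) F) F) = n2 hip (dilH s01 F).
Proof.
have h1 : (fun m => complex.Re (tip (dil (rad m) (dilH (sqr01 s01) F)) (dil (rad m) F)))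
    @ \oo --> complex.Re (hip (dilH (sqr01 s01) F) F).
  by apply: (@ccvg_Re _ _ \oo); exact: hip_cvg.
have h2' := h2_cvg (hval_hardy (dilH s01 F)).
rewrite n2_h2; move: h1; rewrite (_ : (fun m => complex.Re _) =
    (fun m => tn2 (dil (rad m) (dilH s01 F)))).
  by move=> h1; exact: (rcvg_unique h1 h2').
apply/funext => m; have m01 := @rad01 R m.
have cF := cholo_analytic m01 (hardy_analytic (hval_hardy F)).
have -> : tn2 (dil (rad m) (dilH s01 F)) = tn2 (fun z => dil (rad m) F (s%:C *: z)).
  apply: etrans (tn2_dilH s01 F m01) _.
  exact: (f_equal tn2 (etrans (esym (dil_dil (rad m) s F)) (dilC (rad m) s F))).
apply: etrans (esym (tip_dil_dil s01 cF)).
apply: (f_equal (@complex.Re R)); apply: eq_tip => z zD; last reflexivity.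
have rD := polydiscZ m01 zD; rewrite /dil (dilHE (sqr01 s01) F rD).
exact: (f_equal (hval F) (scalerC _ _ z)).
Qed.

(** With G = F(s^2 z), self-adjointness turns the cross term into the squared norm of F(s z), which
    explains the radius s^2: |G - F|^2 = |G|^2 - 2 |F(s z)|^2 + |F|^2 <= |F|^2 - |F(s z)|^2, and
    this tends to 0. *)
Lemma hcvg_dilH F : hcvg hip (fun m => dilH (sqr01 (rad01 m)) F) F.
Proof.
move=> e e0; have /cvgrPdist_lt /(_ e e0) [N _ NP] := h2_cvg (hval_hardy F).
(* The strict inequality [rad N < rad m] is needed to write [rad N] as [rad m] times a radius below
   1. *)
exists N.+1 => m Nm; have m01 := @rad01 R m.
set G := dilH (sqr01 (rad01 m)) F.
have hG := hip_dilH m01 F.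
have -> : n2 hip (G - F) = n2 hip G - 2 * n2 hip (dilH m01 F) + n2 hip F.
  by rewrite (n2D hardy_hilbert) (n2N hardy_hilbert) (ipNr hardy_hilbert) cReN hG mulrN.
have h1 : n2 hip G <= n2 hip (dilH m01 F).
  rewrite !n2_h2; apply: h2_le; first exact: hval_hardy.
  move=> r r01; rewrite tn2_dilH//; have [r0 r1] := andP r01; have [m0 m1] := andP m01.
  have rm : 0 <= r * rad m < 1 by rewrite mulr_ge0//= mulr_ilt1.
  by rewrite expr2 mulrA -(tn2_dilH m01 F rm); apply: h2_ub; first exact: hval_hardy.
have h3 : tn2 (dil (rad N) F) <= n2 hip (dilH m01 F).
  have [N0 _] := andP (@rad01 R N).
  have Nm' : @rad R N < rad m.
    by rewrite /rad ltrD2l ltrN2 ltf_pV2 ?posrE ?ltr0n// ltr_nat.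
  have m0 : 0 < @rad R m by exact: le_lt_trans N0 Nm'.
  have r01 : 0 <= @rad R N / rad m < 1.
    by rewrite divr_ge0 ?(ltW m0)//= ltr_pdivrMr// mul1r.
  rewrite n2_h2 -[rad N](divfK (lt0r_neq0 m0)) -(tn2_dilH m01 F r01).
  by apply: h2_ub; first exact: hval_hardy.
have := NP N (leqnn _); rewrite /= => h4.
have h5 := ler_norm (h2 F - tn2 (dil (rad N) F)).
rewrite (n2_h2 F); move: h1 h3 h4 h5.
move: (n2 _ _) (n2 _ _) (h2 F) (tn2 _) => a b c d.
move: `| _ | => k; lra.
Qed.

End dilation.

Section multiplication.
Context {R : realType} {n : nat}.
Notation H := (hardyT R n).
Notation fT := ('rV[R[i]]_n -> R[i]).
Implicit Types (F : H) (p q : fT).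

Definition multiplier p := analytic p /\ bounded_on_polydisc p.

(** Multiplication as a total operator on [hardyT]: 0 is a default value that is not taken when [p]
    is a [multiplier] ([mulHE]). *)
Definition mulH p F : H :=
  match pselect (hardy (fun z => p z * F z)) with
  | left h => mkH h
  | right _ => 0
  end.

Lemma mulHE p F z : multiplier p -> polydisc z -> mulH p F z = p z * F z.
Proof.
move=> [ap bp] zD; rewrite /mulH; case: pselect => [h|]; first by rewrite mkHE.
by case; exact: hardy_mul_bounded (hval_hardy F).
Qed.

Lemma mulH_lin p c F G : multiplier p -> mulH p (c *: F + G) = c *: mulH p F + mulH p G.
Proof.
move=> mp; apply: hardyT_ext => z zD.
by rewrite hDE hZE !mulHE// hDE hZE; ring.
Qed.

Lemma mulHC p q F : multiplier p -> multiplier q -> mulH p (mulH q F) = mulH q (mulH p F).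
Proof. by move=> mp mq; apply: hardyT_ext => z zD; rewrite !mulHE// mulrCA. Qed.

Lemma n2_mulH_le p (M : R) F : multiplier p -> (forall z, polydisc z -> normc (p z) <= M) ->
  n2 hip (mulH p F) <= M ^+ 2 * n2 hip F.
Proof.
move=> mp pM; rewrite !n2_h2; apply: h2_le; first exact: hval_hardy.
have M0 : 0 <= M by apply: le_trans (pM _ polydisc0); exact: normc_ge0.
move=> r r01; apply: (@le_trans _ _ (M ^+ 2 * tn2 (dil r F))); last first.
  by rewrite ler_wpM2l ?exprn_ge0//; apply: h2_ub; first exact: hval_hardy.
have cc G := ccontinuous_analytic r01 (hardy_analytic (hval_hardy (G : H))).
apply: tn2_le_mul => // z zD; have rzD := polydiscZ r01 zD.
by rewrite /dil mulHE// normcM ler_wpM2r ?normc_ge0// pM.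
Qed.

Lemma inner_multiplier p : inner p -> multiplier p.
Proof. by move=> [ap bp _]; split. Qed.

Lemma cvg_rad_left : @rad R @ \oo --> (1 : R)^'-.
Proof.
move=> A /=; rewrite /at_left /within /= => /nbhs_normP[e /= e0 eA].
have /cvgrPdist_lt /(_ e e0) [N _ NP] := @cvg_rad R.
exists N => // m /= Nm; apply: eA; first by rewrite /= -normrN opprB distrC; exact: NP.
by case/andP: (@rad01 R m).
Qed.

Lemma inner_rad p : inner p -> {ae torus_measure n, forall t, exists l : R[i],
  (fun m => p ((rad m)%:C *: torus_point t)) @ \oo --> l /\ normc l = 1}.
Proof.
move=> [_ _]; apply: filterS => t [l [pl l1]]; exists l; split => //.
exact: (cvg_comp _ _ cvg_rad_left pl).
Qed.

(** The fixed dilation by s < 1 makes the second factor continuous up to the torus, so dominated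
    convergence applies and the unimodular radial limits of [p] drop out. *)
Lemma tn2_unimodular_cvg p F (s M : R) : 0 <= s < 1 -> analytic p ->
    (forall z, polydisc z -> normc (p z) <= M) ->
    {ae torus_measure n, forall t, exists l : R[i],
      (fun m => p ((rad m)%:C *: torus_point t)) @ \oo --> l /\ normc l = 1} ->
  (fun m => tn2 (fun z => dil (rad m) p z * dil (rad m) (dil s F) z)) @ \oo -->
  tn2 (dil s F).
Proof.
move=> s01 ap pM aep.
have M0 : 0 <= M by apply: le_trans (pM _ polydisc0); exact: normc_ge0.
have aF := hardy_analytic (hval_hardy F).
have cF : ccontinuous (dil s F) by exact: ccontinuous_analytic.
have [B FB] := bounded_cpolydisc cF.
have Fm (t : n.-tuple (measurableTypeR R)) :
    (fun m => dil (rad m) (dil s F) (torus_point t)) @ \oo --> dil s F (torus_point t).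
  apply: (cvg_comp _ _ _ (cF _ (cpolydisc_torus t))).
  apply: cvg_row => j; rewrite -[X in _ --> X]mul1r; under eq_fun do rewrite mxE.
  apply: (@ccvgM _ _ \oo); last exact: ccvg_cst.
  by apply: (@ccvg_real _ _ \oo); exact: cvg_rad.
rewrite tn2E; under eq_fun do rewrite tn2E.
have cc m : ccontinuous (fun z => dil (rad m) p z * dil (rad m) (dil s F) z).
  apply: ccontinuousM; apply: ccontinuous_analytic; rewrite ?rad01//.
  exact: analytic_dil.
apply: (@bounded_cvg _ _ _ _ _ _ ((M * B) ^+ 2)).
- by move=> m; have [mf _] := bmeas_torus (cc m); exact: cmeas_sqr_normc mf.
- by have [mf _] := bmeas_torus cF; exact: cmeas_sqr_normc mf.
- apply: filterS aep => t [l [ql l1]].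
  have h1 : (fun m => normc (dil (rad m) p (torus_point t) *
      dil (rad m) (dil s F) (torus_point t))) @ \oo --> normc (l * dil s F (torus_point t)).
    apply: (@ccvg_normc _ _ \oo); apply: (@ccvgM _ _ \oo); first exact: ql.
    exact: Fm.
  rewrite normcM l1 mul1r in h1; under eq_fun do rewrite expr2.
  by rewrite expr2; apply: cvgM; exact: h1.
- move=> m t; rewrite ger0_norm ?exprn_ge0 ?normc_ge0//.
  have rD := polydiscZ (rad01 m) (cpolydisc_torus t).
  have FB' := FB _ (sub_cpolydisc rD).
  have B0 : 0 <= B by apply: le_trans FB'; exact: normc_ge0.
  rewrite ler_pXn2r ?nnegrE ?normc_ge0 ?mulr_ge0// normcM.
  by apply: ler_pM; rewrite ?normc_ge0//; exact: pM.
Qed.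

(** For a dilation of F, [tn2_unimodular_cvg] applied to [p] and to the constant 1 gives both norms
    the same value. The dilations converge to F and multiplication by [p] is bounded, so the
    equality passes to F. *)
Lemma n2_mulH_inner p F : inner p -> n2 hip (mulH p F) = n2 hip F.
Proof.
move=> ip; have mp := inner_multiplier ip; have [ap [M pM]] := mp.
have lin c x y := mulH_lin c x y mp.
have step (s : R) (s01 : 0 <= s < 1) : n2 hip (mulH p (dilH s01 F)) = n2 hip (dilH s01 F).
  have h1 := @tn2_unimodular_cvg p F s M s01 ap pM (inner_rad ip).
  have h2' : (fun m => tn2 (fun z => dil (rad m) (fun=> 1) z * dil (rad m) (dil s F) z)) @ \oo -->
      tn2 (dil s F).
    apply: (@tn2_unimodular_cvg _ _ _ 1 s01).
    - exact: analytic_cst.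
    - by move=> z _; rewrite normc1.
    - apply: aeW => t; exists 1; split; [exact: ccvg_cst|exact: normc1].
  have h3 := h2_cvg (hval_hardy (mulH p (dilH s01 F))).
  have h4 := h2_cvg (hval_hardy (dilH s01 F)).
  rewrite !n2_h2; apply: etrans (_ : tn2 (dil s F) = _).
    apply: (rcvg_unique h3); rewrite (_ : (fun m => tn2 _) =
      (fun m => tn2 (fun z => dil (rad m) p z * dil (rad m) (dil s F) z))) //.
    apply/funext => m; have r01 := @rad01 R m.
    apply: (f_equal (@complex.Re R)); apply: eq_tip => z zD; have rD := polydiscZ r01 zD;
      by rewrite {1}/dil (mulHE _ mp rD) (dilHE s01 F rD).
  apply: (rcvg_unique h2'); rewrite (_ : (fun m => tn2 _) =
      (fun m => tn2 (dil (rad m) (dilH s01 F)))) //.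
  apply/funext => m; have r01 := @rad01 R m.
  apply: (f_equal (@complex.Re R)); apply: eq_tip => z zD; have rD := polydiscZ r01 zD;
      by rewrite {1 4}/dil mul1r (dilHE s01 F rD).
have h1 := hcvg_n2 hardy_hilbert (hcvg_dilH F).
have h2' : hcvg hip (fun m => mulH p (dilH (sqr01 (rad01 m)) F)) (mulH p F).
  move=> e e0; have M1 : 0 < M ^+ 2 + 1 by rewrite ltr_pwDr// exprn_even_ge0.
  have [N NP] := hcvg_dilH F (divr_gt0 e0 M1); exists N => m Nm.
  have := NP m Nm; set G := dilH _ F; rewrite ltr_pdivlMr// => h3.
  have -> : mulH p G - mulH p F = mulH p (G - F).
    by rewrite addrC -scaleN1r -lin addrC scaleN1r addrC.
  apply: le_lt_trans (n2_mulH_le _ mp pM) _; apply: le_lt_trans h3.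
  rewrite mulrC; apply: ler_wpM2l; first exact: n2_hardyT_ge0.
  by rewrite lerDl.
have h3 := hcvg_n2 hardy_hilbert h2'.
apply: (rcvg_unique h3); rewrite (_ : (fun m => n2 _ _) =
  (fun m => n2 hip (dilH (sqr01 (rad01 m)) F))) //.
by apply/funext => m; exact: step.
Qed.

End multiplication.

(** * Adjoints of multiplications and backward shifts *)

Section adjoint_operator.
Context {R : realType} {n : nat}.
Notation H := (hardyT R n).
Notation fT := ('rV[R[i]]_n -> R[i]).
Implicit Types (F G : H) (p : fT) (z w : 'rV[R[i]]_n).
Local Notation hH := (@hardy_hilbert R n).

(** Any adjoint of [V], or the identity by default if there is none; [adjP] excludes the default for
    inner functions. *)
Definition adj (V : H -> H) : H -> H :=
  if pselect (exists W, is_adjoint hip W V) is left ex then sval (cid ex) else id.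

Lemma mulH_linear p : multiplier p -> is_linear (mulH p).
Proof. by move=> mp c x y; exact: mulH_lin. Qed.

Lemma adjP p : inner p -> is_adjoint hip (adj (mulH p)) (mulH p).
Proof.
move=> ip; have mp := inner_multiplier ip.
rewrite /adj; case: pselect => [ex|[]]; first exact: (svalP (cid ex)).
by apply: (isometry_adjoint hH (mulH_linear mp)) => F; exact: n2_mulH_inner.
Qed.

Definition coord (k : 'I_n) : fT := fun z => z 0 k.

Lemma inner_coord k : inner (coord k).
Proof.
split; first exact: analytic_coord.
  by exists 1 => z zD; apply: ltW; exact: (zD k).
apply: aeW => t; exists (torus_point t 0 k).
split; last by rewrite torus_pointE normc_cis.
rewrite /coord -[X in _ --> X]mul1r; under eq_fun do rewrite mxE.
apply: (@ccvgM _ _ (1^'-)); last exact: ccvg_cst.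
apply: (@ccvg_real _ _ (1^'-) _ (fun x : R => x)).
exact: cvg_at_left_filter.
Qed.

Definition shift k : H -> H := mulH (coord k).
Definition coshift k : H -> H := adj (shift k).

Lemma shift_linear k : is_linear (shift k).
Proof. exact/mulH_linear/inner_multiplier/inner_coord. Qed.

Lemma n2_shift k F : n2 hip (shift k F) = n2 hip F.
Proof. exact: n2_mulH_inner (inner_coord k). Qed.

Lemma coshiftP k : is_adjoint hip (coshift k) (shift k).
Proof. exact/adjP/inner_coord. Qed.

Lemma shiftE k F z : polydisc z -> shift k F z = z 0 k * F z.
Proof. by move=> zD; rewrite mulHE//; exact/inner_multiplier/inner_coord. Qed.

Definition zero_at k w : 'rV[R[i]]_n := \row_j if j == k then 0 else w 0 j.

Lemma zero_at_polydisc k w : polydisc w -> polydisc (zero_at k w).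
Proof. by move=> wD j; rewrite mxE; case: eqP => // _; rewrite normc0. Qed.

Lemma zero_at_eq k w : zero_at k w 0 k = 0.
Proof. by rewrite mxE eqxx. Qed.

Lemma zero_at_neq k l w : k != l -> zero_at l w 0 k = w 0 k.
Proof. by move=> kl; rewrite mxE (negbTE kl). Qed.

Lemma cker_zero_at k w z : polydisc w -> polydisc z ->
  cker z w - cker z (zero_at k w) = (w 0 k)^* * (z 0 k * cker z w).
Proof.
move=> wD zD; rewrite /cker (bigD1 k)//=.
rewrite (bigD1 k (F := fun j => (1 - z 0 j * (zero_at k w 0 j)^*)^-1))//=.
rewrite zero_at_eq conjc0 mulr0 subr0 invr1 mul1r.
rewrite (_ : \prod_(j < n | j != k) (1 - z 0 j * (zero_at k w 0 j)^*)^-1 =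
    \prod_(j < n | j != k) (1 - z 0 j * (w 0 j)^*)^-1); last first.
  by apply: eq_bigr => j jk; rewrite zero_at_neq.
move: (\prod_(j < n | _) _) (cker_factor_neq0 k zD (sub_cpolydisc wD)) => P.
by move: (z 0 k) ((w 0 k)^*) => a b ab; field.
Qed.

(* If [w'] is [w] with its [k]-th coordinate set to [0], then
   [k_w - k_w' = conj(w_k) z_k k_w] for the reproducing kernels. *)
Lemma coshiftE k F w : polydisc w -> w 0 k * coshift k F w = F w - F (zero_at k w).
Proof.
move=> wD; have wD' := zero_at_polydisc k wD.
rewrite -(reproducing F wD) -(reproducing F wD') -(ipBr hH).
have -> : kerH wD - kerH wD' = (w 0 k)^* *: shift k (kerH wD).
  apply: hardyT_ext => z zD; rewrite hBE hZE shiftE// !mkHE//.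
  exact: cker_zero_at.
by rewrite (ipZr hH) conjcK -coshiftP reproducing.
Qed.

Lemma shift_coshift k F w : polydisc w ->
  shift k (coshift k F) w = F w - F (zero_at k w).
Proof. by move=> wD; rewrite shiftE// coshiftE. Qed.

Definition at_zero k F := F - shift k (coshift k F).

Lemma at_zeroE k F w : polydisc w -> at_zero k F w = F (zero_at k w).
Proof. by move=> wD; rewrite hBE shift_coshift// subKr. Qed.

Lemma shift_inj k F G : shift k F = shift k G -> F = G.
Proof. exact: (isometry_inj hH (@shift_linear k) (n2_shift k)). Qed.

(** Multiplied by z_l, both sides become p F minus its value at z_l = 0, since p does not depend on
    z_l; multiplication by z_l is injective. *)
Lemma coshift_mulH k l p F : multiplier p -> depends_only_on k p -> l != k ->
  mulH p (coshift l F) = coshift l (mulH p F).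
Proof.
move=> mp pk lk; apply: (@shift_inj l).
have mc := inner_multiplier (inner_coord l).
rewrite [LHS](mulHC _ mc mp); apply: hardyT_ext => w wD.
have wD' := zero_at_polydisc l wD.
rewrite shift_coshift// (mulHE _ mp wD) -/(shift l _) shift_coshift//.
rewrite !(mulHE _ mp)// mulrBr (pk (zero_at l w) w)//.
by rewrite zero_at_neq// eq_sym.
Qed.

Lemma coshift_ker k F w : polydisc w -> coshift k F = 0 -> F (zero_at k w) = F w.
Proof.
move=> wD F0; have := coshiftE k F wD; rewrite F0 h0E mulr0 => /eqP.
by rewrite eq_sym subr_eq0 => /eqP.
Qed.

(** Identities obtained by cancelling z_k hold off the hyperplane z_k = 0; they extend by continuity
    along the points w + e_k / (m+1). *)
Lemma analytic_coord_eq0 k (f : fT) : analytic f ->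
  (forall w, polydisc w -> w 0 k != 0 -> f w = 0) -> forall w, polydisc w -> f w = 0.
Proof.
move=> af f0 w wD; have [wk|wk] := eqVneq (w 0 k) 0; last exact: f0.
have [d d0 dP] := near_polydisc wD.
pose e (m : nat) : R[i] := (m.+1%:R^-1 : R)%:C.
pose u (m : nat) : 'rV[R[i]]_n := w + e m *: delta_mx 0 k.
have e0 : e @ \oo --> (0 : R)%:C by apply: (@ccvg_real _ _ \oo); exact: cvg_harmonic.
have uw : u @ \oo --> w.
  apply: cvg_row => j; rewrite -[X in _ --> X]addr0.
  under eq_fun do rewrite !mxE eqxx /=.
  apply: (@ccvgD _ _ \oo); first exact: ccvg_cst.
  rewrite -[X in _ --> X](mul0r (j == k)%:R).
  by apply: (@ccvgM _ _ \oo); [exact: e0|exact: ccvg_cst].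
have fu := cvg_comp _ _ uw (adiff_cvg (analytic_adiff af wD)).
apply: (@ccvg_unique _ _ \oo _ (f \o u)); first exact: fu.
have /ccvgP /(_ _ d0) [N _ NP] := e0.
apply/(@ccvgP _ _ \oo) => eps eps0; exists N => // m /= Nm.
rewrite f0 ?subr0 ?normc0//.
  apply: dP => j; rewrite !mxE eqxx /= [w 0 j + _]addrC addrK.
  case: (j == k); last by rewrite mulr0 normc0.
  rewrite mulr1 -[e m]subr0; exact: (NP m Nm).
rewrite !mxE wk add0r !eqxx mulr1 -normc_gt0 normc_real normr_gt0.
by rewrite invr_neq0.
Qed.

(** A factor [d] free of z_k comes out of the backward shift. It may be unbounded, so the product is
    an element [D] specified pointwise rather than through [mulH]. *)
Lemma iter_coshift_mulH k F (D d : H) m : coshift k d = 0 ->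
  (forall w, polydisc w -> D w = F w * d w) ->
  forall w, polydisc w -> iter m (coshift k) D w = iter m (coshift k) F w * d w.
Proof.
move=> d0 DF; elim: m => [|m IH] //= w wD.
apply/eqP; rewrite -subr_eq0; apply/eqP; move: w wD.
set D' := iter m _ D; set F' := iter m _ F.
apply: (@analytic_coord_eq0 k).
  apply: (@eq_analytic _ _ (fun w => coshift k D' w + - 1 * (coshift k F' w * d w))).
    by move=> w _; rewrite mulN1r.
  have an G := hardy_analytic (hval_hardy (G : H)).
  apply: analyticD; first exact: an.
  apply: analyticM; first exact: analytic_cst.
  by apply: analyticM; exact: an.
move=> w wD wk; apply: (mulfI wk); rewrite mulr0 mulrBr mulrA !coshiftE//.
have wD' := zero_at_polydisc k wD.
by rewrite -/D' -/F' !IH// (coshift_ker wD d0); ring.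
Qed.

Lemma hardy1 : hardy (fun _ : 'rV[R[i]]_n => 1).
Proof.
apply: hardy_bounded; first exact: analytic_cst.
by exists 1 => z _; rewrite normc1.
Qed.

Definition oneH : H := mkH hardy1.

Lemma oneE z : polydisc z -> oneH z = 1.
Proof. exact: mkHE. Qed.

Lemma hip_one F : hip F oneH = F 0.
Proof.
have -> : oneH = kerH polydisc0.
  apply: hardyT_ext => z zD; rewrite oneE// mkHE// /cker big1// => j _.
  by rewrite mxE conjc0 mulr0 subr0 invr1.
exact: reproducing.
Qed.

Lemma n2_one : n2 hip oneH = 1.
Proof. by rewrite /n2 hip_one oneE//; exact: polydisc0. Qed.

Lemma coshift_one k : coshift k oneH = 0.
Proof.
apply: (ip_ext hH) => F; rewrite (ip0l hH) coshiftP (ipJ hH) hip_one.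
by rewrite shiftE; [rewrite mxE mul0r conjc0|exact: polydisc0].
Qed.

Lemma shiftC k l F : shift k (shift l F) = shift l (shift k F).
Proof. by apply: mulHC; exact/inner_multiplier/inner_coord. Qed.

Lemma coshiftC k l F : coshift k (coshift l F) = coshift l (coshift k F).
Proof. exact: (adjointC hH (coshiftP k) (coshiftP l) (shiftC l k)). Qed.

Lemma shift_mulH k p F : multiplier p -> mulH p (shift k F) = shift k (mulH p F).
Proof. by move=> mp; apply: mulHC => //; exact/inner_multiplier/inner_coord. Qed.

Lemma shift_coshiftC k l F : l != k -> shift k (coshift l F) = coshift l (shift k F).
Proof.
move=> lk; apply: coshift_mulH lk; first exact/inner_multiplier/inner_coord.
by move=> z w _ _.
Qed.

Definition zeros_at (s : seq 'I_n) w := foldr zero_at w s.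

Lemma zeros_atE s w j : zeros_at s w 0 j = if j \in s then 0 else w 0 j.
Proof.
elim: s => [|k s IH] //=; rewrite in_cons; have [->|jk] := eqVneq j k.
  by rewrite zero_at_eq.
by rewrite zero_at_neq.
Qed.

Lemma zeros_at_polydisc s w : polydisc w -> polydisc (zeros_at s w).
Proof. by move=> wD; elim: s => [|k s IH] //=; exact: zero_at_polydisc. Qed.

Lemma coshift_ker_seq s F w : polydisc w -> (forall k, k \in s -> coshift k F = 0) ->
  F (zeros_at s w) = F w.
Proof.
move=> wD; elim: s => [|k s IH] //= F0.
rewrite (coshift_ker (zeros_at_polydisc s wD)) ?F0 ?mem_head//.
by apply: IH => l ls; rewrite F0// in_cons ls orbT.
Qed.

Lemma coshift_ker_depends k F : (forall l, l != k -> coshift l F = 0) ->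
  depends_only_on k F.
Proof.
move=> F0 z w zD wD zw; pose s := [seq l <- enum 'I_n | l != k].
have sF l : l \in s -> coshift l F = 0 by rewrite mem_filter => /andP[/F0].
rewrite -(coshift_ker_seq zD sF) -(coshift_ker_seq wD sF); congr (hval F _).
apply/rowP => j; rewrite !zeros_atE mem_filter mem_enum andbT.
by have [->|] := eqVneq j k.
Qed.

Lemma coshift_ker_const F : (forall l, coshift l F = 0) -> F = hip F oneH *: oneH.
Proof.
move=> F0; apply: hardyT_ext => z zD; rewrite hZE hip_one oneE// mulr1.
rewrite -(coshift_ker_seq (s := enum 'I_n) zD)//; congr (hval F _).
by apply/rowP => j; rewrite zeros_atE mem_enum mxE.
Qed.

(** Here F(w) = w_k^m G_m(w) with the G_m bounded in norm, so [eval_bound] makes |F(w)|^2 at most a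
    constant times rho^(2m), which tends to 0. *)
Lemma shift_pure k F (B : R) :
  (forall m, exists2 G, F = iter m (shift k) G & n2 hip G <= B) -> F = 0.
Proof.
move=> FB; apply: hardyT_ext => w wD.
have [rho r01 wr] := polydisc_rho wD.
have iterE m (G : H) : iter m (shift k) G w = w 0 k ^+ m * G w.
  by elim: m => [|m IH]; rewrite ?mul1r//= shiftE// IH mulrA exprS.
pose K := ((1 - rho)^-1) ^+ n * B.
have FK m : normc (F w) ^+ 2 <= (rho ^+ 2) ^+ m * K.
  have [G FG GB] := FB m; rewrite FG iterE normcM exprMn -exprM mulnC exprM normcX.
  have [r0 r1] := andP r01.
  apply: ler_pM; rewrite ?exprn_ge0 ?normc_ge0//.
    by rewrite -!exprM mulnC lerXn2r ?nnegrE ?normc_ge0.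
  apply: le_trans (eval_bound G r01 wr) _; rewrite ler_wpM2l// exprn_ge0// invr_ge0.
  by rewrite subr_ge0 ltW.
have c0 : (fun m => (rho ^+ 2) ^+ m * K) @ \oo --> (0 : R).
  rewrite -[X in _ --> X](mul0r K); apply: cvgM; last exact: cvg_cst.
  by apply: cvg_expr; have /andP[a b] := sqr01 r01; rewrite ger0_norm.
have : normc (F w) ^+ 2 <= 0.
  have h : \forall m \near \oo, normc (F w) ^+ 2 <= (rho ^+ 2) ^+ m * K.
    by apply: nearW => m; exact: FK.
  exact: (cvgr_to_ge c0 h).
rewrite h0E => h; apply/eqP; rewrite -normc_eq0 -sqrf_eq0 eq_le h.
by rewrite sqr_ge0.
Qed.

Definition taylor_coef k p m : R[i] := iter m (coshift k) (mulH p oneH) 0.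

(** As [d] is free of z_k, the backward shifts of p d are those of p times [d]; setting z_k = 0 in
    the m-th one leaves the m-th Taylor coefficient of p. *)
Lemma at_zero_iter_coshift k p d m : multiplier p -> depends_only_on k p ->
  coshift k d = 0 ->
  at_zero k (iter m (coshift k) (mulH p d)) = taylor_coef k p m *: d.
Proof.
move=> mp pk d0; apply: hardyT_ext => w wD.
have wD' := zero_at_polydisc k wD.
rewrite hZE at_zeroE//.
rewrite (iter_coshift_mulH (F := mulH p oneH) (d := d) m d0 _ wD'); last first.
  by move=> z zD; rewrite !mulHE// oneE// mulr1.
rewrite (coshift_ker wD d0) /taylor_coef; congr (_ * _).
apply: (coshift_ker_depends (k := k)) => //; last by rewrite zero_at_eq mxE.
  move=> l lk; have comm F : iter m (coshift k) (coshift l F) = coshift l (iter m (coshift k) F).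
    by elim: m => [|m IH] //=; rewrite IH coshiftC.
  rewrite -comm -(coshift_mulH _ mp pk lk) coshift_one.
  rewrite (is_linear0 (mulH_linear mp)).
  have c0 : coshift k 0 = 0.
    by apply: is_linear0; exact: (adjoint_linear hH (coshiftP k)).
  by elim: (m) => [|i IH] //=; rewrite IH.
exact: polydisc0.
Qed.

(** The function p has norm 1, so |p - p(0)|^2 = 1 - |p(0)|^2; if |p(0)| >= 1, p is constant. *)
Lemma taylor_coef0_lt1 k p : inner p -> nonconstant p -> normc (taylor_coef k p 0) < 1.
Proof.
move=> ip nc; have mp := inner_multiplier ip.
rewrite ltNge; apply/negP => c1; apply: nc; exists (taylor_coef k p 0).
rewrite /taylor_coef /= in c1 *; set G := mulH p oneH in c1 *.
suff E : G = G 0 *: oneH.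
  move=> z zD; have := mulHE oneH mp zD; rewrite -/G oneE// mulr1 => <-.
  by have := f_equal (fun F : H => F z) E; rewrite hZE oneE// mulr1.
apply/eqP; rewrite -subr_eq0; apply/eqP/(n2_eq0 hH)/eqP.
rewrite eq_le (n2_ge0 hH) andbT (n2D hH) (n2N hH) (n2Z hH) n2_one (ipNr hH) (ipZr hH).
have -> : (G 0)^* * hip G oneH = (normc (G 0) ^+ 2)%:C by rewrite hip_one mulrC mulcJ.
rewrite cReN /= /G (n2_mulH_inner _ ip) n2_one -/G.
move: (normc _) c1 => c c1; nra.
Qed.

End adjoint_operator.

(** * Doubly commuting shifts *)

Section shift_family.
Context {R : realType} {H : lmodType R[i]} {ip : H -> H -> R[i]} {n : nat}.
Hypothesis hH : is_hilbert ip.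
Variables (S T : 'I_n -> H -> H) (one : H).
Implicit Types (x y d : H) (k l j : 'I_n).

(** What the projection argument uses of the coordinate multiplications [S] and the backward shifts
    [T], with [one] for the constant function 1. [sh_pure] says that the ranges of the powers of
    [S k] have no common vector but 0. *)
Record is_shift_family : Prop := IsShiftFamily {
  sh_lin : forall k, is_linear (S k);
  sh_iso : forall k x, n2 ip (S k x) = n2 ip x;
  sh_adj : forall k, is_adjoint ip (T k) (S k);
  sh_comm : forall k l x, S k (S l x) = S l (S k x);
  sh_comm_adj : forall k l x, l != k -> S k (T l x) = T l (S k x);
  sh_adj1 : forall k, T k one = 0;
  sh_norm1 : n2 ip one = 1;
  sh_const : forall x, (forall k, T k x = 0) -> x = ip x one *: one;
  sh_pure : forall k x (B : R),
    (forall m, exists2 y, x = iter m (S k) y & n2 ip y <= B) -> x = 0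
}.

(* On the Hardy space this is the evaluation [f |-> f(z)|_(z_k = 0)], the
   projection onto the kernel of [T k]. *)
Definition wander k x := x - S k (T k x).

(* [V] is multiplication by a non-constant inner function of the [k]-th
   variable, and [c] lists the Taylor coefficients of that function. *)
Record shift_mult k (V W : H -> H) : Prop := ShiftMult {
  sm_lin : is_linear V;
  sm_iso : forall x, n2 ip (V x) = n2 ip x;
  sm_adj : is_adjoint ip W V;
  sm_S : forall l x, V (S l x) = S l (V x);
  sm_T : forall l x, l != k -> V (T l x) = T l (V x);
  sm_coef : exists c : nat -> R[i], normc (c 0%N) < 1 /\
    forall m d, T k d = 0 -> wander k (iter m (T k) (V d)) = c m *: d
}.

Hypothesis hS : is_shift_family.

Lemma T_lin k : is_linear (T k).
Proof. exact: (adjoint_linear hH (sh_adj hS k)). Qed.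

Lemma TSK k x : T k (S k x) = x.
Proof. exact: (adjoint_isometryK hH (sh_lin hS k) (sh_iso hS k) (sh_adj hS k)). Qed.

Lemma T_comm k l x : T k (T l x) = T l (T k x).
Proof. exact: (adjointC hH (sh_adj hS k) (sh_adj hS l) (fun y => sh_comm hS l k y)). Qed.

Lemma T_contr k x : n2 ip (T k x) <= n2 ip x.
Proof. exact: (adjoint_contraction hH (sh_iso hS k) (sh_adj hS k)). Qed.

Lemma iter_T_contr k m x : n2 ip (iter m (T k) x) <= n2 ip x.
Proof. by elim: m => [|m IH] //=; exact: le_trans (T_contr _ _) IH. Qed.

Lemma iter_T_lin k m : is_linear (iter m (T k)).
Proof. by move=> c x y; elim: m => [|m IH] //=; rewrite IH T_lin. Qed.

Lemma wander_lin k : is_linear (wander k).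
Proof.
move=> c x y; rewrite /wander T_lin (sh_lin hS) scalerBr.
by rewrite opprD addrACA.
Qed.

Lemma T_wander k x : T k (wander k x) = 0.
Proof. by rewrite /wander (is_linearB (T_lin k)) TSK subrr. Qed.

Lemma wander_ker k d : T k d = 0 -> wander k d = d.
Proof. by move=> d0; rewrite /wander d0 (is_linear0 (sh_lin hS k)) subr0. Qed.

(** If all Taylor coefficients in z_k vanish, then x = S^m T^m x for every m, and purity applies. *)
Lemma taylor_eq0 k x : (forall m, wander k (iter m (T k) x) = 0) -> x = 0.
Proof.
move=> x0; apply: (sh_pure hS (k := k) (B := n2 ip x)) => m.
exists (iter m (T k) x); last exact: iter_T_contr.
elim: m => [|m IH] //; rewrite {1}IH iterSr /=; congr (iter _ _ _).
by apply/eqP; rewrite -subr_eq0; apply/eqP; exact: x0.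
Qed.

Section one_multiplication.
Context {k : 'I_n} {V W : H -> H}.
Hypothesis hV : shift_mult k V W.

Lemma sm_Wlin : is_linear W.
Proof. exact: (adjoint_linear hH (sm_adj hV)). Qed.

Lemma sm_WV x : W (V x) = x.
Proof. exact: (adjoint_isometryK hH (sm_lin hV) (sm_iso hV) (sm_adj hV)). Qed.

Lemma sm_Wcontr x : n2 ip (W x) <= n2 ip x.
Proof. exact: (adjoint_contraction hH (sm_iso hV) (sm_adj hV)). Qed.

Lemma sm_WT l x : W (T l x) = T l (W x).
Proof. exact: (adjointC hH (sm_adj hV) (sh_adj hS l) (fun y => esym (sm_S hV l y))). Qed.

Lemma sm_WS l x : l != k -> W (S l x) = S l (W x).
Proof.
move=> lk.
exact: (adjoint_comm hH (sm_adj hV) (sh_adj hS l) (fun y => sm_T hV y lk)).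
Qed.

Lemma sm_wander l x : l != k -> W (wander l x) = wander l (W x).
Proof. by move=> lk; rewrite /wander (is_linearB sm_Wlin) sm_WS// sm_WT. Qed.

(** The scalar a is the value of the inner function at 0. For the adjoint, x = W d - a^* d again
    lies in the kernel of [T k], where V x is a x plus a term in the range of [S k]; this makes x
    orthogonal to itself. *)
Lemma sm_ker : exists a : R[i], normc a < 1 /\
  forall d, T k d = 0 -> wander k (V d) = a *: d /\ W d = a^* *: d.
Proof.
have [c [c1 cP]] := sm_coef hV; exists (c 0%N); split => // d d0.
split; first exact: (cP 0%N).
apply/eqP; rewrite -subr_eq0; apply/eqP/(ip_eq0 hH); set x := _ - _.
have x0 : T k x = 0.
  by rewrite /x (is_linearB (T_lin k)) (is_linearZ (T_lin k)) -sm_WT d0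
    (is_linear0 sm_Wlin) scaler0 subrr.
have Vx : V x = c 0%N *: x + S k (T k (V x)).
  by rewrite -(cP 0%N x x0) /= /wander subrK.
rewrite {1}/x (ipBl hH) (ipZl hH) (sm_adj hV) Vx (ipDr hH) (ipZr hH).
by rewrite -(sh_adj hS) d0 (ip0l hH) addr0 subrr.
Qed.

Definition coproj x := x - V (W x).

Lemma coproj_lin : is_linear coproj.
Proof.
move=> c x y; rewrite /coproj sm_Wlin (sm_lin hV) scalerBr.
by rewrite opprD addrACA.
Qed.

Lemma coproj_V x : coproj (V x) = 0.
Proof. by rewrite /coproj sm_WV subrr. Qed.

Lemma coproj_idem x : coproj (coproj x) = coproj x.
Proof. by rewrite {2}/coproj (is_linearB coproj_lin) coproj_V subr0. Qed.

Lemma coproj_sa x y : ip (coproj x) y = ip x (coproj y).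
Proof.
rewrite /coproj (ipBl hH) (ipBr hH); congr (_ - _).
by rewrite -(adjointr hH (sm_adj hV)) (sm_adj hV).
Qed.

Lemma coproj_T l x : l != k -> coproj (T l x) = T l (coproj x).
Proof. by move=> lk; rewrite /coproj (is_linearB (T_lin l)) sm_WT (sm_T hV). Qed.

(** The range of [V] is invariant under [S k] and is killed by [coproj]. *)
Lemma coproj_Sk x : coproj (S k x) = coproj (S k (coproj x)).
Proof.
rewrite {3}/coproj (is_linearB (sh_lin hS k)) (is_linearB coproj_lin).
by rewrite -(sm_S hV) coproj_V subr0.
Qed.

(** The scalar is 1 - |a|^2, with a the value of the inner function at 0; it is non-zero because |a|
    < 1. *)
Lemma coproj_ker : exists a : R[i], a != 0 /\
  forall d, T k d = 0 -> wander k (coproj d) = a *: d.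
Proof.
have [a [a1 aP]] := sm_ker; exists (1 - (normc a ^+ 2)%:C); split.
  rewrite -(rmorph1 (real_complex R)) -rmorphB fmorph_eq0 subr_eq0 eq_sym.
  by rewrite lt_eqF// expr_lt1// normc_ge0.
move=> d d0; have [Vd Wd] := aP d d0.
rewrite /coproj (is_linearB (wander_lin k)) wander_ker// Wd.
rewrite (is_linearZ (sm_lin hV)) (is_linearZ (wander_lin k)) Vd scalerA.
by rewrite mulrC mulcJ scalerBl scale1r.
Qed.

End one_multiplication.

(* [D] below commutes with [S l], and it vanishes on the kernel of [T l] because
   both of its terms have the same Taylor coefficients in [z_l]; so the range of
   [D] is contained in that of every power of [S l]. *)
Lemma sm_doubly_commute k l (V W V' W' : H -> H) : l != k ->
  shift_mult k V W -> shift_mult l V' W' -> (forall x, V (V' x) = V' (V x)) ->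
  forall x, W (V' x) = V' (W x).
Proof.
move=> lk hV hV' VC x.
have kl : k != l by rewrite eq_sym.
have Wl := sm_Wlin hV; have Vl' := sm_lin hV'.
pose D y := W (V' y) - V' (W y).
have D0 d : T l d = 0 -> D d = 0.
  move=> d0; apply: (taylor_eq0 (k := l)) => m.
  have [c [_ cP]] := sm_coef hV'.
  have iterW y : iter m (T l) (W y) = W (iter m (T l) y).
    by elim: m => [|m IH] //=; rewrite IH (sm_WT hV).
  have Wd0 : T l (W d) = 0 by rewrite -(sm_WT hV) d0 (is_linear0 Wl).
  rewrite /D (is_linearB (iter_T_lin l m)) (is_linearB (wander_lin l)) cP//.
  by rewrite iterW -(sm_wander hV)// cP// (is_linearZ Wl) subrr.
have DS y : D (S l y) = S l (D y).
  rewrite /D (is_linearB (sh_lin hS l)) (sm_S hV') !(sm_WS hV)//.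
  by rewrite (sm_S hV').
have Dlin y z : D (y + z) = D y + D z.
  by rewrite /D !(is_linearD Vl', is_linearD Wl) opprD addrACA.
have DST y : D y = S l (D (T l y)).
  rewrite -DS -[y in LHS](subrK (S l (T l y))) Dlin D0 ?add0r//.
  exact: T_wander.
apply/eqP; rewrite -subr_eq0; apply/eqP; rewrite -/(D x).
apply: (sh_pure hS (k := l) (B := 2 * n2 ip x + 2 * n2 ip x)) => m.
exists (D (iter m (T l) x)).
  elim: m => [|m IH] //; rewrite IH [in RHS]iterSr /=; congr (iter _ _ _).
  exact: DST.
set y := iter m (T l) x.
have yx : n2 ip y <= n2 ip x by exact: iter_T_contr.
apply: le_trans (n2D_le2 hH _ _) _; rewrite (n2N hH) (sm_iso hV').
have h1 := sm_Wcontr hV (V' y); rewrite (sm_iso hV') in h1.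
have h2' := sm_Wcontr hV y.
by apply: lerD; rewrite ler_pM2l//; apply: le_trans yx.
Qed.

End shift_family.

(** * Divisibility in one variable *)

Section division.
Context {R : realType} {H : lmodType R[i]} {ip : H -> H -> R[i]} {n : nat}.
Hypothesis hH : is_hilbert ip.
Variables (S T : 'I_n -> H -> H) (one : H).
Hypothesis hS : is_shift_family (ip := ip) S T one.
Variable j : 'I_n.
Implicit Types (x y d : H) (V W : H -> H).

(** On the Hardy space, these are the functions of z_j alone. *)
Definition one_var x := forall k, k != j -> T k x = 0.

Local Notation T_lin := (T_lin hH hS).
Local Notation shift_mult := (shift_mult (ip := ip) S T).

Lemma one_var_T x : one_var x -> one_var (T j x).
Proof. by move=> x1 k kj; rewrite (T_comm hH hS) x1// (is_linear0 (T_lin j)). Qed.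

Lemma one_var_V V W x : shift_mult j V W -> one_var x -> one_var (V x).
Proof.
by move=> hV x1 k kj; rewrite -(sm_T hV)// x1// (is_linear0 (sm_lin hV)).
Qed.

Lemma one_var_W V W x : shift_mult j V W -> one_var x -> one_var (W x).
Proof.
move=> hV x1 k kj; rewrite -(sm_WT hH hS hV) x1//.
exact: (is_linear0 (sm_Wlin hH hV)).
Qed.

Lemma one_var_one : one_var one.
Proof. by move=> k _; exact: (sh_adj1 hS). Qed.

Lemma one_var_const x : one_var x -> T j x = 0 -> x = ip x one *: one.
Proof.
move=> x1 x0; apply: (sh_const hS) => k.
by have [->|kj] := eqVneq k j; [|exact: x1].
Qed.

Lemma one_var_wander x : one_var x -> wander S T j x = ip x one *: one.
Proof.
move=> x1; rewrite [LHS](one_var_const (x := wander S T j x)).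
- congr (_ *: _); rewrite /wander (ipBl hH) -(adjointr hH (sh_adj hS j)).
  by rewrite (sh_adj1 hS) (ip0r hH) subr0.
- move=> k kj; rewrite /wander (is_linearB (T_lin k)) -(sh_comm_adj hS)// 1?eq_sym//.
  by rewrite (T_comm hH hS k j) x1// (is_linear0 (T_lin j)) (is_linear0 (sh_lin hS j)) subrr.
- exact: (T_wander hH hS).
Qed.

Lemma one_neq0 : one <> 0.
Proof.
move=> one0; have := sh_norm1 hS; rewrite one0 (n2_0 hH) => /eqP.
by rewrite eq_sym oner_eq0.
Qed.

Section commuting_projections.
Variables V W V' W' : H -> H.
Hypotheses (hV : shift_mult j V W) (hV' : shift_mult j V' W').
Hypothesis EE' : forall x, one_var x -> V (W (V' (W' x))) = V' (W' (V (W x))).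

Let Wlin := sm_Wlin hH hV.
Let Wlin' := sm_Wlin hH hV'.

(* The part [p] of [phi] orthogonal to [psi H] is [phi a], where [a] belongs to
   the [T j]-invariant space of all [x] with [phi x] orthogonal to [psi H].  If
   [p <> 0], some [b] in that space has [b(0) <> 0], and this forces [W' phi] to
   be constant. *)
Lemma division_or_orthogonal : (exists h, V one = V' h) \/ (exists h, V' one = V h) \/
  W' (V one) = 0.
Proof.
pose phi := V one; have phi1 : one_var phi by exact: (one_var_V hV one_var_one).
pose p := phi - V' (W' phi).
have [p0|p0] := eqVneq p 0.
  by left; exists (W' phi); apply/eqP; rewrite -subr_eq0 -/phi -/p p0.
have Wphi : W phi = one by exact: (sm_WV hH hV).
pose a := W p; have pa : V a = p.
  rewrite /a /p (is_linearB Wlin) (is_linearB (sm_lin hV)) Wphi.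
  by rewrite EE'// Wphi.
pose A x := one_var x /\ W' (V x) = 0.
have Aa : A a.
  split; last by rewrite pa /p (is_linearB Wlin') (sm_WV hH hV') subrr.
  apply: (one_var_W hV) => k kj; rewrite /p (is_linearB (T_lin k)) (phi1 k kj).
  by rewrite (one_var_V hV' (one_var_W hV' phi1) kj) subr0.
have AT x : A x -> A (T j x).
  move=> [x1 x0]; split; first exact: one_var_T.
  (* Since V (T x) = V (W y), commutation of the projections turns V' W' of it into V W V' (W' y),
     and W' y = T (W' (V x)) = 0. *)
  pose y := T j (V x); have y1 : one_var y by apply/one_var_T/(one_var_V hV).
  have -> : V (T j x) = V (W y) by rewrite /y (sm_WT hH hS hV) (sm_WV hH hV).
  apply: (isometry_inj hH (sm_lin hV') (sm_iso hV')).
  rewrite -(EE' y1) /y (sm_WT hH hS hV') x0 (is_linear0 (T_lin j)).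
  by rewrite (is_linear0 (sm_lin hV')) (is_linear0 Wlin) (is_linear0 (sm_lin hV)).
have AiterT m : A (iter m (T j) a) by elim: m => [|m IH] //=; exact: AT.
have [m bm] : exists m, wander S T j (iter m (T j) a) != 0.
  apply: contrapT => am; apply/(negP p0)/eqP; rewrite -pa.
  suff -> : a = 0 by exact: (is_linear0 (sm_lin hV)).
  apply: (taylor_eq0 hH hS (k := j)) => m.
  by apply: contrapT => /eqP bm; apply: am; exists m.
set b := iter m (T j) a in bm; have [b1 b0] : A b by exact: AiterT.
have [_ Tb0] := AT _ (conj b1 b0).
rewrite (one_var_wander b1) in bm; set beta := ip b one in bm.
have bE : b = beta *: one + S j (T j b).
  by rewrite -(one_var_wander b1) /wander subrK.
have beta0 : beta != 0 by apply: contraNneq bm => ->; rewrite scale0r.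
(* Apply W' V to b = beta 1 + S (T b): the left side vanishes. Then [T j] cancels S and leaves beta
   T (W' phi) = - W' (V (T b)), which is 0 because T b is in [A] as well. *)
have TW0 : T j (W' phi) = 0.
  have : beta *: T j (W' phi) = 0.
    rewrite -(is_linearZ (T_lin j)) -(is_linearZ Wlin') -(is_linearZ (sm_lin hV)).
    have -> : beta *: one = b - S j (T j b) by rewrite {1}bE addrK.
    rewrite (is_linearB (sm_lin hV)) (is_linearB Wlin') b0 sub0r (sm_S hV).
    rewrite -scaleN1r (is_linearZ (T_lin j)) -(sm_WT hH hS hV') (TSK hH hS).
    by rewrite Tb0 scaler0.
  by move/eqP; rewrite scaler_eq0 (negbTE beta0) => /eqP.
have Wphi' := one_var_const (one_var_W hV' phi1) TW0.
set g := ip (W' phi) one in Wphi'.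
have [g0|g0] := eqVneq g 0; first by right; right; rewrite -/phi Wphi' g0 scale0r.
(* Now V' (W' phi) = g psi with g a non-zero constant, and it is fixed by the projection V W, so psi
   lies in the range of V. *)
right; left; exists (W (V' one)).
have E : V (W (V' (W' phi))) = V' (W' phi) by rewrite EE'// Wphi.
rewrite Wphi' (is_linearZ (sm_lin hV')) (is_linearZ Wlin) (is_linearZ (sm_lin hV)) in E.
by apply: (scalerI g0).
Qed.

(* [t = W' V] would intertwine [T j] with itself and have range orthogonal to
   [1], hence vanish, although it maps [psi] to [phi]. *)
Lemma not_orthogonal : W' (V one) = 0 -> W (V' one) = 0 ->
  (forall x, V (V' x) = V' (V x)) -> False.
Proof.
move=> o1 o2 VC; pose t x := W' (V x).
have tT x : one_var x -> T j (t x) = t (T j x).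
  move=> x1; rewrite /t -(sm_WT hH hS hV').
  have xE : x = ip x one *: one + S j (T j x).
    by rewrite -(one_var_wander x1) /wander subrK.
  rewrite {1}xE (is_linearD (sm_lin hV)) (is_linearD (T_lin j)) (is_linearD Wlin').
  rewrite (sm_S hV) (TSK hH hS) (is_linearZ (sm_lin hV)) (is_linearZ (T_lin j)).
  by rewrite (is_linearZ Wlin') (sm_WT hH hS hV') o1 (is_linear0 (T_lin j)) scaler0 add0r.
have t1 x : one_var x -> one_var (t x).
  by move=> x1; exact: (one_var_W hV' (one_var_V hV x1)).
have t0 x : one_var x -> t x = 0.
  move=> x1; apply: (taylor_eq0 hH hS (k := j)) => m.
  have [y [y1 ->]] : exists y, one_var y /\ iter m (T j) (t x) = t y.
    elim: m => [|m [y [y1 /= ->]]]; first by exists x.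
    by exists (T j y); split; [exact: one_var_T|exact: tT].
  rewrite (one_var_wander (t1 _ y1)) /t (sm_adj hV') -(adjointr hH (sm_adj hV)).
  by rewrite o2 (ip0r hH) scale0r.
have := t0 (V' one) (one_var_V hV' one_var_one).
rewrite /t VC (sm_WV hH hV') => V10; apply: one_neq0.
by rewrite -(sm_WV hH hV one) V10 (is_linear0 Wlin).
Qed.

End commuting_projections.

Lemma one_variable_division (V W V' W' : H -> H) :
  shift_mult j V W -> shift_mult j V' W' -> (forall x, V (V' x) = V' (V x)) ->
  (forall x, one_var x -> V (W (V' (W' x))) = V' (W' (V (W x)))) ->
  (exists h, V one = V' h) \/ (exists h, V' one = V h).
Proof.
move=> hV hV' VC EE'.
have [|[|o1]] := division_or_orthogonal hV hV' EE'; [by left|by right|].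
have E'E x : one_var x -> V' (W' (V (W x))) = V (W (V' (W' x))) by move=> /EE' ->.
have [|[|o2]] := division_or_orthogonal hV' hV E'E;
  [by right|by left|].
by case: (not_orthogonal hV hV' o1 o2 VC).
Qed.

End division.

(** * Products of complementary projections *)

Section products.
Context {R : realType} {H : lmodType R[i]} {ip : H -> H -> R[i]} {n : nat}.
Hypothesis hH : is_hilbert ip.
Variables (S T : 'I_n -> H -> H) (one : H).
Hypothesis hS : is_shift_family (ip := ip) S T one.
Variables (L : bool -> {set 'I_n}) (V W : bool -> 'I_n -> H -> H).
Hypothesis hV : forall b k, k \in L b -> shift_mult (ip := ip) S T k (V b k) (W b k).
Hypothesis VC : forall b b' k l x, k \in L b -> l \in L b' ->
  V b k (V b' l x) = V b' l (V b k x).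
Implicit Types (b : bool) (k l j : 'I_n) (x y : H) (s : seq 'I_n).

Local Notation T_lin := (T_lin hH hS).

(** The boolean selects one of the two families of inner functions. Indices outside [L b] contribute
    the identity, so that both products run over all variables. *)
Definition factor b k x := if k \in L b then coproj (V := V b k) (W := W b k) x else x.

Lemma factor_lin b k : is_linear (factor b k).
Proof.
by move=> c x y; rewrite /factor; case: (boolP (k \in L b)) => // kL;
  exact: (coproj_lin hH (hV kL)).
Qed.

Lemma factor_idem b k x : factor b k (factor b k x) = factor b k x.
Proof. by rewrite /factor; case: (boolP (k \in L b)) => // kL; exact: (coproj_idem hH (hV kL)). Qed.

Lemma factor_sa b k x y : ip (factor b k x) y = ip x (factor b k y).
Proof. by rewrite /factor; case: (boolP (k \in L b)) => // kL; exact: (coproj_sa hH (hV kL)). Qed.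

Lemma factor_T b k l x : l != k -> factor b k (T l x) = T l (factor b k x).
Proof. by move=> lk; rewrite /factor; case: (boolP (k \in L b)) => // kL;
  exact: (coproj_T hH hS (hV kL)). Qed.

Lemma factor_Sk b k x : factor b k (S k x) = factor b k (S k (factor b k x)).
Proof. by rewrite /factor; case: (boolP (k \in L b)) => // kL;
  exact: (coproj_Sk hH hS (hV kL)). Qed.

(** The adjoint form of [factor_Sk]: the orthogonal complement of [V] H is invariant under [T k]. *)
Lemma T_factor b k x : T k (factor b k x) = factor b k (T k (factor b k x)).
Proof.
apply: (ip_ext hH) => y; rewrite [RHS]factor_sa !(sh_adj hS) !factor_sa.
by rewrite -factor_Sk.
Qed.

Lemma factor_ker b k : exists a : R[i], a != 0 /\
  forall d, T k d = 0 -> wander S T k (factor b k d) = a *: d.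
Proof.
rewrite /factor; case: (boolP (k \in L b)) => kL; first exact: (coproj_ker hH hS (hV kL)).
exists 1; split; first exact: oner_neq0.
by move=> d d0; rewrite scale1r; exact: (wander_ker hS).
Qed.

(** In distinct variables the multiplications commute, hence their adjoints do, and the mixed
    products commute by [sm_doubly_commute]. *)
Lemma factor_comm b b' k l x : l != k ->
  factor b k (factor b' l x) = factor b' l (factor b k x).
Proof.
move=> lk; have kl : k != l by rewrite eq_sym.
rewrite /factor; case: (boolP (k \in L b)) => // kL; case: (boolP (l \in L b')) => // lL.
have h := hV kL; have h' := hV lL.
have c1 y : W b k (V b' l y) = V b' l (W b k y).
  by apply: (sm_doubly_commute hH hS lk h h') => z; exact: VC.
have c2 y : W b' l (V b k y) = V b k (W b' l y).
  by apply: (sm_doubly_commute hH hS kl h' h) => z; exact: VC.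
have c3 y : W b k (W b' l y) = W b' l (W b k y).
  by apply: (adjointC hH (sm_adj h) (sm_adj h')) => z; exact: VC.
rewrite /coproj (is_linearB (sm_Wlin hH h)) (is_linearB (sm_Wlin hH h')).
rewrite (is_linearB (sm_lin h)) (is_linearB (sm_lin h')).
rewrite c1 c2 c3 VC// !opprB !addrA.
by rewrite addrAC [RHS]addrAC; congr (_ + _); exact: addrAC.
Qed.

Definition fprod b s x := foldr (factor b) x s.

Lemma fprod_lin b s : is_linear (fprod b s).
Proof. by elim: s => [|k s IH] c x y //=; rewrite IH factor_lin. Qed.

Lemma fprod_comm (F : H -> H) b s : (forall k x, k \in s -> F (factor b k x) = factor b k (F x)) ->
  forall x, F (fprod b s x) = fprod b s (F x).
Proof.
move=> FC x; elim: s FC => [|k s IH] FC //=.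
rewrite FC ?mem_head// IH// => l y ls; apply: FC.
by rewrite in_cons ls orbT.
Qed.

Lemma fprod_factor b b' k s x : k \notin s ->
  factor b' k (fprod b s x) = fprod b s (factor b' k x).
Proof.
move=> ks; apply: fprod_comm => l y ls; apply: factor_comm.
by apply: contraNneq ks => <-.
Qed.

Lemma fprod_rem b j s x : uniq s -> j \in s -> fprod b s x = factor b j (fprod b (rem j s) x).
Proof.
elim: s => [|k s IH] //= /andP[ks us]; rewrite in_cons.
have [->|kj] := eqVneq j k; first by [].
by move=> /= js; rewrite IH//= factor_comm.
Qed.

Lemma fprod_idem b s x : uniq s -> fprod b s (fprod b s x) = fprod b s x.
Proof.
elim: s => [|k s IH] //= /andP[ks us].
by rewrite -fprod_factor// factor_idem IH.
Qed.

Lemma fprod_sa b s x y : uniq s -> ip (fprod b s x) y = ip x (fprod b s y).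
Proof.
elim: s x y => [|k s IH] x y //= /andP[ks us].
by rewrite factor_sa IH// fprod_factor.
Qed.

(** The product of both families rearranged variable by variable, so that one variable at a time can
    be removed. *)
Definition fprod2 s x := foldr (fun k y => factor true k (factor false k y)) x s.

Lemma fprod2E s x : uniq s -> fprod true s (fprod false s x) = fprod2 s x.
Proof.
elim: s => [|k s IH] //= /andP[ks us].
by rewrite -fprod_factor// IH.
Qed.

Lemma fprod2_lin s : is_linear (fprod2 s).
Proof. by elim: s => [|k s IH] c x y //=; rewrite IH !factor_lin. Qed.

Lemma fprod2_comm (F : H -> H) s :
  (forall b k x, k \in s -> F (factor b k x) = factor b k (F x)) ->
  forall x, F (fprod2 s x) = fprod2 s (F x).
Proof.
move=> FC x; elim: s FC => [|k s IH] FC //=.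
rewrite !FC ?mem_head// IH// => b l y ls; apply: FC.
by rewrite in_cons ls orbT.
Qed.

Lemma fprod_commute : (forall k x,
    factor true k (factor false k x) = factor false k (factor true k x)) ->
  forall s x, fprod true s (fprod false s x) = fprod false s (fprod true s x).
Proof.
move=> FC s x.
have FC' k l y : factor true k (factor false l y) = factor false l (factor true k y).
  by have [->|lk] := eqVneq l k; [exact: FC|exact: factor_comm].
by apply: fprod_comm => l y _; apply/esym; apply: fprod_comm => k z _; exact: (esym (FC' _ _ _)).
Qed.

Section peeling.
Variables (j : 'I_n) (C : H -> H).
Hypothesis C0 : C 0 = 0.
Hypothesis CT : forall k x, k != j -> C (T k x) = T k (C x).
Hypothesis CF : forall k x, k != j -> C (factor false k x) = factor false k (C x).

(* Applying [D0] to [T k (factor false k x)] and using that the range of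
   [factor true k] is invariant under [T k] gives
   [factor true k (wander k (factor false k (N x))) = 0]; on the kernel of [T k]
   the two outer operators then act as non-zero scalars. *)
Lemma peel s (D : H -> Prop) : uniq s -> j \notin s ->
  (forall k x, k \in s -> D x -> D (T k (factor false k x))) ->
  (forall x, D x -> fprod2 s (C x) = 0) ->
  forall x, D x -> (forall k, k \in s -> T k x = 0) -> C x = 0.
Proof.
elim: s D => [|k s IH] D /=; first by move=> _ _ _ D0 x Dx _; exact: D0.
move=> /andP[ks us]; rewrite in_cons negb_or => /andP[jk js] DT D0 x Dx x0.
have kj : k != j by rewrite eq_sym.
pose N y := fprod2 s (C y).
have sk l : l \in s -> k != l by move=> ls; apply: contraNneq ks => ->.
have NT y : N (T k y) = T k (N y).
  rewrite /N CT// -(@fprod2_comm (T k) s)// => b l z ls.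
  by rewrite -factor_T ?sk.
have NF y : N (factor false k y) = factor false k (N y).
  rewrite /N CF// -(@fprod2_comm (factor false k) s)// => b l z ls.
  by rewrite factor_comm// eq_sym sk.
(* [D] accumulates the restrictions made so far: from here on only functions free of z_k occur.
   Their stability under [T l] after [factor false l] supplies the test vectors for the next
   variable. *)
apply: (IH (fun y => D y /\ T k y = 0)) => //; last first.
- by move=> l ls; apply: x0; rewrite in_cons ls orbT.
- by split => //; apply: x0; rewrite mem_head.
- move=> y [Dy y0]; rewrite -/(N y).
  have QQ : factor true k (factor false k (N y)) = 0 by exact: D0.
  have QTQ : factor true k (T k (factor false k (N y))) = 0.
    have := D0 _ (DT k y (mem_head _ _) Dy).
    by rewrite -/(N _) NT NF -T_factor.
  have QSTQ : factor true k (S k (T k (factor false k (N y)))) = 0.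
    by rewrite factor_Sk QTQ (is_linear0 (sh_lin hS k)) (is_linear0 (factor_lin true k)).
  have Ny0 : T k (N y) = 0.
    by rewrite -NT y0 /N C0; exact: (is_linear0 (fprod2_lin s)).
  have [a [a0 aP]] := factor_ker false k; have [a' [a0' aP']] := factor_ker true k.
  have Q0 : factor true k (N y) = 0.
    apply: (scalerI a0); rewrite scaler0 -(is_linearZ (factor_lin true k)) -aP//.
    by rewrite /wander (is_linearB (factor_lin true k)) QQ QSTQ subrr.
  apply: (scalerI a0'); rewrite scaler0 -aP'// Q0.
  exact: (is_linear0 (wander_lin hH hS k)).
- move=> l y ls [Dy y0]; split; first by apply: DT => //; rewrite in_cons ls orbT.
  rewrite (T_comm hH hS) -factor_T ?sk// y0.
  by rewrite (is_linear0 (factor_lin false l)) (is_linear0 (T_lin l)).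
Qed.

End peeling.

Lemma commuting_fprod_division :
  (forall x, fprod true (enum 'I_n) (fprod false (enum 'I_n) x) =
             fprod false (enum 'I_n) (fprod true (enum 'I_n) x)) ->
  forall j, j \in L true -> j \in L false ->
  (exists h, V true j one = V false j h) \/ (exists h, V false j one = V true j h).
Proof.
move=> PP j jt jf; set E := enum 'I_n in PP.
have uE : uniq E by exact: enum_uniq.
have jE : j \in E by rewrite mem_enum.
pose s := rem j E; have us : uniq s by exact: rem_uniq.
have js : j \notin s by rewrite mem_rem_uniqF.
have sk k : k \in s = (k != j) by rewrite /s mem_rem_uniq// !inE mem_enum andbT.
pose A := fprod true s; pose B := fprod false s.
pose q := factor true j; pose q' := factor false j.
have Aq b x : factor b j (A x) = A (factor b j x) by exact: fprod_factor.
have Bq b x : factor b j (B x) = B (factor b j x) by exact: fprod_factor.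
pose C x := q (q' x) - q' (q x).
have AB x : A (B (q (q' x))) = B (A (q' (q x))).
  have E1 y : fprod true E y = q (A y) by exact: fprod_rem.
  have E2 y : fprod false E y = q' (B y) by exact: fprod_rem.
  by have := PP x; rewrite !E1 !E2 /q /q' Aq Bq Bq Bq Aq Aq.
have Alin : is_linear A by exact: fprod_lin.
have Blin : is_linear B by exact: fprod_lin.
(* As A and B need not commute, [AB] is applied at B x: its left side is unchanged since B is
   idempotent, and its right side becomes B A B q' q x. *)
have BABC x : B (A (B (C x))) = 0.
  rewrite /C (is_linearB Blin) (is_linearB Alin) (is_linearB Blin).
  apply/eqP; rewrite subr_eq0; apply/eqP.
  have AB' : A (B (q (q' x))) = B (A (B (q' (q x)))).
    have := AB (B x); rewrite /q /q' !Bq {1}/B fprod_idem//.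
  by rewrite AB' {1}/B fprod_idem.
(* For the projections A and B, |A B y|^2 = <y, B A B y>. *)
have ABC x : fprod2 s (C x) = 0.
  rewrite -fprod2E//; apply: (ip_eq0 hH).
  rewrite fprod_sa// fprod_idem// fprod_sa//.
  by have := BABC x; rewrite /A /B => ->; rewrite (ip0r hH).
have C0 x : one_var T j x -> C x = 0.
  move=> x1; apply: (@peel j C _ _ _ s (fun=> True)) => //.
  - by rewrite /C /q /q' !(is_linear0 (factor_lin _ _)) subrr.
  - move=> k y kj; rewrite /C /q /q' (is_linearB (T_lin k)).
    by rewrite !factor_T.
  - move=> k y kj; rewrite /C /q /q' (is_linearB (factor_lin false k)).
    by rewrite !(factor_comm _ _ _ kj).
  - by move=> k; rewrite sk; exact: x1.
have hVt := hV jt; have hVf := hV jf.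
apply: (one_variable_division hH hS hVt hVf) => [x|x /C0]; first exact: VC.
rewrite /C /q /q' /factor jt jf /coproj.
rewrite !(is_linearB (sm_lin hVt), is_linearB (sm_lin hVf),
  is_linearB (sm_Wlin hH hVt), is_linearB (sm_Wlin hH hVf)).
move/eqP; rewrite subr_eq0 => /eqP.
set a := V true j (W true j x); set a' := V false j (W false j x).
rewrite !opprB !addrA [x - a' + _ - _]addrAC [x - a + _ - _]addrAC.
by rewrite [x - a' - a]addrAC => /addrI.
Qed.

(** The range of [V (~~ b) j] lies in that of [V b j], so with E and E' the projections for [b] and
    [~~ b] one has E E' = E', and E' E = E' by taking adjoints. *)
Lemma factor_commute_division j (M : H -> H) b : j \in L b -> j \in L (~~ b) ->
  (forall x, V (~~ b) j x = V b j (M x)) ->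
  forall x, factor b j (factor (~~ b) j x) = factor (~~ b) j (factor b j x).
Proof.
move=> jb jb' VM x; have h := hV jb; have h' := hV jb'.
have E y : V b j (W b j (V (~~ b) j (W (~~ b) j y))) = V (~~ b) j (W (~~ b) j y).
  by rewrite VM (sm_WV hH h).
have E' y : V (~~ b) j (W (~~ b) j (V b j (W b j y))) = V (~~ b) j (W (~~ b) j y).
  apply: (ip_ext hH) => z.
  rewrite -(adjointr hH (sm_adj h')) (sm_adj h').
  rewrite -(adjointr hH (sm_adj h)) (sm_adj h).
  by rewrite E -(adjointr hH (sm_adj h')) (sm_adj h').
rewrite /factor jb jb' /coproj.
rewrite !(is_linearB (sm_lin h), is_linearB (sm_lin h'),
  is_linearB (sm_Wlin hH h), is_linearB (sm_Wlin hH h')).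
by rewrite E E' subrr subr0 opprB addrA subrK.
Qed.

End products.

Lemma complement_commutator (R : realType) (H : lmodType R[i]) (A B : H -> H) x :
  is_linear A -> is_linear B ->
  x - B x - A (x - B x) - (x - A x - B (x - A x)) = A (B x) - B (A x).
Proof.
move=> lA lB; rewrite (is_linearB lA) (is_linearB lB).
have E (a b c : H) : x - a - (b - c) = x - a - b + c by rewrite opprB addrA addrAC.
by rewrite !E [x - A x - B x]addrAC opprD addrACA subrr add0r.
Qed.

(** * Projections onto the submodules *)

Section hardy_shifts.
Context {R : realType} {n : nat}.
Notation H := (hardyT R n).
Notation fT := ('rV[R[i]]_n -> R[i]).
Implicit Types (F G : H) (p q f g : fT) (z w : 'rV[R[i]]_n).
Local Notation hH := (@hardy_hilbert R n).

Lemma hardy_shift_family : is_shift_family (ip := hip) (@shift R n) (@coshift R n) (@oneH R n).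
Proof.
split.
- exact: shift_linear.
- exact: n2_shift.
- exact: coshiftP.
- exact: shiftC.
- exact: shift_coshiftC.
- exact: coshift_one.
- exact: n2_one.
- exact: coshift_ker_const.
- exact: shift_pure.
Qed.

Lemma inner_shift_mult k p : inner p -> nonconstant p -> depends_only_on k p ->
  shift_mult (ip := hip) (@shift R n) (@coshift R n) k (mulH p) (adj (mulH p)).
Proof.
move=> ip nc pk; have mp := inner_multiplier ip; split.
- exact: mulH_linear.
- by move=> F; exact: n2_mulH_inner.
- exact: adjP.
- by move=> l F; exact: shift_mulH.
- by move=> l F lk; exact: (coshift_mulH _ mp pk lk).
- exists (taylor_coef k p); split; first exact: taylor_coef0_lt1.
  by move=> m F F0; exact: at_zero_iter_coshift.
Qed.

(* If [p = q h] then [M_h] is isometric, so [h] is bounded by [1]: test it on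
   reproducing kernels. *)
Lemma inner_quotient p q (h : H) : inner p -> inner q ->
  (forall z, polydisc z -> p z = q z * h z) -> inner h.
Proof.
move=> ip iq pqh; have mp := inner_multiplier ip; have mq := inner_multiplier iq.
have ah := hardy_analytic (hval_hardy h).
split => //.
  exists 1 => w wD; have [ak bk] := (cker_analytic wD, cker_bounded wD).
  have hk : hardy (fun z => cker z w * h z) by exact: hardy_mul_bounded (hval_hardy h).
  pose G := mkH hk.
  have nG : n2 hip G = n2 hip (kerH wD).
    rewrite -(n2_mulH_inner G iq) -(n2_mulH_inner (kerH wD) ip); congr (n2 hip _).
    by apply: hardyT_ext => z zD; rewrite !mulHE// !mkHE// pqh//; ring.
  pose K := n2 hip (kerH wD).
  have KE : hip (kerH wD) (kerH wD) = K%:C by exact: (ip_real hH).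
  have K0 : 0 < K.
    rewrite lt_neqAle eq_sym (n2_ge0 hH) andbT; apply/eqP => /(n2_eq0 hH) k0.
    have := mkHE (cker_hardy wD) polydisc0; rewrite -/(kerH wD) k0 h0E => /esym/eqP.
    rewrite (negbTE (cker_neq0 polydisc0 (sub_cpolydisc wD))) //.
  have hw : hip G (kerH wD) = h w * K%:C.
    by rewrite -KE !reproducing !mkHE// mulrC.
  have := hcauchy_schwarz hH G (kerH wD); rewrite hw nG -/K normcM normc_real (gtr0_norm K0).
  rewrite exprMn -expr2 -[leRHS]mul1r ler_pM2r ?exprn_gt0//.
  by rewrite expr_le1 ?normc_ge0.
have [_ _ aep] := ip; have [_ _ aeq] := iq.
apply: filterS2 aep aeq => t [l [pl l1]] [l' [ql l1']].
have l0' : l' != 0 by rewrite -normc_gt0 l1' ltr01.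
exists (l / l'); split; last by rewrite normcM normcV l1 l1' invr1 mulr1.
apply: cvg_trans (@ccvgM _ _ (1^'-) _ _ _ _ _ pl (@ccvgV _ _ (1^'-) _ _ _ l0' ql)).
apply: near_eq_cvg.
have rnear : \forall r \near (1 : R)^'-, 0 <= r < 1.
  near=> r; apply/andP; split; near: r; last exact: nbhs_left_lt.
  by apply: filterS (nbhs_left_gt (@ltr01 R)) => r /ltW.
(* The radial limit of [q] has modulus 1, so near the boundary [q] is non-zero along this radius and
   [h] equals p / q there. *)
have qnear : \forall r \near (1 : R)^'-, q (r%:C *: torus_point t) != 0.
  have /ccvgP /(_ 1 ltr01) := ql; apply: filterS => r; apply: contraTneq => ->.
  by rewrite sub0r normcN l1' ltxx.
apply: filterS2 rnear qnear => r r01 q0.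
rewrite pqh; last exact: polydiscZ r01 (cpolydisc_torus t).
by rewrite mulrAC mulfV// mul1r.
Unshelve. all: by end_near.
Qed.

Lemma hsumE (s : seq 'I_n) (P : pred 'I_n) (g : 'I_n -> H) z :
  (\sum_(l <- s | P l) g l) z = \sum_(l <- s | P l) g l z.
Proof. by elim/big_rec2: _ => // l x y _ <-. Qed.

Lemma hardy_inner_mkH f g (hf : hardy f) (hg : hardy g) :
  hardy_inner f g = hip (mkH hf) (mkH hg).
Proof.
apply: (@ccvg_unique _ _ \oo _ _ _ _ (hardy_inner_cvg hf hg)).
rewrite (_ : (fun m => _) =
  (fun m => tip (dil (rad m) (mkH hf)) (dil (rad m) (mkH hg)))).
  exact: hip_cvg.
apply/funext => m; apply: eq_tip => z zD; have rD := polydiscZ (rad01 m) zD.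
  by rewrite /dil (mkHE hf rD).
by rewrite /dil (mkHE hg rD).
Qed.

End hardy_shifts.

(** * The projections as complements of products *)

Section projections.
Context {R : realType} {n : nat}.
Notation H := (hardyT R n).
Notation fT := ('rV[R[i]]_n -> R[i]).
Implicit Types (F G : H) (f g : fT) (z w : 'rV[R[i]]_n).
Local Notation hH := (@hardy_hilbert R n).
Variables (L : bool -> {set 'I_n}) (p : bool -> 'I_n -> fT).
Hypothesis hp : forall b l, l \in L b ->
  [/\ inner (p b l), nonconstant (p b l) & depends_only_on l (p b l)].

Let V b l : H -> H := mulH (p b l).
Let W b l : H -> H := adj (V b l).
Let hS := @hardy_shift_family R n.

Let mp b l : l \in L b -> multiplier (p b l).
Proof. by move=> /hp[/inner_multiplier]. Qed.

Let hV b l : l \in L b -> shift_mult (ip := hip) (@shift R n) (@coshift R n) l (V b l) (W b l).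
Proof. by move=> /hp[ip nc pl]; exact: inner_shift_mult. Qed.

Let VC b b' k l F : k \in L b -> l \in L b' -> V b k (V b' l F) = V b' l (V b k F).
Proof. by move=> kL lL; apply: mulHC; exact: mp. Qed.

Let Q b F := fprod L V W b (enum 'I_n) F.

Definition in_sum b F := exists g : 'I_n -> H, F = \sum_(l in L b) mulH (p b l) (g l).

Lemma sum_submoduleP b f : sum_submodule (L b) (p b) f <->
  exists hf : hardy f, in_sum b (mkH hf).
Proof.
split=> [[hf [g hg fg]]|[hf [g fg]]].
  exists hf; exists (fun l => if pselect (hardy (g l)) is left hl then mkH hl else 0).
  apply: hardyT_ext => z zD; rewrite mkHE// fg// hsumE; apply: eq_bigr => l lL.
  rewrite mulHE//; last exact: mp.
  by case: pselect => [hl|[]]; [rewrite mkHE|exact: hg].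
split => //; exists g => [l _|z zD]; first exact: hval_hardy.
rewrite -(mkHE hf zD) fg hsumE; apply: eq_bigr => l lL.
by rewrite mulHE//; exact: mp.
Qed.

Lemma in_sumB b F G : in_sum b F -> in_sum b G -> in_sum b (F - G).
Proof.
move=> [f ->] [g ->]; exists (fun l => f l - g l); rewrite -sumrB.
by apply: eq_bigr => l lL; rewrite (is_linearB (mulH_linear (mp lL))).
Qed.

(** The difference telescopes: the k-th factor contributes V_k W_k y. The complement of the product
    thus lands in the algebraic sum itself, without taking a closure. *)
Lemma in_sum_fprod b F : in_sum b (F - Q b F).
Proof.
rewrite /Q; elim: (enum 'I_n) => [|k s [g IH]] /=.
  exists (fun=> 0); rewrite subrr big1// => l lL.
  exact: (is_linear0 (mulH_linear (mp lL))).
set y := fprod _ _ _ _ _ _ in IH *; rewrite /factor; case: ifP => kL; last by exists g.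
exists (fun l => g l + if l == k then W b k y else 0).
have -> : F - coproj (V := V b k) (W := W b k) y = F - y + V b k (W b k y).
  by rewrite /coproj opprB addrA addrAC.
rewrite IH [RHS](eq_bigr (fun l => mulH (p b l) (g l) +
    mulH (p b l) (if l == k then W b k y else 0))); last first.
  by move=> l lL; exact: (is_linearD (mulH_linear (mp lL))).
rewrite big_split /= ; congr (_ + _).
rewrite (bigD1 k)//= eqxx big1 ?addr0// => l /andP[lL /negbTE ->].
exact: (is_linear0 (mulH_linear (mp lL))).
Qed.

(** The l-th factor can be brought to the front of the product; being self-adjoint, it moves across
    and kills the summand in the range of [V b l]. *)
Lemma fprod_orthogonal b F G : in_sum b G -> hip (Q b F) G = 0.
Proof.
move=> [g ->]; have ipsum (I : seq 'I_n) (K : H) (h : 'I_n -> H) :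
    (forall l, l \in L b -> hip K (h l) = 0) -> hip K (\sum_(l <- I | l \in L b) h l) = 0.
  move=> h0; elim/big_ind: _ => [|x y x0 y0|l /h0//]; first exact: (ip0r hH).
  by rewrite (ipDr hH) x0 y0 addr0.
apply: ipsum => l lL; rewrite /Q.
rewrite (fprod_rem hH hS hV VC _ _ (enum_uniq _) (mem_enum _ l)).
rewrite (factor_sa hH hV) /factor lL (coproj_V hH (hV lL)).
exact: (ip0r hH).
Qed.

(** [hardy_proj] selects some element meeting the projection condition; F - Q F is one, which also
    shows that the default is not taken. The equality is between elements of [hardyT] because the
    selected function is arbitrary off the polydisc. *)
Lemma hardy_projP b f (hf : hardy f) : exists hg : hardy (hardy_proj (sum_submodule (L b) (p b)) f),
  mkH hg = mkH hf - Q b (mkH hf).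
Proof.
set S := sum_submodule _ _; pose F := mkH hf; pose G := F - Q b F.
have iG : in_sum b G by exact: in_sum_fprod.
have mkG g (hg : hardy g) : (forall z, polydisc z -> g z = G z) -> mkH hg = G.
  by move=> gG; apply: hardyT_ext => z zD; rewrite mkHE// gG.
have sub g (hg : hardy g) : exists hfg : hardy (fun z => f z - g z), mkH hfg = F - mkH hg.
  have hfg : hardy (fun z => f z - g z).
    by apply: eq_hardy (hval_hardy (F - mkH hg)) => z zD; rewrite hBE !mkHE.
  by exists hfg; apply: hardyT_ext => z zD; rewrite hBE !mkHE.
pose A := [set g | S g /\ forall h, S h -> hardy_inner (fun z => f z - g z) h = 0].
have AG : A (G : fT).
  split.
    apply/sum_submoduleP; exists (hval_hardy G).
    rewrite (mkG _ (hval_hardy G)) //.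
  move=> h /sum_submoduleP[hh ih]; have [hfg E] := sub _ (hval_hardy G).
  rewrite (hardy_inner_mkH hfg hh) E (mkG _ (hval_hardy G)) // /G subKr.
  exact: fprod_orthogonal.
have [] : A (hardy_proj S f) by rewrite /hardy_proj; apply: xgetPex; exists (hval G).
set g := hardy_proj S f => /sum_submoduleP[hg ig] go; exists hg.
apply/eqP; rewrite -subr_eq0 -/F -/G; apply/eqP/(ip_eq0 hH).
set D := mkH hg - G; have iD : in_sum b D by exact: in_sumB.
have SD : S (D : fT).
  apply/sum_submoduleP; exists (hval_hardy D).
  suff -> : mkH (hval_hardy D) = D by [].
  by apply: hardyT_ext => z zD; rewrite mkHE.
have := go _ SD; have [hfg E] := sub _ hg; rewrite (hardy_inner_mkH hfg (hval_hardy D)) E.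
have -> : mkH (hval_hardy D) = D by apply: hardyT_ext => z zD; rewrite mkHE.
(* Then 0 = <Q F - D, D> = - |D|^2, because Q F is orthogonal to the sum, which contains D. *)
have -> : F - mkH hg = Q b F - D by rewrite /D /G opprB addrA [Q b F + _]addrC subrK.
rewrite (ipBl hH) fprod_orthogonal// sub0r => /eqP; rewrite oppr_eq0 => /eqP.
by [].
Qed.

Lemma hardy_proj_commutator : zero_operator
    (commutator (hardy_proj (sum_submodule (L true) (p true)))
                (hardy_proj (sum_submodule (L false) (p false)))) <->
  forall F, Q true (Q false F) = Q false (Q true F).
Proof.
have PP b b' f (hf : hardy f) z : polydisc z ->
    hardy_proj (sum_submodule (L b) (p b)) (hardy_proj (sum_submodule (L b') (p b')) f) z =
    (mkH hf - Q b' (mkH hf) - Q b (mkH hf - Q b' (mkH hf))) z.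
  move=> zD; have [hg gE] := hardy_projP b' hf; have [hk kE] := hardy_projP b hg.
  by rewrite -(mkHE hk zD) kE gE.
have Qlin b : is_linear (Q b) by exact: (fprod_lin hH hV).
have CE f (hf : hardy f) z : polydisc z ->
    commutator (hardy_proj (sum_submodule (L true) (p true)))
                (hardy_proj (sum_submodule (L false) (p false))) f z =
    (Q true (Q false (mkH hf)) - Q false (Q true (mkH hf))) z.
  move=> zD; apply: etrans (f_equal (fun K : H => K z)
    (complement_commutator (mkH hf) (Qlin true) (Qlin false))).
  by rewrite /commutator (PP _ _ _ hf z zD) (PP _ _ _ hf z zD).
split=> [H0 F|QQ f hf z zD]; last by rewrite (CE f hf z zD) QQ subrr.
apply/eqP; rewrite -subr_eq0; apply/eqP/hardyT_ext => z zD.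
have FE : mkH (hval_hardy F) = F by apply: hardyT_ext => w wD; rewrite mkHE.
by have := CE _ (hval_hardy F) z zD; rewrite FE (H0 _ (hval_hardy F) z zD).
Qed.

Lemma commuting_projections_division :
  zero_operator
    (commutator (hardy_proj (sum_submodule (L true) (p true)))
                (hardy_proj (sum_submodule (L false) (p false)))) <->
  (forall j, j \in L true :&: L false ->
     inner_divides (p true j) (p false j) \/ inner_divides (p false j) (p true j)).
Proof.
rewrite hardy_proj_commutator; split=> [QQ j|divs F].
  rewrite inE => /andP[jt jf].
  (* Evaluating V 1 = V' h gives the factorization with [h] merely a Hardy function;
     [inner_quotient] shows that [h] is inner. *)
  have divs b b' : j \in L b -> j \in L b' -> (exists h : H, V b j (@oneH R n) = V b' j h) ->
      inner_divides (p b' j) (p b j).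
    move=> jb jb' [h Vh]; have ph z : polydisc z -> p b j z = p b' j z * h z.
      move=> zD; have := f_equal (fun G : H => G z) Vh.
      by rewrite /= (mulHE _ (mp jb) zD) (mulHE _ (mp jb') zD) oneE// mulr1.
    exists h; split => //; have [ib _ _] := hp jb; have [ib' _ _] := hp jb'.
    exact: inner_quotient ib ib' ph.
  by have [/divs|/divs] := commuting_fprod_division hH hS hV VC QQ jt jf; [right; auto|left; auto].
apply: (fprod_commute hH hS hV VC) => k G.
have [kt|kt] := boolP (k \in L true); last by rewrite /factor (negbTE kt).
have [kf|kf] := boolP (k \in L false); last by rewrite /factor (negbTE kf).
have mul b b' h : k \in L b -> k \in L b' -> inner h ->
    (forall z, polydisc z -> p b' k z = p b k z * h z) ->
    forall x, V b' k x = V b k (mulH h x).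
  move=> kb kb' ih ph x; apply: hardyT_ext => z zD.
  by rewrite !mulHE ?ph ?mulrA//; [exact: inner_multiplier|exact: mp|exact: mp].
have [|[h [ih ph]]|[h [ih ph]]] := divs k; first by rewrite inE kt.
  apply: (factor_commute_division hH hV (b := true) kt kf) => x.
  exact: (mul true false h kt kf ih ph x).
apply/esym; apply: (factor_commute_division hH hV (b := false) kf kt) => x.
exact: (mul false true h kf kt ih ph x).
Qed.

End projections.

Theorem theorem1p6 (R : realType) (n : nat) (hn : (2 <= n)%N)
  (Lambda Gamma : {set 'I_n})
  (phi psi : 'I_n -> 'rV[R[i]]_n -> R[i])
  (hphi : forall l : 'I_n, l \in Lambda ->
     [/\ inner (phi l), nonconstant (phi l) & depends_only_on l (phi l)])
  (hpsi : forall t : 'I_n, t \in Gamma ->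
     [/\ inner (psi t), nonconstant (psi t) & depends_only_on t (psi t)]) :
  zero_operator (commutator (hardy_proj (sum_submodule Lambda phi))
                            (hardy_proj (sum_submodule Gamma psi)))
  <->
  (forall j : 'I_n, j \in Lambda :&: Gamma ->
     inner_divides (phi j) (psi j) \/ inner_divides (psi j) (phi j)).
Proof.
apply: (@commuting_projections_division R n
  (fun b => if b then Lambda else Gamma) (fun b => if b then phi else psi)).
by case.
Qed.
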